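(* Consider the stochastic master equation with zero control, $$d\rho_t=\Big(-i\omega[J_z,\rho_t]+M\big(J_z\rho_tJ_z-\tfrac12J_z^2\rho_t-\tfrac12\rho_tJ_z^2\big)\Big)dt+\sqrt{\eta M}\,\big(J_z\rho_t+\rho_tJ_z-2\mathrm{Tr}(J_z\rho_t)\rho_t\big)dW_t,\qquad\rho_0\in\mathcal S.$$ Then the set $\bar E:=\{\boldsymbol\rho_0,\dots,\boldsymbol\rho_{2J}\}$ is exponentially stable in mean and almost surely exponentially stable, with average and sample Lyapunov exponents less than or equal to $-\eta M/2$; that is, there is a constant $a>0$ such that for all $\rho_0\in\mathcal S$ and $t\ge0$, $$\mathbb E(d_B(\rho_t,\bar E))\le a\,d_B(\rho_0,\bar E)\,e^{-\frac{\eta M}2t},$$ and for all $\rho_0\in\mathcal S$, $$\limsup_{t\to\infty}\frac1t\log d_B(\rho_t,\bar E)\le-\frac{\eta M}2\quad\text{a.s.}$$ Moreover, for each $n\in\{0,\dots,2J\}$, the probability that $\rho_t$ converges to $\boldsymbol\rho_n$ as $t\to\infty$ is $\mathrm{Tr}(\rho_0\boldsymbol\rho_n)$.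
   Context: Fix an integer $N\ge2$, put $J=\frac{N-1}2$, and let $\{e_0,\dots,e_{2J}\}$ be an orthonormal basis of $\mathbb C^N$. $J_z$ is the self-adjoint matrix with $J_ze_n=(J-n)e_n$, $n\in\{0,\dots,2J\}$. Let $\mathcal S=\{\rho\in\mathbb C^{N\times N}\mid\rho=\rho^*,\ \mathrm{Tr}(\rho)=1,\ \rho\ge0\}$ and $\boldsymbol\rho_n=e_ne_n^*$. Parameters: $\eta\in(0,1]$, $M>0$, $\omega\ge0$. $[A,B]=AB-BA$. $W_t$ is a 1-dimensional standard Wiener process on a filtered probability space $(\Omega,\mathcal F,(\mathcal F_t),\mathbb P)$, with $(\mathcal F_t)$ its natural filtration. The equation has, for every $\rho_0\in\mathcal S$, a unique strong solution $\rho_t$, with values in $\mathcal S$. Bures distance: $d_B(\rho,\boldsymbol\rho_n)=\sqrt{2-2\sqrt{\mathrm{Tr}(\rho\boldsymbol\rho_n)}}$ and $d_B(\rho,\bar E)=\min_nd_B(\rho,\boldsymbol\rho_n)$. An invariant set $\bar E$ is exponentially stable in mean if for some positive constants $a,b$ one has $\mathbb E(d_B(\rho_t,\bar E))\le a\,d_B(\rho_0,\bar E)e^{-bt}$ for every $\rho_0\in\mathcal S$ (the smallest such $-b$ is the average Lyapunov exponent); it is almost surely exponentially stable if $\limsup_{t\to\infty}\frac1t\log d_B(\rho_t,\bar E)<0$ a.s. for every $\rho_0\in\mathcal S$ (the left-hand side is the sample Lyapunov exponent; $\log0=-\infty$). *)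

(* Defs.v *)
From HB Require Import structures.
From mathcomp Require Import all_boot all_order all_algebra.
From mathcomp Require Import complex.
From mathcomp Require Import all_classical all_reals all_analysis.
Set Implicit Arguments.
Unset Strict Implicit.
Unset Printing Implicit Defensive.
Import Order.TTheory GRing.Theory Num.Theory.
Import numFieldNormedType.Exports.
Local Open Scope classical_set_scope.
Local Open Scope ring_scope.
Local Open Scope complex_scope.
Local Open Scope sesquilinear_scope.

(** Processes are functions [R -> Omega -> _]; only times [t >= 0] matter. *)

Section Stochastic.
Context {R : realType} {d : measure_display} {Omega : measurableType d}.
Variable P : probability Omega R.

(** The natural filtration of [W], augmented as usual by the null events. *)
Definition natural_filtration (W : R -> Omega -> R) (t : R) : set (set Omega) :=
  <<s [set A | exists (s : R) (B : set R),
             [/\ 0 <= s, s <= t, measurable B & A = W s @^-1` B]]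
      `|` [set A | measurable A /\ P A = 0%E] >>.

Definition adapted (F : R -> set (set Omega)) (X : R -> Omega -> R) : Prop :=
  forall t : R, 0 <= t -> forall B : set R, measurable B -> F t (X t @^-1` B).

(** The second argument of [normal_prob] is the standard deviation. *)
Record standard_wiener (F : R -> set (set Omega)) (W : R -> Omega -> R) : Prop := {
  wiener_measurable : forall t : R, 0 <= t -> measurable_fun setT (W t);
  wiener_adapted : adapted F W;
  wiener_start : {ae P, forall w, W 0 w = 0};
  wiener_continuous : {ae P, forall w, {within `[0, +oo[, continuous (W ^~ w)}};
  wiener_gaussian : forall s t : R, 0 <= s -> s < t ->
    forall B : set R, measurable B ->
      P [set w | B (W t w - W s w)] = normal_prob 0 (Num.sqrt (t - s)) B;
  wiener_independent : forall s t : R, 0 <= s -> s < t ->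
    forall (A : set Omega) (B : set R), F s A -> measurable B ->
      P (A `&` [set w | B (W t w - W s w)])
        = (P A * P [set w | B (W t w - W s w)%R])%E
}.

(** The elementary process
    [\sum_(k < steps) coef k * 1_[node k, node k.+1[]. *)
Record elementary := Elementary {
  steps : nat;
  node : nat -> R;
  coef : nat -> Omega -> R
}.

Record elementary_on (F : R -> set (set Omega)) (t : R) (phi : elementary)
    : Prop := {
  elementary_start : node phi 0%N = 0;
  elementary_end : node phi (steps phi) = t;
  elementary_nodes : forall k, (k < steps phi)%N ->
    node phi k <= node phi k.+1;
  elementary_coef : forall k, (k < steps phi)%N ->
    forall B : set R, measurable B -> F (node phi k) (coef phi k @^-1` B);
  elementary_bounded : forall k, (k < steps phi)%N ->
    exists K : R, forall w, `|coef phi k w| <= K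
}.

Definition elementary_val (phi : elementary) (s : R) (w : Omega) : R :=
  \sum_(k < steps phi)
    coef phi k w * \1_(`[node phi k, node phi k.+1[%classic) s.

Definition elementary_int (W : R -> Omega -> R) (phi : elementary) (w : Omega)
    : R :=
  \sum_(k < steps phi)
    coef phi k w * (W (node phi k.+1) w - W (node phi k) w).

(** [I] is a version of the Ito integral of [H] against [W] over [[0, t]]: the
    L2(P)-limit of the integrals of elementary processes that converge to [H]
    in L2(P x ds). By the Ito isometry [I] is unique up to a null event and
    does not depend on the approximating sequence. *)
Definition is_ito_integral (F : R -> set (set Omega)) (W : R -> Omega -> R)
    (H : R -> Omega -> R) (t : R) (I : Omega -> R) : Prop :=
  [/\ adapted F H,
      measurable_fun (`[0, t] `*` [set: Omega]) (fun z : R * Omega => H z.1 z.2),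
      measurable_fun setT I
    & exists phi : nat -> elementary,
      [/\ forall m, elementary_on F t (phi m),
          (\int[P]_w \int[lebesgue_measure]_(s in `[0%R, t])
             ((elementary_val (phi m) s w - H s w) ^+ 2)%R%:E)%E
            @[m --> \oo] --> 0%E
        & (\int[P]_w ((elementary_int W (phi m) w - I w) ^+ 2)%R%:E)%E
            @[m --> \oo] --> 0%E]].

(** Complex matrices are integrated entrywise, real and imaginary parts
    separately. *)
Definition adapted_mx N (F : R -> set (set Omega))
    (X : R -> Omega -> 'M[R[i]]_N) : Prop :=
  forall k l, adapted F (fun t w => complex.Re (X t w k l)) /\
              adapted F (fun t w => complex.Im (X t w k l)).

Definition is_ito_integral_mx N (F : R -> set (set Omega)) (W : R -> Omega -> R)
    (H : R -> Omega -> 'M[R[i]]_N) (t : R) (I : Omega -> 'M[R[i]]_N) : Prop :=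
  forall k l,
    is_ito_integral F W (fun s w => complex.Re (H s w k l)) t
                        (fun w => complex.Re (I w k l)) /\
    is_ito_integral F W (fun s w => complex.Im (H s w k l)) t
                        (fun w => complex.Im (I w k l)).

Definition integral_mx N (t : R) (f : R -> 'M[R[i]]_N) : 'M[R[i]]_N :=
  \matrix_(k, l)
    ((\int[lebesgue_measure]_(s in `[0, t]) complex.Re (f s k l)) +i*
     (\int[lebesgue_measure]_(s in `[0, t]) complex.Im (f s k l))).

(** The library's norm topology on [R[i]] is only found through its
    [numFieldType] structure, hence the casts. *)
Definition continuous_path N (x : R -> 'M[R[i]]_N) : Prop :=
  {within `[0 : R, +oo[, continuous (x : R -> 'M[(R[i] : numFieldType)]_N)}.

Definition path_converges N (x : R -> 'M[R[i]]_N) (l : 'M[R[i]]_N) : Prop :=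
  (x : R -> 'M[(R[i] : numFieldType)]_N) t @[t --> +oo]
    --> (l : 'M[(R[i] : numFieldType)]_N).

(** [X] is a solution with values in [S] of
    [dX = b X dt + sigma X dW, X_0 = x0]. Paths are continuous for every
    outcome, so that [X_t --> x] is an event even if [P] is not complete. *)
Record solution_in N (F : R -> set (set Omega)) (W : R -> Omega -> R)
    (b sigma : 'M[R[i]]_N -> 'M[R[i]]_N) (S : set 'M[R[i]]_N)
    (x0 : 'M[R[i]]_N) (X : R -> Omega -> 'M[R[i]]_N) : Prop := {
  solution_state : forall (t : R) w, 0 <= t -> S (X t w);
  solution_start : forall w, X 0 w = x0;
  solution_continuous : forall w, continuous_path (X ^~ w);
  solution_adapted : adapted_mx F X;
  solution_sde : forall t : R, 0 <= t ->
    is_ito_integral_mx F W (fun s w => sigma (X s w)) t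
      (fun w => X t w - x0 - integral_mx t (fun s => b (X s w)))
}.

End Stochastic.

Section Quantum.
Context {R : realType} {N : nat}.
Local Notation C := R[i].

Definition density : set 'M[C]_N :=
  [set rho | [/\ rho = rho ^t*, \tr rho = 1
               & forall v : 'cV[C]_N, 0 <= (v ^t* *m rho *m v) 0 0]].

(** [N] orthonormal vectors of [C^N] automatically form a basis. *)
Definition orthonormal_basis (e : 'I_N -> 'cV[C]_N) : Prop :=
  forall n m, ((e n) ^t* *m e m) 0 0 = (n == m)%:R.

Definition pure (v : 'cV[C]_N) : 'M[C]_N := v *m v ^t*.

Definition is_Jz (e : 'I_N -> 'cV[C]_N) (Jz : 'M[C]_N) : Prop :=
  Jz = Jz ^t* /\
  forall n : 'I_N, Jz *m e n = ((N%:R - 1) / 2 - n%:R) *: e n.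

Definition bracket (A B : 'M[C]_N) : 'M[C]_N := A *m B - B *m A.

Definition sme_drift (omega M : R) (Jz rho : 'M[C]_N) : 'M[C]_N :=
  - ('i * omega%:C) *: bracket Jz rho
  + M%:C *: (Jz *m rho *m Jz - 2^-1 *: (Jz *m Jz *m rho)
                             - 2^-1 *: (rho *m Jz *m Jz)).

Definition sme_diffusion (eta M : R) (Jz rho : 'M[C]_N) : 'M[C]_N :=
  (Num.sqrt (eta * M))%:C *:
    (Jz *m rho + rho *m Jz - (2 * \tr (Jz *m rho)) *: rho).

(** The Bures distance; this formula is the one for a pure state [sigma], and
    the trace is then real. *)
Definition bures (rho sigma : 'M[C]_N) : R :=
  Num.sqrt (2 - 2 * Num.sqrt (complex.Re (\tr (rho *m sigma)))).

(** For the finite set of pure states below, [inf] is a minimum. *)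
Definition bures_set (rho : 'M[C]_N) (E : set 'M[C]_N) : R :=
  inf [set bures rho sigma | sigma in E].

Definition pure_states (e : 'I_N -> 'cV[C]_N) : set 'M[C]_N :=
  [set pure (e n) | n in [set: 'I_N]].

End Quantum.

(** [Sol rho0 rho] means that [rho] is the solution issued from [rho0]. *)

Section Stability.
Context {R : realType} {d : measure_display} {Omega : measurableType d}.
Variable P : probability Omega R.
Context {N : nat}.
Variable Sol : 'M[R[i]]_N -> (R -> Omega -> 'M[R[i]]_N) -> Prop.
Variable E : set 'M[R[i]]_N.

Definition invariant_set : Prop :=
  forall rho0 rho, E rho0 -> Sol rho0 rho ->
    {ae P, forall w, forall t : R, 0 <= t -> E (rho t w)}.

Definition mean_bound (a b : R) : Prop :=
  forall rho0 rho, density rho0 -> Sol rho0 rho -> forall t : R, 0 <= t ->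
    ('E_P[fun w => bures_set (rho t w) E]
       <= (a * bures_set rho0 E * expR (- b * t))%:E)%E.

Definition exponentially_stable_in_mean : Prop :=
  invariant_set /\ exists a b : R, [/\ 0 < a, 0 < b & mean_bound a b].

(** [lne 0 = -oo]. *)
Definition sample_lyapunov (path : R -> 'M[R[i]]_N) : \bar R :=
  limf_esup (fun t : R => ((t^-1)%:E * lne (bures_set (path t) E)%:E)%E)
            (pinfty_nbhs R).

Definition almost_surely_exponentially_stable : Prop :=
  invariant_set /\
  forall rho0 rho, density rho0 -> Sol rho0 rho ->
    {ae P, forall w, (sample_lyapunov (rho ^~ w) < 0)%E}.

End Stability.

(* Main.v *)
(** Let [p_n := Tr (rho_t rho_n)] be the populations. The Hamiltonian and
    dissipative parts of the equation do not act on them, so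
    [d p_n = 2 sqrt (eta M) (l_n - sum_m l_m p_m) p_n dW] with [l_n] the
    eigenvalues of [J_z]. Each [p_n] is a martingale, and for [n != m] the drift
    of [sqrt (p_n p_m)] is [- (eta M / 2) (l_n - l_m)^2 sqrt (p_n p_m)], with
    [(l_n - l_m)^2 >= 1]. Hence [V := sum_(n != m) sqrt (p_n p_m)] is such that
    [e^(eta M t / 2) V] is a nonnegative supermartingale: this bounds [E V], and
    by the maximal inequality [V = O(e^(- eta M t / 2))] almost surely. As [V]
    is equivalent to the Bures distance to the set of pure states, stability
    follows. Finally [p_n (1 - p_n) <= V] tends to [0], so by continuity [p_n]
    tends to [0] or [1] almost surely, and the probability of the limit [1] is
    the conserved mean of [p_n].

    Ito's formula is not used for the drift of [sqrt (p_n p_m)]: over a short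
    interval it is bounded by AM-GM with weights [e^(- k dW)] and [e^(k dW)],
    [k := sqrt (eta M) (l_n - l_m)], whose Gaussian expectations produce the
    factor [e^(- k^2 h / 2)]. *)

Require Import Defs.
From HB Require Import structures.
From mathcomp Require Import all_boot all_order all_algebra.
From mathcomp Require Import complex.
From mathcomp Require Import all_classical all_reals all_analysis.
From mathcomp Require Import measurable_realfun ring lra.
Set Implicit Arguments.
Unset Strict Implicit.
Unset Printing Implicit Defensive.
Import Order.TTheory GRing.Theory Num.Theory.
Import numFieldNormedType.Exports.
Local Open Scope classical_set_scope.
Local Open Scope ring_scope.

(** * Square-integrable random variables *)

(** The Ito integral is given only as an L2-limit of elementary integrals, separately for each end
    time, and the approximations at two times are unrelated. All that is extracted from it is
    [expands]: over [[s, t]] the increment is [a_s dW] plus a remainder that has mean zero against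
    bounded [F s]-measurable variables and variance [o(t - s)], uniformly for [t <= T]. In the AM-GM
    bound this remainder meets an exponential of [dW]; having mean zero, it allows the exponential
    to be lowered by 1, which leaves a factor of order [sqrt (t - s)] in L2. Each remainder thus
    costs at most a small multiple of [t - s], and these costs add up over a subdivision. The AM-GM
    weight [sqrt (p_m / p_n)] is unbounded; adding [q ^+ 2] to both populations bounds it by [2 / q]
    and costs an error of order [q]. So [q] is fixed first, the mesh is chosen in terms of [q], and
    [q] tends to 0 at the end. Conditional expectations are avoided: supermartingales are tested
    against events of [F s], which are carried through the estimates as indicators. *)

Lemma quadratic_discriminant (R : realFieldType) (a b c : R) :
  0 <= c -> (forall r, 0 <= a + 2 * r * b + r ^+ 2 * c) -> b ^+ 2 <= a * c.
Proof.
move=> c0 H.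
have [cz|cn] := eqVneq c 0.
  have a0 := H 0; rewrite !(mulr0, mul0r, expr0n, addr0) /= in a0.
  rewrite cz mulr0; have [->|bn] := eqVneq b 0; first by rewrite expr0n.
  (* With [c = 0] the polynomial is affine; at this [r] its value is [-1], a contradiction. *)
  have := H (- (a + 1) / (2 * b)); rewrite cz mulr0 addr0.
  have -> : 2 * (- (a + 1) / (2 * b)) * b = - (a + 1) by field.
  lra.
have cp : 0 < c by rewrite lt_def cn.
(* The minimiser of the quadratic. *)
have := H (- b / c).
have -> : a + 2 * (- b / c) * b + (- b / c) ^+ 2 * c = (a * c - b ^+ 2) / c.
  by field.
by rewrite pmulr_lge0 ?invr_gt0 // subr_ge0.
Qed.

Section RealExpectation.
Context {R : realType} {d : measure_display} {Omega : measurableType d}.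
Variable P : probability Omega R.
Implicit Types X Y Z : Omega -> R.

Definition integ X := P.-integrable setT (EFin \o X).
(** The extended integral is cut down to a real number, an infinite value becoming 0; hence the
    integrability hypotheses in the linearity lemmas. *)
Definition ex X : R := \int[P]_w X w.
Definition sqint X := measurable_fun setT X /\ integ (fun w => X w ^+ 2).

Lemma integ_measurable X : integ X -> measurable_fun setT X.
Proof. by move=> /measurable_int /measurable_EFinP. Qed.

Lemma integD X Y : integ X -> integ Y -> integ (fun w => X w + Y w).
Proof.
move=> iX iY; have := @integrableD _ _ _ P setT measurableT _ _ iX iY.
by apply: eq_integrable.
Qed.

Lemma integZ k X : integ X -> integ (fun w => k * X w).
Proof.
move=> iX; have := @integrableZl _ _ _ P setT measurableT k _ iX.
by apply: eq_integrable.
Qed.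

Lemma integB X Y : integ X -> integ Y -> integ (fun w => X w - Y w).
Proof.
move=> iX iY; have := @integrableB _ _ _ P setT measurableT _ _ iX iY.
by apply: eq_integrable.
Qed.

Lemma integ_bounded K X : measurable_fun setT X -> (forall w, `|X w| <= K) ->
  integ X.
Proof.
move=> mX bX; apply: measurable_bounded_integrable => //.
  exact: (le_lt_trans (probability_le1 P measurableT) (ltry 1)).
exists K; split; first exact: num_real.
by move=> x Kx w _; apply: (le_trans (bX w)); exact: ltW.
Qed.

Lemma integ_cst k : integ (fun=> k).
Proof. by apply: (@integ_bounded `|k|). Qed.

Lemma le_integ X Y : measurable_fun setT X -> (forall w, `|X w| <= Y w) ->
  integ Y -> integ X.
Proof.
move=> mX XY iY; apply: (le_integrable _ _ _ iY) => //.
  exact/measurable_EFinP.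
move=> w _ /=; rewrite lee_fin (le_trans (XY w))// ler_norm //.
Qed.

Lemma integ_sum I (s : seq I) (X : I -> Omega -> R) :
  (forall i, integ (X i)) -> integ (fun w => \sum_(i <- s) X i w).
Proof.
move=> iX; elim: s => [|i s ih].
  by under eq_fun do rewrite big_nil; exact: integ_cst.
by under eq_fun do rewrite big_cons; exact: integD.
Qed.

Lemma exD X Y : integ X -> integ Y ->
  ex (fun w => X w + Y w) = ex X + ex Y.
Proof. by move=> iX iY; rewrite /ex RintegralD. Qed.

Lemma exB X Y : integ X -> integ Y ->
  ex (fun w => X w - Y w) = ex X - ex Y.
Proof. by move=> iX iY; rewrite /ex RintegralB. Qed.

Lemma exZ k X : integ X -> ex (fun w => k * X w) = k * ex X.
Proof. by move=> iX; rewrite /ex RintegralZl. Qed.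

Lemma ex_cst k : ex (fun=> k) = k.
Proof.
rewrite /ex Rintegral_cst//.
have -> : fine (P setT) = 1 by exact: (congr1 fine (probability_setT P)).
by rewrite mulr1.
Qed.

Lemma ex_sum I (s : seq I) (X : I -> Omega -> R) : (forall i, integ (X i)) ->
  ex (fun w => \sum_(i <- s) X i w) = \sum_(i <- s) ex (X i).
Proof.
move=> iX; elim: s => [|i s ih].
  rewrite big_nil -[RHS](ex_cst 0); congr ex; apply/funext => w.
  by rewrite big_nil.
rewrite big_cons -ih -exD //; last exact: integ_sum.
by congr ex; apply/funext => w; rewrite big_cons.
Qed.

Lemma ex_le X Y : integ X -> integ Y -> (forall w, X w <= Y w) -> ex X <= ex Y.
Proof. by move=> iX iY XY; apply: le_Rintegral. Qed.

Lemma ex_ge0 X : (forall w, 0 <= X w) -> 0 <= ex X.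
Proof. by move=> X0; apply: Rintegral_ge0. Qed.

Lemma exE X : integ X -> (ex X)%:E = (\int[P]_w (X w)%:E)%E.
Proof.
move=> iX; rewrite /ex /Rintegral fineK //.
exact: (integrable_fin_num _ iX).
Qed.

Lemma eq_ex X Y : X =1 Y -> ex X = ex Y.
Proof. by move=> XY; congr ex; apply/funext. Qed.

Lemma ex_norm X : integ X -> `|ex X| <= ex (fun w => `|X w|).
Proof. by move=> iX; rewrite /ex le_normr_Rintegral. Qed.

Lemma ex_norm_le K X : measurable_fun setT X -> (forall w, `|X w| <= K) ->
  `|ex X| <= K.
Proof.
move=> mX bX; have iX := integ_bounded mX bX.
apply: (le_trans (ex_norm iX)); rewrite -[leRHS]ex_cst; apply: ex_le => //.
- by apply: (le_integ _ _ (integ_cst K)) => [|w];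
    [exact: measurableT_comp|rewrite normr_id].
- exact: integ_cst.
Qed.

Lemma sqint_bounded K X : measurable_fun setT X -> (forall w, `|X w| <= K) ->
  sqint X.
Proof.
move=> mX bX; split=> //; apply: (@integ_bounded (K ^+ 2)).
  exact: measurable_funX.
by move=> w; rewrite normrX lerXn2r ?nnegrE // (le_trans _ (bX w)).
Qed.

Lemma sqint_mul X Y : sqint X -> sqint Y -> integ (fun w => X w * Y w).
Proof.
move=> [mX iX] [mY iY]; apply: (le_integ _ _ (integD iX iY)).
  exact: measurable_funM.
move=> w /=; rewrite normrM.
rewrite -[X w ^+ 2]real_normK ?num_real // -[Y w ^+ 2]real_normK ?num_real //.
have := sqr_ge0 (`|X w| - `|Y w|); have := normr_ge0 (X w); have := normr_ge0 (Y w).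
nra.
Qed.

Lemma sqint_integ X : sqint X -> integ X.
Proof.
move=> sX; have s1 := sqint_bounded (@measurable_cst _ _ _ _ setT (1 : R)) (fun=> lexx `|1 : R|).
have := sqint_mul sX s1.
by under eq_fun do rewrite mulr1.
Qed.

Lemma sqintZ k X : sqint X -> sqint (fun w => k * X w).
Proof.
move=> [mX iX]; split; first exact: measurable_funM.
by under eq_fun do rewrite exprMn; exact: integZ.
Qed.

Lemma sqintD X Y : sqint X -> sqint Y -> sqint (fun w => X w + Y w).
Proof.
move=> sX sY; have [mX iX] := sX; have [mY iY] := sY; split.
  exact: measurable_funD.
under eq_fun do rewrite sqrrD -mulr_natl.
by apply: integD => //; apply: integD => //; apply/integZ/sqint_mul.
Qed.

Lemma sqintB X Y : sqint X -> sqint Y -> sqint (fun w => X w - Y w).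
Proof.
move=> sX /(sqintZ (-1)) /(sqintD sX).
by under eq_fun do rewrite mulN1r.
Qed.

Lemma sqint_sum I (s : seq I) (X : I -> Omega -> R) :
  (forall i, sqint (X i)) -> sqint (fun w => \sum_(i <- s) X i w).
Proof.
move=> iX; elim: s => [|i s ih].
  under eq_fun do rewrite big_nil.
  by apply: (@sqint_bounded 0) => // w; rewrite normr0.
by under eq_fun do rewrite big_cons; exact: sqintD.
Qed.

Lemma sqint_mul_bounded K X Y : measurable_fun setT Y ->
  (forall w, `|Y w| <= K) -> sqint X -> sqint (fun w => Y w * X w).
Proof.
move=> mY bY [mX iX]; split; first exact: measurable_funM.
apply: (le_integ _ _ (integZ (K ^+ 2) iX)).
  by apply: measurable_funX; exact: measurable_funM.
move=> w; rewrite exprMn normrM ler_pM // normrX.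
  by rewrite lerXn2r ?nnegrE // (le_trans _ (bY w)).
by rewrite real_normK ?num_real.
Qed.

Lemma integ_mul_bounded K X Y : measurable_fun setT Y ->
  (forall w, `|Y w| <= K) -> integ X -> integ (fun w => Y w * X w).
Proof.
move=> mY bY iX; have K0 : 0 <= K by exact: le_trans (bY point).
apply: (le_integ _ _ (integZ K _)) => [|w|].
- by apply: measurable_funM => //; exact: integ_measurable.
- by rewrite normrM; apply: ler_wpM2r => //; exact: bY.
- have := integrable_norm iX; exact.
Qed.

(** Discriminant of the nonnegative quadratic [r |-> E (X + r Y)^2]. *)
Lemma cauchy_schwarz X Y : sqint X -> sqint Y ->
  ex (fun w => X w * Y w) ^+ 2 <=
  ex (fun w => X w ^+ 2) * ex (fun w => Y w ^+ 2).
Proof.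
move=> sX sY; apply: quadratic_discriminant.
  by apply: ex_ge0 => w; exact: sqr_ge0.
move=> r; have iXY := sqint_mul sX sY; have [_ iX] := sX; have [_ iY] := sY.
rewrite -!exZ// -exD//; [|exact: integZ].
rewrite -exD//; [|by apply: integD => //; exact: integZ|exact: integZ].
apply: ex_ge0 => w.
have -> : X w ^+ 2 + 2 * r * (X w * Y w) + r ^+ 2 * Y w ^+ 2 =
  (X w + r * Y w) ^+ 2 by ring.
exact: sqr_ge0.
Qed.

Lemma ex_mul_le a b X Y : sqint X -> sqint Y -> 0 <= a -> 0 <= b ->
  ex (fun w => X w ^+ 2) <= a ^+ 2 -> ex (fun w => Y w ^+ 2) <= b ^+ 2 ->
  `|ex (fun w => X w * Y w)| <= a * b.
Proof.
move=> sX sY a0 b0 Xa Yb.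
rewrite -(@ler_pXn2r _ 2) ?nnegrE ?mulr_ge0 // real_normK ?num_real //.
apply: (le_trans (cauchy_schwarz sX sY)); rewrite exprMn ler_pM //.
  by apply: ex_ge0 => w; exact: sqr_ge0.
by apply: ex_ge0 => w; exact: sqr_ge0.
Qed.

Lemma ex_sqrD X Y : sqint X -> sqint Y ->
  ex (fun w => (X w + Y w) ^+ 2) <=
  2 * ex (fun w => X w ^+ 2) + 2 * ex (fun w => Y w ^+ 2).
Proof.
move=> sX sY; have [_ iX] := sX; have [_ iY] := sY.
rewrite -!exZ // -exD //; try exact: integZ.
apply: ex_le.
- by have [] := sqintD sX sY.
- by apply: integD; exact: integZ.
- by move=> w; have := sqr_ge0 (X w - Y w); nra.
Qed.

Lemma ex_dominated K (X_ : nat -> Omega -> R) X :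
  (forall n, measurable_fun setT (X_ n)) -> measurable_fun setT X ->
  (forall n w, `|X_ n w| <= K) ->
  {ae P, forall w, X_ n w @[n --> \oo] --> X w} ->
  ex (X_ n) @[n --> \oo] --> ex X.
Proof.
move=> mX_ mX bX cX.
have [//|||||iX _ H] := @dominated_convergence _ _ _ P setT measurableT
    (fun n w => (X_ n w)%:E) (fun w => (X w)%:E) (fun=> K%:E).
- by move=> n; exact/measurable_EFinP.
- exact/measurable_EFinP.
- apply: filterS cX => w /= cX _; apply: cvg_EFin => //; exact: nearW.
- exact: integ_cst.
- by apply: aeW => w n _; rewrite /= lee_fin.
by apply: fine_cvg; rewrite fineK //; exact: (integrable_fin_num _ iX).
Qed.

End RealExpectation.

(** * Wiener increments *)

Section Gaussian.
Context {R : realType} {d : measure_display} {Omega : measurableType d}.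
Variable P : probability Omega R.

(** The Radon-Nikodym derivative of the normal law agrees almost everywhere with [normal_pdf], since
    both have the same integral over every measurable set; the change of variables holds for the
    former. *)
Lemma normal_prob_integral (s : R) (f : R -> \bar R) :
  (forall x, 0 <= f x)%E -> measurable_fun setT f ->
  (\int[normal_prob 0 s]_x f x =
   \int[lebesgue_measure]_x (f x * (normal_pdf 0 s x)%:E))%E.
Proof.
move=> f0 mf.
have dom := normal_prob_dominates 0 s.
rewrite -(Radon_Nikodym_SigmaFinite.change_of_variables dom f0 measurableT mf).
have mg := measurable_int _ (Radon_Nikodym_SigmaFinite.f_integrable dom).
have mp : measurable_fun setT (fun x : R => (normal_pdf 0 s x)%:E).
  by apply/measurable_EFinP; exact: measurable_normal_pdf.
apply: ae_eq_integral => //; try exact: emeasurable_funM.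
apply: ae_eqe_mul2l; apply: integral_ae_eq => //.
  exact: Radon_Nikodym_SigmaFinite.f_integrable.
by move=> A _ mA; rewrite -Radon_Nikodym_SigmaFinite.f_integral.
Qed.

Variables (Z : Omega -> R) (h : R).
Hypothesis h0 : 0 < h.
Hypothesis mZ : measurable_fun setT Z.
Hypothesis lawZ : forall B : set R, measurable B ->
  P [set w | B (Z w)] = normal_prob 0 (Num.sqrt h) B.

(** Completing the square: [e^(k x)] times the density of variance [h] is [e^(k^2 h / 2)] times the
    same density recentred at [k h], which has mass 1. *)
Lemma gauss_integral_expR k :
  (\int[P]_w (expR (k * Z w))%:E = (expR (k ^+ 2 * h / 2))%:E)%E.
Proof.
have s0 : Num.sqrt h != 0 by rewrite gt_eqF // sqrtr_gt0.
have mexp : measurable_fun setT (fun x : R => (expR (k * x))%:E).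
  by apply/measurable_EFinP; apply: measurableT_comp => //; exact: measurable_funM.
pose Zm : {mfun Omega >-> measurableTypeR R} :=
  HB.pack Z (isMeasurableFun.Build _ _ _ (measurableTypeR R) Z mZ).
transitivity (\int[pushforward P Zm]_x (expR (k * x))%:E)%E.
  rewrite ge0_integral_pushforward // => x _; rewrite lee_fin; exact: expR_ge0.
rewrite (eq_measure_integral (normal_prob 0 (Num.sqrt h))); last first.
  by move=> B mB _; exact: lawZ.
rewrite normal_prob_integral //.
transitivity (\int[lebesgue_measure]_x ((expR (k ^+ 2 * h / 2))%:E *
    (normal_pdf (k * h) (Num.sqrt h) x)%:E))%E.
  apply: eq_integral => x _; rewrite -!EFinM !normal_pdfE //; congr EFin.
  rewrite mulrCA [RHS]mulrCA; congr (_ * _); rewrite /normal_fun -!expRD.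
  rewrite sqr_sqrtr ?ltW //; congr expR; field.
  by rewrite gt_eqF.
rewrite ge0_integralZl //.
- by rewrite integral_normal_pdf mule1.
- by apply/measurable_EFinP; exact: measurable_normal_pdf.
- by move=> x _; rewrite lee_fin normal_pdf_ge0.
Qed.

Lemma gauss_integ_expR k : integ P (fun w => expR (k * Z w)).
Proof.
apply/integrableP; split.
  by apply/measurable_EFinP; apply: measurableT_comp => //; exact: measurable_funM.
under eq_integral do rewrite gee0_abs ?lee_fin ?expR_ge0 //.
by rewrite gauss_integral_expR ltry.
Qed.

Lemma gauss_mgf k : ex P (fun w => expR (k * Z w)) = expR (k ^+ 2 * h / 2).
Proof. by rewrite /ex /Rintegral gauss_integral_expR. Qed.

(** Integrable majorant of [e^(c |Z|)], used to differentiate in [k] under the expectation. *)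
Let dom (c : R) w := expR (c * Z w) + expR (- c * Z w).

Let dom_norm c w : 0 <= c -> expR (c * `|Z w|) <= dom c w.
Proof.
move=> c0; rewrite /dom; have e1 := expR_ge0 (c * Z w).
have e2 := expR_ge0 (- c * Z w).
case: (ger0P (Z w)) => _; rewrite ?mulrN -?mulNr; last by rewrite lerDr.
by rewrite lerDl.
Qed.

Let integ_dom c : integ P (dom c).
Proof. by apply: integD; exact: gauss_integ_expR. Qed.

Let norm_le_expR (z : R) : `|z| <= expR `|z|.
Proof. have := expR_ge1Dx `|z|; lra. Qed.

Let expR_dom (a x : R) w : `]a - 1, a + 1[%classic x ->
  expR (x * Z w) <= expR ((`|a| + 1) * `|Z w|).
Proof.
rewrite /= in_itv /= => /andP[ax xa]; rewrite ler_expR.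
apply: (le_trans (ler_norm _)); rewrite normrM ler_wpM2r //.
by rewrite ler_norml; have := ler_norm a; have := ler_norm (- a); rewrite normrN; lra.
Qed.

Let mZexp k : measurable_fun setT (fun w => Z w * expR (k * Z w)).
Proof.
apply: measurable_funM => //; apply: measurableT_comp => //.
exact: measurable_funM.
Qed.

Lemma gauss_integ_ZexpR k : integ P (fun w => Z w * expR (k * Z w)).
Proof.
(* One unit of the exponent absorbs [|Z| <= e^|Z|]; the other comes from [expR_dom], which covers
   all parameters within 1 of [k]. *)
apply: (le_integ (mZexp k) _ (integ_dom (`|k| + 2))) => w.
apply: (le_trans _ (dom_norm _ _)); last by have := normr_ge0 k; lra.
rewrite normrM (ger0_norm (expR_ge0 _)).
have -> : (`|k| + 2) * `|Z w| = `|Z w| + (`|k| + 1) * `|Z w| by ring.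
rewrite expRD ler_pM ?expR_ge0 //.
by apply: expR_dom; rewrite /= in_itv /=; lra.
Qed.

Let derive_expR_lin (x z : R) : is_derive x 1 (fun k => expR (k * z)) (z * expR (x * z)).
Proof.
have H : is_derive x 1 (fun k : R => k * z) z.
  apply: is_derive_eq; rewrite scaler0 add0r; exact: mulr1.
by have := @is_derive1_comp R expR (fun k => k * z) x _ _ (is_derive_expR _) H;
  rewrite mulrC.
Qed.

(** Derivative in [k] of the moment generating function. *)
Lemma gauss_mean_expR k :
  ex P (fun w => Z w * expR (k * Z w)) = k * h * expR (k ^+ 2 * h / 2).
Proof.
have Ia : `]k - 1, k + 1[%classic k by rewrite /= in_itv /=; lra.
have := @differentiation_under_integral R _ Omega P
  (fun x w => expR (x * Z w)) setT measurableT k (k - 1) (k + 1) Ia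
  (fun x _ => gauss_integ_expR x) _ (dom (`|k| + 2)) _ (integ_dom _) _.
have -> : (fun x' => \int[P]_y expR (x' * Z y)) =
          (fun x => expR (x ^+ 2 * h / 2)).
  by apply/funext => x; exact: gauss_mgf.
have D x y : ((fun x => expR (x * Z y))^`() x)%classic = Z y * expR (x * Z y).
  by rewrite derive1E; have /@derive_val -> := derive_expR_lin x (Z y).
move=> H; rewrite /ex.
under eq_Rintegral do rewrite -D.
rewrite -H.
- rewrite derive1E.
  have HD : is_derive k 1 (fun x : R => x ^+ 2 * h / 2) (k * h).
    by apply: is_derive_eq; rewrite /GRing.scale /=; field.
  have := @is_derive1_comp R expR (fun k => k ^+ 2 * h / 2) k _ _ (is_derive_expR _) HD.
  by move=> /@derive_val; rewrite mulrC.
- by move=> x y _ _; have [] := derive_expR_lin x (Z y).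
- by move=> y; rewrite /dom addr_ge0 // expR_ge0.
- move=> x y Ix _; rewrite /partial1of2 D.
  apply: (le_trans _ (dom_norm _ _)); last by have := normr_ge0 k; lra.
  rewrite normrM (ger0_norm (expR_ge0 _)).
  have -> : (`|k| + 2) * `|Z y| = `|Z y| + (`|k| + 1) * `|Z y| by ring.
  by rewrite expRD ler_pM ?expR_ge0 //; exact: expR_dom.
Qed.

Lemma gauss_integ_Z2 : integ P (fun w => Z w * Z w).
Proof.
apply: (le_integ _ _ (integZ 2 (integ_dom 1))) => [|w].
  exact: measurable_funM.
have H := dom_norm w ler01.
apply: (@le_trans _ _ (2 * expR (1 * `|Z w|))); last by lra.
rewrite normrM mul1r.
have := expR_ge1Dxn 1 (normr_ge0 (Z w)).
rewrite (_ : 2`!%:R = 2 :> R) //; lra.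
Qed.

(** Second derivative of the moment generating function at 0, obtained by differentiating
    [gauss_mean_expR]. *)
Lemma gauss_variance : ex P (fun w => Z w * Z w) = h.
Proof.
have Ia : `]0 - 1, 0 + 1[%classic (0 : R) by rewrite /= in_itv /=; lra.
have := @differentiation_under_integral R _ Omega P
  (fun x w => Z w * expR (x * Z w)) setT measurableT 0 (0 - 1) (0 + 1) Ia
  (* For [|x| < 1], [Z^2 <= 2 e^|Z|] and [e^(x Z) <= e^|Z|], whence the majorant [2 e^(2 |Z|)]. *)
  (fun x _ => gauss_integ_ZexpR x) _ (fun w => 2 * dom 2 w) _ (integZ 2 (integ_dom 2)) _.
have -> : (fun x' => \int[P]_y (Z y * expR (x' * Z y))) =
          (fun x => x * h * expR (x ^+ 2 * h / 2)).
  by apply/funext => x; exact: gauss_mean_expR.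
have DD (x : R) y : is_derive x 1 (fun x : R => Z y * expR (x * Z y))
    (Z y * (Z y * expR (x * Z y))).
  have := derive_expR_lin x (Z y) => ?.
  by apply: is_derive_eq; rewrite /GRing.scale /=; ring.
have D x y : ((fun x => Z y * expR (x * Z y))^`() x)%classic =
    Z y * (Z y * expR (x * Z y)).
  by rewrite derive1E; have /@derive_val -> := DD x y.
move=> H; transitivity (\int[P]_y partial1of2 (fun x w => Z w * expR (x * Z w)) 0 y).
  by apply: eq_ex => w; rewrite /partial1of2 D mul0r expR0 mulr1.
rewrite -H.
- rewrite derive1E.
  have HD : is_derive (0 : R) 1 (fun x : R => x ^+ 2 * h / 2) 0.
    by apply: is_derive_eq; rewrite /GRing.scale /=; ring.
  have HE := @is_derive1_comp R expR (fun k => k ^+ 2 * h / 2) 0 _ _ (is_derive_expR _) HD.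
  have : is_derive (0 : R) 1 (fun x : R => x * h * expR (x ^+ 2 * h / 2)) h.
    apply: is_derive_eq; rewrite /GRing.scale /= !(mulr0, mul0r, expr0n) /=.
    by rewrite ?(mul0r, mulr0, expR0, addr0, add0r, mul1r, mulr1).
  by move=> /@derive_val.
- by move=> x y _ _; have [] := DD x y.
- by move=> y; rewrite /dom mulr_ge0 // addr_ge0 // expR_ge0.
- move=> x y Ix _; rewrite /partial1of2 D.
  apply: (@le_trans _ _ (2 * expR (2 * `|Z y|))); last first.
    by rewrite ler_wpM2l //; exact: dom_norm.
  rewrite mulrA normrM (ger0_norm (expR_ge0 _)) normrM.
  have -> : expR (2 * `|Z y|) = expR (1 * `|Z y|) * expR (1 * `|Z y|).
    by rewrite -expRD; congr expR; ring.
  rewrite mulrA ler_pM ?expR_ge0 ?mulr_ge0 //.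
    have := expR_ge1Dxn 1 (normr_ge0 (Z y)).
    by rewrite (_ : 2`!%:R = 2 :> R) // mul1r; lra.
  by have := expR_dom y Ix; rewrite normr0 add0r.
Qed.

Lemma gauss_mean : ex P Z = 0.
Proof.
have := gauss_mean_expR 0; rewrite !mul0r => <-; apply: eq_ex => w.
by rewrite mul0r expR0 mulr1.
Qed.

Lemma gauss_sqint : sqint P Z.
Proof.
by split=> //; have := gauss_integ_Z2; under eq_fun do rewrite -expr2.
Qed.

Lemma gauss_sqint_expR k : sqint P (fun w => expR (k * Z w)).
Proof.
split; first by apply: measurableT_comp => //; exact: measurable_funM.
have -> : (fun w => expR (k * Z w) ^+ 2) = (fun w => expR (2 * k * Z w)).
  by apply/funext => w; rewrite expr2 -expRD; congr expR; ring.
exact: gauss_integ_expR.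
Qed.

End Gaussian.

(** * Expectation of a product of independent variables *)

Section Independence.
Context {R : realType} {d : measure_display} {Omega : measurableType d}.
Variable P : probability Omega R.

(** Independence says that the law of [(Y, Z)] and the product of the two laws agree on rectangles,
    hence everywhere by uniqueness of the product measure; Fubini then separates the integrals. *)
Lemma ex_mul_independent (Y Z : Omega -> R) (g : R -> R) :
  measurable_fun setT Y -> measurable_fun setT Z -> measurable_fun setT g ->
  (forall A B : set R, measurable A -> measurable B ->
    P (Y @^-1` A `&` Z @^-1` B) = (P (Y @^-1` A) * P (Z @^-1` B))%E) ->
  integ P Y -> integ P (fun w => g (Z w)) ->
  integ P (fun w => Y w * g (Z w)) ->
  ex P (fun w => Y w * g (Z w)) = ex P Y * ex P (fun w => g (Z w)).
Proof.
move=> mY mZ mg ind iY iZ iYZ.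
pose T := measurableTypeR R.
pose Ym : {mfun Omega >-> T} := HB.pack Y (isMeasurableFun.Build _ _ _ T Y mY).
pose Zm : {mfun Omega >-> T} := HB.pack Z (isMeasurableFun.Build _ _ _ T Z mZ).
have mYZ : measurable_fun setT (fun w => (Y w, Z w) : T * T).
  exact: measurable_fun_pair.
pose YZm : {mfun Omega >-> (T * T)%type} :=
  HB.pack (fun w => (Y w, Z w) : T * T)
    (isMeasurableFun.Build _ _ _ (T * T)%type _ mYZ).
pose f (z : T * T) : \bar R := (z.1 * g z.2)%:E.
have mf : measurable_fun setT f.
  apply/measurable_EFinP; apply: measurable_funM; first exact: measurable_fst.
  by apply: measurableT_comp => //; exact: measurable_snd.
have law A : measurable A ->
    (distribution P Ym \x distribution P Zm)%E A = pushforward P YZm A.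
  move=> mA; apply: product_measure_unique => // B C mB mC.
have if_ : (distribution P Ym \x distribution P Zm)%E.-integrable setT f.
  apply/integrableP; split => //.
  rewrite (eq_measure_integral (pushforward P YZm)); last first.
    by move=> A mA _; exact: law.
  have /integrableP[] : (pushforward P YZm).-integrable setT f => //.
  by apply: integrable_pushforward => //; rewrite preimage_setT.
have c_fin : (\int[distribution P Zm]_z (g z)%:E = (ex P (fun w => g (Z w)))%:E)%E.
  rewrite exE // integral_pushforward //.
    exact/measurable_EFinP.
have intg : (distribution P Zm).-integrable setT (EFin \o g).
  apply: integrable_pushforward => //.
  exact/measurable_EFinP.
apply: EFin_inj; rewrite EFinM !exE //.
transitivity (\int[pushforward P YZm]_z f z)%E.
  by rewrite integral_pushforward.
rewrite -(eq_measure_integral _ (m1 := distribution P Ym \x distribution P Zm)%E); last first.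
  by move=> A mA _; exact: law.
rewrite -integral12_prod_meas1 //.
transitivity (\int[distribution P Ym]_y (y%:E * \int[distribution P Zm]_z (g z)%:E))%E.
  apply: eq_integral => y _; rewrite /fubini_F /f /=.
  under eq_integral do rewrite EFinM.
  by rewrite integralZl.
have mE : measurable_fun setT (@EFin R : T -> \bar R).
  exact/measurable_EFinP.
rewrite c_fin integralZr //; last exact: integrable_pushforward.
by rewrite exE // integral_pushforward.
Qed.

End Independence.

(** * Filtrations and measurability at a given time *)

Section Filtration.
Context {R : realType} {d : measure_display} {Omega : measurableType d}.

Record filtration (F : R -> set (set Omega)) : Prop := {
  filtration_sigma : forall t, sigma_algebra setT (F t);
  filtration_mono : forall s t, s <= t -> F s `<=` F t;
  filtration_measurable : forall t A, F t A -> measurable A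
}.

Definition fmeas (F : R -> set (set Omega)) (t : R) (X : Omega -> R) :=
  forall B : set R, measurable B -> F t (X @^-1` B).

Variable F : R -> set (set Omega).
Hypothesis hF : filtration F.
Implicit Types X Y : Omega -> R.

(** Since [F t] is the sigma-algebra it generates, the usual closure properties of measurable
    functions transfer to [fmeas]. *)
Lemma fmeasP t X :
  fmeas F t X <-> measurable_fun setT (X : g_sigma_algebraType (F t) -> R).
Proof.
have E : <<s F t >> = F t by apply: sigma_algebra_id; exact: filtration_sigma.
split=> [H _ B mB|H B mB].
  by rewrite setTI /measurable /= E; exact: H.
by have := H measurableT B mB; rewrite setTI /measurable /= E.
Qed.

Lemma fmeas_le s t X : s <= t -> fmeas F s X -> fmeas F t X.
Proof. by move=> st H B mB; apply: (filtration_mono hF st); exact: H. Qed.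

Lemma fmeas_measurable t X : fmeas F t X -> measurable_fun setT X.
Proof.
move=> H _ B mB; rewrite setTI.
by apply: (filtration_measurable hF (t := t)); exact: H.
Qed.

Lemma fmeas_cst t k : fmeas F t (fun=> k).
Proof. by apply/fmeasP; exact: measurable_cst. Qed.

Lemma fmeasD t X Y : fmeas F t X -> fmeas F t Y -> fmeas F t (fun w => X w + Y w).
Proof. by move=> /fmeasP mX /fmeasP mY; apply/fmeasP; exact: measurable_funD. Qed.

Lemma fmeasM t X Y : fmeas F t X -> fmeas F t Y -> fmeas F t (fun w => X w * Y w).
Proof. by move=> /fmeasP mX /fmeasP mY; apply/fmeasP; exact: measurable_funM. Qed.

Lemma fmeasB t X Y : fmeas F t X -> fmeas F t Y -> fmeas F t (fun w => X w - Y w).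
Proof. by move=> /fmeasP mX /fmeasP mY; apply/fmeasP; exact: measurable_funB. Qed.

Lemma fmeas_comp t (g : R -> R) X : measurable_fun setT g -> fmeas F t X ->
  fmeas F t (fun w => g (X w)).
Proof. by move=> mg /fmeasP mX; apply/fmeasP; exact: measurableT_comp. Qed.

Lemma fmeas_indic t A : F t A -> fmeas F t (\1_A).
Proof.
move=> FA; apply/fmeasP/measurable_indic.
rewrite /measurable /= sigma_algebra_id //; exact: filtration_sigma.
Qed.

Lemma fmeas_sum t I (r : seq I) (X : I -> Omega -> R) :
  (forall i, fmeas F t (X i)) -> fmeas F t (fun w => \sum_(i <- r) X i w).
Proof.
move=> H; apply/fmeasP/measurable_sum => i; exact/fmeasP.
Qed.

End Filtration.

Section Wiener.
Context {R : realType} {d : measure_display} {Omega : measurableType d}.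
Variable P : probability Omega R.
Variable F : R -> set (set Omega).
Hypothesis hF : filtration F.
Variable W : R -> Omega -> R.
Hypothesis hW : standard_wiener P F W.

Definition dW (s t : R) (w : Omega) : R := W t w - W s w.

Lemma dW_measurable s t : 0 <= s -> 0 <= t -> measurable_fun setT (dW s t).
Proof.
by move=> s0 t0; apply: measurable_funB; exact: (wiener_measurable hW).
Qed.

Lemma dWxx s : dW s s = fun=> 0.
Proof. by apply/funext => w; rewrite /dW subrr. Qed.

Lemma dWD s t u w : dW s u w = dW s t w + dW t u w.
Proof. by rewrite /dW; ring. Qed.

Lemma dW_law s t : 0 <= s -> s < t -> forall B : set R, measurable B ->
  P [set w | B (dW s t w)] = normal_prob 0 (Num.sqrt (t - s)) B.
Proof. by move=> s0 st; exact: (wiener_gaussian hW s0 st). Qed.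

Lemma dW_sqint s t : 0 <= s -> s <= t -> sqint P (dW s t).
Proof.
move=> s0; rewrite le_eqVlt => /predU1P[<-|st].
  by rewrite dWxx; apply: (@sqint_bounded _ _ _ P 0) => // w; rewrite normr0.
apply: (@gauss_sqint _ _ _ P _ (t - s)); first by rewrite subr_gt0.
  by apply: dW_measurable => //; lra.
exact: dW_law.
Qed.

Lemma dW_fmeas s t u : 0 <= s -> s <= t -> t <= u -> fmeas F u (dW s t).
Proof.
move=> s0 st tu; apply: fmeasB => //.
- apply: (fmeas_le hF tu) => B; apply: (wiener_adapted hW); lra.
- by apply: (fmeas_le hF (le_trans st tu)) => B; exact: (wiener_adapted hW).
Qed.

Lemma ex_mul_dW s t (Y : Omega -> R) (g : R -> R) : 0 <= s -> s < t ->
  fmeas F s Y -> measurable_fun setT g ->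
  integ P Y -> integ P (fun w => g (dW s t w)) ->
  integ P (fun w => Y w * g (dW s t w)) ->
  ex P (fun w => Y w * g (dW s t w)) = ex P Y * ex P (fun w => g (dW s t w)).
Proof.
move=> s0 st fY mg iY ig iYg; apply: ex_mul_independent => //.
- exact: (fmeas_measurable hF fY).
- by apply: dW_measurable => //; lra.
- move=> A B mA mB; apply: (wiener_independent hW s0 st) => //; exact: fY.
Qed.

Lemma dW_mean s t Y : 0 <= s -> s <= t -> fmeas F s Y -> sqint P Y ->
  ex P (fun w => Y w * dW s t w) = 0.
Proof.
move=> s0; rewrite le_eqVlt => /predU1P[<-|st] fY sY.
  rewrite dWxx -[RHS](ex_cst P 0); apply: eq_ex => w; exact: mulr0.
have sW := dW_sqint s0 (ltW st).
have := @ex_mul_dW s t Y id s0 st fY; rewrite /= => ->.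
- rewrite (@gauss_mean _ _ _ P (dW s t) (t - s)) ?mulr0 ?subr_gt0 //.
    by apply: dW_measurable => //; lra.
  exact: dW_law.
- exact: measurable_id.
- exact: sqint_integ.
- exact: sqint_integ.
- exact: sqint_mul.
Qed.

Lemma dW_variance K s t Y : 0 <= s -> s <= t -> fmeas F s Y ->
  (forall w, `|Y w| <= K) ->
  ex P (fun w => Y w * (dW s t w * dW s t w)) = ex P Y * (t - s).
Proof.
move=> s0; rewrite le_eqVlt => /predU1P[<-|st] fY bY.
  transitivity (ex P (fun=> 0)); last by rewrite ex_cst subrr mulr0.
  by apply: eq_ex => w; rewrite dWxx !mulr0.
have sW := dW_sqint s0 (ltW st).
have mY := fmeas_measurable hF fY.
have := @ex_mul_dW s t Y (fun x => x * x) s0 st fY; rewrite /= => ->.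
- rewrite (@gauss_variance _ _ _ P _ (t - s)) ?subr_gt0 //.
    by apply: dW_measurable => //; lra.
  exact: dW_law.
- exact: measurable_funM.
- exact: integ_bounded bY.
- exact: sqint_mul.
- by apply: (integ_mul_bounded mY bY); exact: sqint_mul.
Qed.

(** The factor [Y * dW p q] is known at time [r], where the second increment starts. *)
Lemma dW_orthogonal K p q r s Y : 0 <= p -> p <= q -> q <= r -> r <= s ->
  fmeas F r Y -> (forall w, `|Y w| <= K) ->
  ex P (fun w => Y w * (dW p q w * dW r s w)) = 0.
Proof.
move=> p0 pq qr rs fY bY.
under eq_ex do rewrite mulrA.
apply: dW_mean => //; first by lra.
- apply: fmeasM => //; exact: dW_fmeas.
- apply: sqint_mul_bounded (bY) _; first exact: (fmeas_measurable hF fY).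
  exact: dW_sqint.
Qed.

(** Length of the intersection of the two intervals, that is, the covariance of their Wiener
    increments. *)
Definition overlap (u v u' v' : R) : R :=
  if Num.max u u' < Num.min v v' then Num.min v v' - Num.max u u' else 0.

Lemma overlapC u v u' v' : overlap u v u' v' = overlap u' v' u v.
Proof. by rewrite /overlap maxC minC. Qed.

(** Both increments are cut at the later start and at the earlier end; the common part contributes
    its variance, and all other products are orthogonal. *)
Lemma dW_covariance K u v u' v' Y : 0 <= u -> u <= v -> 0 <= u' -> u' <= v' ->
  fmeas F (Num.max u u') Y -> (forall w, `|Y w| <= K) ->
  ex P (fun w => Y w * (dW u v w * dW u' v' w)) = ex P Y * overlap u v u' v'.
Proof.
wlog uu' : u v u' v' / u <= u'.
  move=> H u0 uv u'0 uv' fY bY; have [uu'|u'u] := leP u u'.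
    by apply: H => //; rewrite max_r.
  rewrite overlapC -H //; [|exact: ltW|by rewrite maxC].
  by apply: eq_ex => w; congr (_ * _); rewrite mulrC.
move=> u0 uv u'0 uv'; rewrite /overlap max_r // => fY bY.
have mY := fmeas_measurable hF fY.
have iW a b a' b' : 0 <= a -> a <= b -> 0 <= a' -> a' <= b' ->
    integ P (fun w => Y w * (dW a b w * dW a' b' w)).
  move=> *; apply: (integ_mul_bounded mY bY).
  by apply: sqint_mul; exact: dW_sqint.
have fY' a : u' <= a -> fmeas F a Y by move=> *; apply: (fmeas_le hF _ fY).
have [vu'|u'v] := leP v u'.
  rewrite ifF ?mulr0; last by apply/negbTE; rewrite -leNgt ge_min vu'.
  exact: (@dW_orthogonal K).
rewrite lt_min u'v /=.
have [v'u'|u'v'] := leP v' u'.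
  have -> : v' = u' by lra.
  transitivity (ex P (fun=> 0)); last by rewrite ex_cst mulr0.
  by apply: eq_ex => w; rewrite dWxx !mulr0.
have [vv'|v'v] := leP v v'.
- transitivity (ex P (fun w => Y w * (dW u u' w * dW u' v' w) +
     (Y w * (dW u' v w * dW u' v w) + Y w * (dW u' v w * dW v v' w)))).
    apply: eq_ex => w; rewrite (dWD u u' v) (dWD u' v v').
    by ring.
  rewrite exD; [|apply: iW; lra|apply: integD; apply: iW; lra].
  rewrite exD; [|apply: iW; lra|apply: iW; lra].
  rewrite (@dW_variance K) //; [|lra].
  rewrite (@dW_orthogonal K u u' u' v') //.
  rewrite (@dW_orthogonal K u' v v v') //; [|lra|by apply: fY'; lra].
  by rewrite add0r addr0.
- transitivity (ex P (fun w => Y w * (dW u u' w * dW u' v' w) +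
     (Y w * (dW u' v' w * dW u' v' w) + Y w * (dW u' v' w * dW v' v w)))).
    apply: eq_ex => w; rewrite (dWD u u' v) (dWD u' v' v).
    by ring.
  rewrite exD; [|apply: iW; lra|apply: integD; apply: iW; lra].
  rewrite exD; [|apply: iW; lra|apply: iW; lra].
  rewrite (@dW_variance K) //.
  rewrite (@dW_orthogonal K u u' u' v') //.
  rewrite (@dW_orthogonal K u' v' v' v) //; [|lra|by apply: fY'; lra].
  by rewrite add0r addr0.
Qed.

End Wiener.

(** * Ito integrals over short intervals *)

Section Pieces.
Context {R : realType} {d : measure_display} {Omega : measurableType d}.
Variable P : probability Omega R.
Variable F : R -> set (set Omega).
Hypothesis hF : filtration F.
Variable W : R -> Omega -> R.
Hypothesis hW : standard_wiener P F W.

(** The process [amp * 1_[lo, hi[]. Unlike in [elementary], the intervals may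
    overlap, so that sums are concatenations. *)
Record piece (a b : R) := Piece {
  lo : R; hi : R; amp : Omega -> R;
  piece_ge : a <= lo;
  piece_le : lo <= hi;
  piece_hi : hi <= b;
  piece_fmeas : fmeas F lo amp;
  piece_bounded : exists K, forall w, `|amp w| <= K
}.

Definition pint a b (psi : seq (piece a b)) (w : Omega) : R :=
  \sum_(i <- psi) amp i w * dW W (lo i) (hi i) w.

Definition pval a b (psi : seq (piece a b)) (r : R) (w : Omega) : R :=
  \sum_(i <- psi) amp i w * \1_(`[lo i, hi i[%classic) r.

(** The time integral of [pval ^+ 2], expanded over pairs; cross terms survive because pieces may
    overlap. *)
Definition pquad a b (psi : seq (piece a b)) (w : Omega) : R :=
  \sum_(i <- psi) \sum_(j <- psi)
    amp i w * amp j w * overlap (lo i) (hi i) (lo j) (hi j).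

Section OnInterval.
Variables a b : R.
Hypothesis a0 : 0 <= a.
Implicit Types (i j : piece a b) (psi : seq (piece a b)).

Let lo_ge0 i : 0 <= lo i.
Proof. exact: le_trans (piece_ge i). Qed.

Lemma amp_measurable i : measurable_fun setT (amp i).
Proof. exact: (fmeas_measurable hF (piece_fmeas i)). Qed.

Lemma amp_mul_bounded i j : exists K, forall w, `|amp i w * amp j w| <= K.
Proof.
have [K HK] := piece_bounded i; have [L HL] := piece_bounded j.
by exists (K * L) => w; rewrite normrM ler_pM.
Qed.

Lemma piece_sqint i : sqint P (fun w => amp i w * dW W (lo i) (hi i) w).
Proof.
have [K HK] := piece_bounded i.
apply: sqint_mul_bounded HK _; first exact: amp_measurable.
by apply: (dW_sqint hW) => //; exact: piece_le.
Qed.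

Lemma pint_sqint psi : sqint P (pint psi).
Proof. by apply: sqint_sum => i; exact: piece_sqint. Qed.

Lemma overlap_term_integ i j : integ P (fun w =>
  amp i w * amp j w * overlap (lo i) (hi i) (lo j) (hi j)).
Proof.
have [K HK] := amp_mul_bounded i j.
under eq_fun do rewrite mulrC.
apply: integZ; apply: integ_bounded HK.
by apply: measurable_funM; exact: amp_measurable.
Qed.

Lemma pquad_integ psi : integ P (pquad psi).
Proof. by apply: integ_sum => i; apply: integ_sum => j; exact: overlap_term_integ. Qed.

(** Ito isometry, pair by pair: the product of two amplitudes is known at the later of the two
    starts, as [dW_covariance] requires. *)
Lemma pint_isometry psi : ex P (fun w => pint psi w ^+ 2) = ex P (pquad psi).
Proof.
transitivity (ex P (fun w => \sum_(i <- psi) \sum_(j <- psi)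
   (amp i w * dW W (lo i) (hi i) w) * (amp j w * dW W (lo j) (hi j) w))).
  by apply: eq_ex => w; rewrite expr2 /pint mulr_suml; apply: eq_bigr => i _;
    rewrite mulr_sumr.
have iI i j : integ P (fun w =>
    (amp i w * dW W (lo i) (hi i) w) * (amp j w * dW W (lo j) (hi j) w)).
  by apply: sqint_mul; exact: piece_sqint.
rewrite ex_sum; last by move=> i; exact: integ_sum.
rewrite /pquad ex_sum; last by move=> i; apply: integ_sum => j; exact: overlap_term_integ.
apply: eq_bigr => i _; rewrite !ex_sum //; last exact: overlap_term_integ.
apply: eq_bigr => j _.
have [K HK] := amp_mul_bounded i j.
under eq_ex do rewrite mulrACA.
rewrite (@dW_covariance _ _ _ _ _ hF _ hW K) //; try exact: piece_le; last first.
- apply: fmeasM => //.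
    by apply: (fmeas_le hF _ (piece_fmeas i)); rewrite le_max lexx.
  by apply: (fmeas_le hF _ (piece_fmeas j)); rewrite le_max lexx orbT.
- under [RHS]eq_ex do rewrite mulrC.
  rewrite exZ 1?mulrC //; apply: integ_bounded HK.
  by apply: measurable_funM; exact: amp_measurable.
Qed.

(** A product of two interval indicators is the indicator of the intersection, whose length is
    [overlap]. *)
Lemma pval_quad psi w :
  (\int[lebesgue_measure]_(r in `[a, b]) ((pval psi r w) ^+ 2)%:E =
   (pquad psi w)%:E)%E.
Proof.
pose A i j : set R := `[Num.max (lo i) (lo j), Num.min (hi i) (hi j)[%classic.
have mA i j : measurable (A i j : set (measurableTypeR R)) by exact: measurable_itv.
have iA i j c : lebesgue_measure.-integrable `[a, b]
    (fun r : R => (c * \1_(A i j) r)%:E).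
  apply: (@measurable_bounded_integrable _ _ _ lebesgue_measure
    (fun r : R => c * \1_(A i j) r)) => //.
  - by rewrite /= lebesgue_measure_itv /=; case: ifP => // _; rewrite -EFinB ltry.
  - by apply: measurable_funM => //; apply: measurable_indic; exact: mA.
  - exists `|c|; split; first exact: num_real.
    move=> x x1 y _ /=; rewrite indicE normrM; apply: le_trans (ltW x1).
    by case: (_ \in _); rewrite ?normr1 ?normr0 ?mulr1 ?mulr0.
transitivity (\int[lebesgue_measure]_(r in `[a, b])
  (\sum_(i <- psi) \sum_(j <- psi) (amp i w * amp j w * \1_(A i j) r)%:E))%E.
  apply: eq_integral => r _; rewrite expr2 /pval mulr_suml -sumEFin.
  apply: eq_bigr => i _; rewrite mulr_sumr -sumEFin; apply: eq_bigr => j _.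
  congr EFin; rewrite mulrACA; congr (_ * _).
  rewrite !indicE /A -natrM mulnb; congr (_%:R); congr nat_of_bool.
  rewrite -[RHS]/(r \in `[Num.max (lo i) (lo j), Num.min (hi i) (hi j)[%classic).
  apply/andP/idP; rewrite !inE /= !in_itv /= lt_min ge_max.
    by move=> [/andP[-> ->] /andP[-> ->]].
  by move=> /andP[/andP[-> ->] /andP[-> ->]].
rewrite integral_sum //; last first.
  by move=> i; apply: integrable_sum => // j _; exact: iA.
rewrite /pquad -sumEFin; apply: eq_bigr => i _.
rewrite integral_sum // -sumEFin; apply: eq_bigr => j _.
under eq_integral do rewrite EFinM.
rewrite integralZl //; last first.
  by apply: eq_integrable (iA i j 1) => // x _ /=; rewrite mul1r.
rewrite integral_indic; [|by []|exact: mA]; rewrite [RHS]EFinM; congr (_ * _)%E.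
rewrite setIidl; last first.
  move=> r; rewrite /A /= !in_itv /= ge_max lt_min.
  move=> /andP[/andP[l1 _] /andP[l2 _]].
  by rewrite (le_trans (piece_ge i) l1) (le_trans (ltW l2) (piece_hi i)).
rewrite /= /A lebesgue_measure_itv /= lte_fin /overlap.
by case: ifP => // _; rewrite EFinB.
Qed.

End OnInterval.
End Pieces.

Section PieceOperations.
Context {R : realType} {d : measure_display} {Omega : measurableType d}.
Variable P : probability Omega R.
Variable F : R -> set (set Omega).
Hypothesis hF : filtration F.
Variable W : R -> Omega -> R.
Hypothesis hW : standard_wiener P F W.

Section Operations.
Variables a b : R.
Implicit Types (i : piece F a b) (psi : seq (piece F a b)).

Lemma pint_cat psi1 psi2 w :
  pint W (psi1 ++ psi2) w = pint W psi1 w + pint W psi2 w.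
Proof. by rewrite /pint big_cat. Qed.

Lemma pval_cat psi1 psi2 r w :
  pval (psi1 ++ psi2) r w = pval psi1 r w + pval psi2 r w.
Proof. by rewrite /pval big_cat. Qed.

Program Definition piece_opp i : piece F a b :=
  @Piece R d Omega F a b (lo i) (hi i) (fun w => -1 * amp i w) _ _ _ _ _.
Next Obligation. by move=> i; exact: piece_ge. Qed.
Next Obligation. by move=> i; exact: piece_le. Qed.
Next Obligation. by move=> i; exact: piece_hi. Qed.
Next Obligation.
by move=> i; apply: fmeasM => //; [exact: fmeas_cst|exact: piece_fmeas].
Qed.
Next Obligation.
move=> i; have [K HK] := piece_bounded i; exists K => w.
by rewrite mulN1r normrN.
Qed.

Lemma pint_opp psi w : pint W (map piece_opp psi) w = - pint W psi w.
Proof.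
rewrite /pint big_map /= -sumrN; apply: eq_bigr => i _.
by rewrite mulN1r mulNr.
Qed.

Lemma pval_opp psi r w : pval (map piece_opp psi) r w = - pval psi r w.
Proof.
rewrite /pval big_map /= -sumrN; apply: eq_bigr => i _.
by rewrite mulN1r mulNr.
Qed.

Program Definition piece_widen b' (bb' : b <= b') i : piece F a b' :=
  @Piece R d Omega F a b' (lo i) (hi i) (amp i) _ _ _ _ _.
Next Obligation. by move=> b' bb' i; exact: piece_ge. Qed.
Next Obligation. by move=> b' bb' i; exact: piece_le. Qed.
Next Obligation. by move=> b' bb' i; exact: le_trans (piece_hi i) bb'. Qed.
Next Obligation. by move=> b' bb' i; exact: piece_fmeas. Qed.
Next Obligation. by move=> b' bb' i; exact: piece_bounded. Qed.

Lemma pint_widen b' (bb' : b <= b') psi w :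
  pint W (map (piece_widen bb') psi) w = pint W psi w.
Proof. by rewrite /pint big_map. Qed.

Lemma pval_widen b' (bb' : b <= b') psi r w :
  pval (map (piece_widen bb') psi) r w = pval psi r w.
Proof. by rewrite /pval big_map. Qed.

(** A piece that starts after [s] gets amplitude [0], since its amplitude is
    not [F s]-measurable. *)
Program Definition piece_below s (as_ : a <= s) i : piece F a s :=
  @Piece R d Omega F a s (Num.min (lo i) s) (Num.min (hi i) s)
    (if lo i <= s then amp i else fun=> 0) _ _ _ _ _.
Next Obligation. by move=> s as_ i; rewrite le_min piece_ge. Qed.
Next Obligation.
by move=> s as_ i; rewrite le_min ge_min piece_le /= ge_min lexx orbT.
Qed.
Next Obligation. by move=> s as_ i; rewrite ge_min lexx orbT. Qed.
Next Obligation.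
move=> s as_ i; have [ls|sl] := leP (lo i) s; first exact: piece_fmeas.
exact: fmeas_cst.
Qed.
Next Obligation.
move=> s as_ i; case: ifP => _; first exact: piece_bounded.
by exists 0 => w; rewrite normr0.
Qed.

Program Definition piece_above s (sb : s <= b) i : piece F s b :=
  @Piece R d Omega F s b (Num.max (lo i) s) (Num.max (hi i) s) (amp i) _ _ _ _ _.
Next Obligation. by move=> s sb i; rewrite le_max lexx orbT. Qed.
Next Obligation.
by move=> s sb i; rewrite ge_max le_max piece_le /= le_max lexx orbT.
Qed.
Next Obligation. by move=> s sb i; rewrite ge_max piece_hi. Qed.
Next Obligation.
by move=> s sb i; apply: (fmeas_le hF _ (piece_fmeas i)); rewrite le_max lexx.
Qed.
Next Obligation. by move=> s sb i; exact: piece_bounded. Qed.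

(** A piece that straddles [s] has its increment cut at [s]; any other piece lies on one side and
    leaves a zero term on the other. *)
Lemma pint_split s (as_ : a <= s) (sb : s <= b) psi w :
  pint W psi w = pint W (map (piece_below as_) psi) w +
                 pint W (map (piece_above sb) psi) w.
Proof.
rewrite /pint !big_map -big_split; apply: eq_bigr => i _ /=.
have lh := piece_le i.
have [ls|sl] := leP (lo i) s; have [hs|sh] := leP (hi i) s.
- by rewrite dWxx mulr0 addr0.
- by rewrite (dWD W _ s) mulrDr.
- by exfalso; lra.
- by rewrite mul0r add0r.
Qed.

Lemma pval_below s (as_ : a <= s) psi r w : r < s ->
  pval (map (piece_below as_) psi) r w = pval psi r w.
Proof.
move=> rs; rewrite /pval big_map; apply: eq_bigr => i _ /=.
have E : (r \in `[Num.min (lo i) s, Num.min (hi i) s[%classic) =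
         (r \in `[lo i, hi i[%classic) :> bool.
  apply/idP/idP; rewrite !inE /= !in_itv /= ge_min lt_min rs andbT.
    by move=> /andP[/orP[->//|sr]]; lra.
  by move=> /andP[-> ->].
rewrite !indicE E; case: ifP => // /negbT; rewrite -ltNge => sl.
rewrite mul0r [_ \in _](_ : _ = false) ?mulr0 //.
by apply/negP; rewrite inE /= in_itv /= => /andP[]; lra.
Qed.

(** Pieces are half-open, so the truncated process need not agree with [pval psi] at [s]; the closed
    interval of integration makes this endpoint a separate case. *)
Lemma pval_below_end s (as_ : a <= s) psi w :
  pval (map (piece_below as_) psi) s w = 0.
Proof.
rewrite /pval big1 // => i _; rewrite indicE.
rewrite [_ \in _](_ : _ = false) ?mulr0 //.
by apply/negP; rewrite inE /= in_itv /= => /andP[_]; have := piece_hi i; lra.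
Qed.

Lemma pval_end psi r w : b <= r -> pval psi r w = 0.
Proof.
move=> br; rewrite /pval big1 // => i _; rewrite indicE.
rewrite [_ \in _](_ : _ = false) ?mulr0 //.
by apply/negP; rewrite inE /= in_itv /= => /andP[_]; have := piece_hi i; lra.
Qed.

Lemma pval_measurable psi :
  measurable_fun setT (fun z : R * Omega => pval psi z.1 z.2).
Proof.
apply: measurable_sum => i; apply: measurable_funM.
  by apply: measurableT_comp; [exact: (amp_measurable hF)|exact: measurable_snd].
apply: (@measurableT_comp _ _ _ _ _ _ (\1_(`[lo i, hi i[%classic) : R -> R)).
  by apply: measurable_indic; exact: measurable_itv.
exact: measurable_fst.
Qed.

(** Every piece starts after [a], so [Y * amp i] is known when its increment begins. *)
Lemma pint_mean K Y psi : 0 <= a -> fmeas F a Y -> (forall w, `|Y w| <= K) ->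
  ex P (fun w => Y w * pint W psi w) = 0.
Proof.
move=> a0 fY bY; have mY := fmeas_measurable hF fY.
have iYi i : integ P (fun w => Y w * (amp i w * dW W (lo i) (hi i) w)).
  by apply: (integ_mul_bounded mY bY); apply: sqint_integ; exact: (piece_sqint hF hW).
transitivity (\sum_(i <- psi) ex P (fun w => Y w * (amp i w * dW W (lo i) (hi i) w))).
  by rewrite -ex_sum //; apply: eq_ex => w; rewrite /pint mulr_sumr.
rewrite big1 // => i _.
under eq_ex do rewrite mulrA.
apply: (dW_mean hF hW).
- exact: le_trans (piece_ge i).
- exact: piece_le.
- apply: fmeasM => //; last exact: piece_fmeas.
  by apply: (fmeas_le hF _ fY); exact: piece_ge.
- have [L HL] := piece_bounded i.
  apply: (@sqint_bounded _ _ _ P (K * L)).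
    by apply: measurable_funM => //; exact: (amp_measurable hF).
  by move=> w; rewrite normrM ler_pM.
Qed.

End Operations.

Section Elementary.
Variables (t : R) (phi : elementary (R := R) (Omega := Omega)).
Hypothesis hphi : elementary_on F t phi.

Let node_mono k l : (k <= l <= steps phi)%N -> node phi k <= node phi l.
Proof.
move=> /andP[kl ln]; elim: l kl ln => [|l ih].
  by rewrite leqn0 => /eqP ->.
rewrite leq_eqVlt => /predU1P[-> //|kl] ln.
apply: (le_trans (ih _ (ltnW ln))) => //.
exact: (elementary_nodes hphi).
Qed.

Program Definition elementary_piece (k : 'I_(steps phi)) : piece F 0 t :=
  @Piece R d Omega F 0 t (node phi k) (node phi k.+1) (coef phi k) _ _ _ _ _.
Next Obligation.
by move=> k; rewrite -(elementary_start hphi) node_mono //= ltnW.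
Qed.
Next Obligation. by move=> k; exact: (elementary_nodes hphi). Qed.
Next Obligation.
by move=> k; rewrite -(elementary_end hphi) node_mono //= leqnn andbT.
Qed.
Next Obligation. by move=> k B mB; exact: (elementary_coef hphi). Qed.
Next Obligation. by move=> k; exact: (elementary_bounded hphi). Qed.

Definition elementary_pieces := map elementary_piece (index_enum 'I_(steps phi)).

Lemma pint_elementary w : pint W elementary_pieces w = elementary_int W phi w.
Proof. by rewrite /pint big_map. Qed.

Lemma pval_elementary r w : pval elementary_pieces r w = elementary_val phi r w.
Proof. by rewrite /pval big_map. Qed.

End Elementary.
End PieceOperations.

(** * Fubini on a time strip *)

Section DoubleIntegral.
Context {R : realType} {d : measure_display} {Omega : measurableType d}.
Variable P : probability Omega R.
Notation mu := (@lebesgue_measure R).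

Definition strip (a b : R) : set (measurableTypeR R * Omega) := `[a, b]%classic `*` setT.

Definition strip_meas (a b : R) (G : R -> Omega -> R) : Prop :=
  measurable_fun (strip a b) (fun z : measurableTypeR R * Omega => G z.1 z.2).

Definition dint (a b : R) (G : R -> Omega -> R) : \bar R :=
  (\int[P]_w \int[mu]_(r in `[a, b]) (G r w)%:E)%E.

Lemma strip_measurable a b : measurable (strip a b).
Proof. by apply: measurableX => //; exact: measurable_itv. Qed.

(** Extension by 0 off the strip: the integrands are jointly measurable only there, while
    Fubini-Tonelli is applied on the whole product. *)
Let patched a b (G : R -> Omega -> R) :=
  ((fun z : measurableTypeR R * Omega => (G z.1 z.2)%:E) \_ (strip a b))%E.

Let patched_measurable a b (G : R -> Omega -> R) :
  strip_meas a b G ->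
  measurable_fun setT (patched a b G).
Proof.
move=> mG; apply/(measurable_restrictT _ (strip_measurable a b)).
exact/measurable_EFinP.
Qed.

Let patched_ge0 a b (G : R -> Omega -> R) : (forall r w, a <= r <= b -> 0 <= G r w) ->
  forall z, (0 <= patched a b G z)%E.
Proof.
move=> G0 [r w]; rewrite /patched patchE; case: ifP => //.
by rewrite inE /strip /= in_itv /= => -[rab _]; rewrite lee_fin G0.
Qed.

Let patched_inner a b (G : R -> Omega -> R) w :
  (\int[mu]_(r in `[a, b]) (G r w)%:E = \int[mu]_r patched a b G (r, w))%E.
Proof.
rewrite integral_mkcond; apply: eq_integral => r _.
rewrite /patched !patchE; congr (if _ then _ else _).
by rewrite /strip in_setX in_setT andbT.
Qed.

Lemma dint_prod a b (G : R -> Omega -> R) :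
  strip_meas a b G ->
  (forall r w, a <= r <= b -> 0 <= G r w) ->
  dint a b G = (\int[mu \x P]_(z in strip a b) (G z.1 z.2)%:E)%E.
Proof.
move=> mG G0; rewrite [RHS]integral_mkcond.
rewrite (fubini_tonelli2 (patched a b G)); last 2 first.
- exact: patched_measurable.
- exact: patched_ge0.
by apply: eq_integral => w _; rewrite patched_inner.
Qed.

Lemma dint_swap a b (G : R -> Omega -> R) :
  strip_meas a b G ->
  (forall r w, a <= r <= b -> 0 <= G r w) ->
  (dint a b G = \int[mu]_(r in `[a, b]) \int[P]_w (G r w)%:E)%E.
Proof.
move=> mG G0; rewrite dint_prod // [LHS]integral_mkcond.
rewrite (fubini_tonelli1 (patched a b G)); last 2 first.
- exact: patched_measurable.
- exact: patched_ge0.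
rewrite [RHS]integral_mkcond; apply: eq_integral => r _.
rewrite patchE; case: ifPn => rab; rewrite /fubini_F.
  apply: eq_integral => w _; rewrite /patched patchE ifT //.
  by rewrite inE /strip /=; move: rab; rewrite inE.
rewrite integral0_eq // => w _; rewrite /patched patchE ifF //.
by apply/negP; rewrite inE /strip /= => -[]; move: rab; rewrite notin_setE.
Qed.

Lemma dint_inner_measurable a b (G : R -> Omega -> R) :
  strip_meas a b G -> (forall r w, a <= r <= b -> 0 <= G r w) ->
  measurable_fun (`[a, b]%classic : set (measurableTypeR R))
    (fun r : measurableTypeR R => \int[P]_w (G r w)%:E)%E.
Proof.
move=> mG G0.
have := @measurable_fun_fubini_tonelli_F _ _ _ _ R P (patched a b G)
  (patched_measurable mG) (patched_ge0 G0).
move=> /(measurable_funTS (D := `[a, b]%classic)); apply: eq_measurable_fun.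
move=> r rab; apply: eq_integral => w _; rewrite /patched patchE ifT //.
by rewrite inE /strip /=; move: rab; rewrite inE.
Qed.

End DoubleIntegral.

Lemma sqr_sum3 {R : realFieldType} (x y z : R) :
  (x + y + z) ^+ 2 <= 3 * (x ^+ 2 + y ^+ 2 + z ^+ 2).
Proof.
have := sqr_ge0 (x - y); have := sqr_ge0 (y - z); have := sqr_ge0 (x - z).
rewrite !sqrrB !sqrrD; lra.
Qed.

(** * The increment of an Ito integral between two times *)

Section ItoIncrement.
Context {R : realType} {d : measure_display} {Omega : measurableType d}.
Variable P : probability Omega R.
Variable F : R -> set (set Omega).
Hypothesis hF : filtration F.
Variable W : R -> Omega -> R.
Hypothesis hW : standard_wiener P F W.
Variable H : R -> Omega -> R.

Lemma ito_approximation t I e : is_ito_integral P F W H t I -> 0 < e ->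
  exists psi : seq (piece F 0 t),
   (dint P 0 t (fun r w => ((pval psi r w - H r w) ^+ 2)%R) <= e%:E)%E /\
   (\int[P]_w ((pint W psi w - I w) ^+ 2)%R%:E <= e%:E)%E.
Proof.
move=> [_ _ _ [phi [hphi c1 c2]]] e0.
have near_le (u : nat -> \bar R) : u @ \oo --> 0%E -> \forall m \near \oo, (u m < e%:E)%E.
  move=> /fine_cvgP [fu cu]; near=> m.
  rewrite -[u m]fineK; last by near: m.
  by rewrite lte_fin; near: m; apply: (cvgr_lt 0 cu).
have [m _ /(_ m (leqnn m)) [Hm1 Hm2]] : \forall m \near \oo,
   (\int[P]_w \int[lebesgue_measure]_(s in `[0%R, t])
             ((elementary_val (phi m) s w - H s w) ^+ 2)%R%:E < e%:E)%E /\
   (\int[P]_w ((elementary_int W (phi m) w - I w) ^+ 2)%R%:E < e%:E)%E.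
  by apply: filterI; exact: near_le.
exists (elementary_pieces (hphi m)); split.
  rewrite /dint; apply/ltW; apply: le_lt_trans Hm1.
  under eq_integral do under eq_integral do rewrite pval_elementary.
  by [].
apply/ltW; apply: le_lt_trans Hm2.
by under eq_integral do rewrite pint_elementary.
Unshelve. all: end_near. Qed.

(** The definition of the Ito integral does not state that it is square-integrable; this follows
    from [Y = X - (X - Y)] with both terms square-integrable. *)
Lemma sqint_of_near (X Y : Omega -> R) e : sqint P X -> measurable_fun setT Y ->
  (\int[P]_w ((X w - Y w) ^+ 2)%R%:E <= e%:E)%E ->
  sqint P Y /\ ex P (fun w => (X w - Y w) ^+ 2) <= e.
Proof.
move=> sX mY XY; have [mX _] := sX.
have iXY : integ P (fun w => (X w - Y w) ^+ 2).
  apply/integrableP; split.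
    by apply/measurable_EFinP; apply: measurable_funX; exact: measurable_funB.
  under eq_integral do rewrite gee0_abs ?lee_fin ?sqr_ge0 //.
  exact: (le_lt_trans XY (ltry e)).
split; last by rewrite -lee_fin exE.
have -> : Y = (fun w => X w - (X w - Y w)) by apply/funext => w; ring.
by apply: sqintB => //; split => //; exact: measurable_funB.
Qed.

Variables (s t K : R).
Hypothesis s0 : 0 <= s.
Hypothesis st : s <= t.
Variables Is It : Omega -> R.
Hypothesis itoS : is_ito_integral P F W H s Is.
Hypothesis itoT : is_ito_integral P F W H t It.
Hypothesis H_bounded : forall r w, 0 <= r -> `|H r w| <= K.

Let t0 : 0 <= t. Proof. exact: le_trans st. Qed.

Let Hs_fmeas : fmeas F s (H s).
Proof. by move=> B mB; have [aH _ _ _] := itoS; exact: aH. Qed.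

Let Hs_measurable : measurable_fun setT (H s).
Proof. exact: (fmeas_measurable hF Hs_fmeas). Qed.

Definition ito_remainder (w : Omega) : R := It w - Is w - H s w * dW W s t w.

Let start_piece : piece F 0 t :=
  @Piece R d Omega F 0 t s t (H s) s0 st (lexx t) Hs_fmeas
    (ex_intro _ K (fun w => H_bounded w s0)).

(** Approximates [ito_remainder]: the approximation for time [t], minus the one for time [s], minus
    the process equal to [H s] on [[s, t[]. *)
Let approx (pt : seq (piece F 0 t)) (ps : seq (piece F 0 s)) :
    seq (piece F 0 t) :=
  pt ++ map (@piece_opp _ _ _ _ hF 0 t) (map (piece_widen st) ps ++ [:: start_piece]).

Let pint_approx pt ps w : pint W (approx pt ps) w =
  pint W pt w - pint W ps w - H s w * dW W s t w.
Proof.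
rewrite /approx pint_cat pint_opp pint_cat pint_widen.
have -> : pint W [:: start_piece] w = H s w * dW W s t w.
  by rewrite /pint big_seq1.
by rewrite opprD addrA.
Qed.

Let pval_approx pt ps r w : pval (approx pt ps) r w =
  pval pt r w - pval ps r w - H s w * \1_(`[s, t[%classic) r.
Proof.
rewrite /approx pval_cat pval_opp pval_cat pval_widen.
have -> : pval [:: start_piece] r w = H s w * \1_(`[s, t[%classic) r.
  by rewrite /pval big_seq1.
by rewrite opprD addrA.
Qed.

Let H_strip_meas a b : 0 <= a -> b <= t -> strip_meas a b H.
Proof.
move=> a0 bt; have [_ mH _ _] := itoT.
apply: measurable_funS mH; first exact: strip_measurable.
move=> z [/= + _]; rewrite in_itv /= => /andP[az zb]; split => //=.
by rewrite in_itv /= (le_trans a0 az) (le_trans zb bt).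
Qed.

Let pval_strip_meas a b c (psi : seq (piece F 0 c)) : strip_meas a b (pval psi).
Proof.
apply: measurable_funS (pval_measurable hF psi) => //.
Qed.

Let Hs_strip_meas a b : strip_meas a b (fun=> H s).
Proof.
apply: (@measurable_funS _ _ _ _ setT) => //.
by apply: measurableT_comp Hs_measurable _; exact: measurable_snd.
Qed.

Local Notation sq_err c psi := (fun r w => ((pval (psi : seq (piece F 0 c)) r w - H r w) ^+ 2)%R).
Local Notation pm := (@lebesgue_measure R \x P)%E.

Let sq_err_meas a b c psi : 0 <= a -> b <= t -> strip_meas a b (sq_err c psi).
Proof.
move=> a0 bt; apply: measurable_funX; apply: measurable_funB.
  exact: pval_strip_meas.
exact: H_strip_meas.
Qed.

Let drift_meas a b : 0 <= a -> b <= t ->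
  strip_meas a b (fun r w => (H r w - H s w) ^+ 2).
Proof.
move=> a0 bt; apply: measurable_funX; apply: measurable_funB.
  exact: H_strip_meas.
exact: Hs_strip_meas.
Qed.

Let strip_sub a b a' b' : a' <= a -> b <= b' ->
  (strip a b : set (measurableTypeR R * Omega)) `<=` strip a' b'.
Proof.
move=> aa bb z [/= + _]; rewrite in_itv /= => /andP[az zb]; split => //=.
by rewrite in_itv /= (le_trans aa az) (le_trans zb bb).
Qed.

(** Before [s] the process is the difference of two approximation errors; after [s] it is the error
    of [pt] plus [H r - H s]. The factor 3 is that of [sqr_sum3]. *)
Let approx_energy pt ps e D :
  (dint P 0 t (sq_err t pt) <= e%:E)%E -> (dint P 0 s (sq_err s ps) <= e%:E)%E ->
  (dint P s t (fun r w => ((H r w - H s w) ^+ 2)%R) <= D%:E)%E ->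
  (dint P 0 t (fun r w => (pval (approx pt ps) r w ^+ 2)%R) <= (3 * (e + e + D))%:E)%E.
Proof.
rewrite !dint_prod; try by move=> *; rewrite sqr_ge0.
- move=> H1 H2 H3.
  pose g1 (z : measurableTypeR R * Omega) := ((pval pt z.1 z.2 - H z.1 z.2) ^+ 2)%:E.
  pose g2 (z : measurableTypeR R * Omega) := ((pval ps z.1 z.2 - H z.1 z.2) ^+ 2)%:E.
  pose g3 (z : measurableTypeR R * Omega) := ((H z.1 z.2 - H s z.2) ^+ 2)%:E.
  have g1m : measurable_fun (strip 0 t) g1 by apply/measurable_EFinP; exact: sq_err_meas.
  have g2m : measurable_fun (strip 0 t) (g2 \_ (strip 0 s)).
    apply/(measurable_restrict _ (strip_measurable 0 s) (strip_measurable 0 t)).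
    apply/measurable_EFinP; apply: measurable_funS (sq_err_meas ps (lexx 0) st).
      exact: strip_measurable.
    by move=> z [].
  have g3m : measurable_fun (strip 0 t) (g3 \_ (strip s t)).
    apply/(measurable_restrict _ (strip_measurable s t) (strip_measurable 0 t)).
    apply/measurable_EFinP; apply: measurable_funS (drift_meas s0 (lexx t)).
      exact: strip_measurable.
    by move=> z [].
  have g1p z : (0 <= g1 z)%E by rewrite lee_fin sqr_ge0.
  have g2p z : (0 <= (g2 \_ (strip 0 s)) z)%E.
    by rewrite patchE; case: ifP => // _; rewrite lee_fin sqr_ge0.
  have g3p z : (0 <= (g3 \_ (strip s t)) z)%E.
    by rewrite patchE; case: ifP => // _; rewrite lee_fin sqr_ge0.
  apply: (@le_trans _ _ (\int[pm]_(z in strip 0 t)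
     (3%:E * (g1 z + (g2 \_ (strip 0 s)) z + (g3 \_ (strip s t)) z)))%E).
    apply: ge0_le_integral => //.
    + exact: strip_measurable.
    + by move=> z _; rewrite lee_fin sqr_ge0.
    + apply/measurable_EFinP; apply: measurable_funX; exact: pval_strip_meas.
    + apply: measurable_funeM; apply: emeasurable_funD => //; exact: emeasurable_funD.
    + move=> [r w] [/= + _]; rewrite in_itv /= => /andP[r0 rt].
      rewrite pval_approx !patchE /g1 /g2 /g3 /=.
      have -> : ((r, w) \in strip 0 s :> bool) = (r <= s).
        by apply/idP/idP; rewrite inE /strip /= in_itv /= r0 => // -[].
      have -> : ((r, w) \in strip s t :> bool) = (s <= r).
        by apply/idP/idP; rewrite inE /strip /= in_itv /= rt andbT => // -[].
      rewrite indicE.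
      have -> : (r \in `[s, t[%classic :> bool) = (s <= r < t).
        by apply/idP/idP; rewrite inE /= in_itv.
      have [rs|sr] := ltP r s.
        rewrite (ltW rs) /= mulr0 subr0 adde0 -EFinD -EFinM lee_fin.
        have := sqr_sum3 (pval pt r w - H r w) (H r w - pval ps r w) 0.
        by rewrite expr0n /= !addr0 -[(H r w - _) ^+ 2]sqrrN opprB addrA subrK.
      rewrite (pval_end ps w sr) subr0.
      (* At [r = t] every piece has ended and the left side is 0. *)
      have [rt'|] := ltP r t; last first.
        move=> tr; rewrite andbF mulr0 subr0 (pval_end pt w tr) expr0n /=.
        rewrite mule_ge0 // ?adde_ge0 ?lee_fin ?sqr_ge0 //.
        by case: ifP => _ //; rewrite lee_fin sqr_ge0.
      rewrite andbT mulr1.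
      (* The strips are closed, so at [r = s] the middle term is still present; being nonnegative,
         it is dropped. *)
      apply: (@le_trans _ _ (3%:E * (((pval pt r w - H r w) ^+ 2)%:E
                                 + 0 + ((H r w - H s w) ^+ 2)%:E))%E).
        rewrite adde0 -EFinD -EFinM lee_fin.
        have := sqr_sum3 (pval pt r w - H r w) (H r w - H s w) 0.
        by rewrite expr0n /= !addr0 addrA subrK.
      rewrite lee_pmul2l // leeD2r // leeD2l //.
      by case: ifP => // _; rewrite lee_fin sqr_ge0.
  rewrite ge0_integralZl //; last 3 first.
  + exact: strip_measurable.
  + by apply: emeasurable_funD => //; exact: emeasurable_funD.
  + by move=> z _; rewrite !adde_ge0.
  rewrite EFinM lee_pmul2l // ge0_integralD //; last 3 first.
  + exact: strip_measurable.
  + by move=> z _; rewrite adde_ge0.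
  + exact: emeasurable_funD.
  rewrite ge0_integralD //; last exact: strip_measurable.
  rewrite !EFinD; apply: leeD; first apply: leeD => //.
    rewrite -integral_mkcondr setIidr //; exact: strip_sub.
  rewrite -integral_mkcondr setIidr //; exact: strip_sub.
- apply: measurable_funX; exact: pval_strip_meas.
- exact: drift_meas.
- exact: sq_err_meas.
- exact: sq_err_meas.
Qed.

(** Before [s] only the approximation errors remain, without [D]: this is why the remainder is
    orthogonal to the past. *)
Let approx_early_energy pt ps e :
  (dint P 0 t (sq_err t pt) <= e%:E)%E -> (dint P 0 s (sq_err s ps) <= e%:E)%E ->
  (dint P 0 s (fun r w => (pval (map (@piece_below _ _ _ _ hF 0 t s s0) (approx pt ps)) r w ^+ 2)%R)
     <= (2 * (e + e))%:E)%E.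
Proof.
rewrite !dint_prod; try by move=> *; rewrite sqr_ge0.
- move=> H1 H2.
  pose g1 (z : measurableTypeR R * Omega) := ((pval pt z.1 z.2 - H z.1 z.2) ^+ 2)%:E.
  pose g2 (z : measurableTypeR R * Omega) := ((pval ps z.1 z.2 - H z.1 z.2) ^+ 2)%:E.
  have g1m : measurable_fun (strip 0 s) g1 by apply/measurable_EFinP; exact: sq_err_meas.
  have g2m : measurable_fun (strip 0 s) g2 by apply/measurable_EFinP; exact: sq_err_meas.
  have g1p z : (0 <= g1 z)%E by rewrite lee_fin sqr_ge0.
  have g2p z : (0 <= g2 z)%E by rewrite lee_fin sqr_ge0.
  apply: (@le_trans _ _ (\int[pm]_(z in strip 0 s) (2%:E * (g1 z + g2 z)))%E).
    apply: ge0_le_integral => //.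
    + exact: strip_measurable.
    + by move=> z _; rewrite lee_fin sqr_ge0.
    + apply/measurable_EFinP; apply: measurable_funX.
      by apply: measurable_funS (pval_measurable hF _) => //.
    + apply: measurable_funeM; exact: emeasurable_funD.
    + move=> [r w] [/= + _]; rewrite in_itv /= => /andP[r0 rs].
      have [rs'|] := ltP r s; last first.
        move=> sr; have -> : r = s by lra.
        by rewrite pval_below_end expr0n mule_ge0 // adde_ge0.
      rewrite pval_below // pval_approx /g1 /g2 /=.
      rewrite indicE [_ \in _](_ : _ = false) ?mulr0 ?subr0; last first.
        by apply/negP; rewrite inE /= in_itv /= leNgt rs'.
      rewrite -EFinD -EFinM lee_fin.
      have := sqr_ge0 ((pval pt r w - H r w) + (pval ps r w - H r w)).
      nra.
  rewrite ge0_integralZl //; last 3 first.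
  + exact: strip_measurable.
  + exact: emeasurable_funD.
  + by move=> z _; rewrite adde_ge0.
  rewrite EFinM lee_pmul2l // ge0_integralD //; last exact: strip_measurable.
  rewrite EFinD leeD //; apply: le_trans H1.
  apply: ge0_subset_integral => //; try exact: strip_measurable.
    by apply/measurable_EFinP; exact: sq_err_meas.
  exact: strip_sub.
- apply: measurable_funX.
  by apply: measurable_funS (pval_measurable hF _) => //.
- exact: sq_err_meas.
- exact: sq_err_meas.
Qed.

Let pint_energy b (psi : seq (piece F 0 b)) e :
  (dint P 0 b (fun r w => (pval psi r w ^+ 2)%R) <= e%:E)%E ->
  ex P (fun w => pint W psi w ^+ 2) <= e.
Proof.
rewrite (pint_isometry hF hW (lexx 0)) -lee_fin exE; last exact: pquad_integ.
by apply: le_trans; rewrite /dint; under [leRHS]eq_integral do rewrite pval_quad.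
Qed.

Let It_measurable : measurable_fun setT It. Proof. by have [] := itoT. Qed.
Let Is_measurable : measurable_fun setT Is. Proof. by have [] := itoS. Qed.

(** A single [psi] is close to the remainder, is controlled by the mean-square variation [D] of [H],
    and has a part before [s] that is small independently of [D]. *)
Let remainder_approx e : 0 < e ->
  exists psi, [/\ sqint P ito_remainder,
    ex P (fun w => (pint W psi w - ito_remainder w) ^+ 2) <= 4 * e,
    forall D, (dint P s t (fun r w => ((H r w - H s w) ^+ 2)%R) <= D%:E)%E ->
      ex P (fun w => pint W psi w ^+ 2) <= 3 * (e + e + D) &
    ex P (fun w => pint W (map (@piece_below _ _ _ _ hF 0 t s s0) psi) w ^+ 2) <= 2 * (e + e)].
Proof.
move=> e0; have [pt [t1 t2]] := ito_approximation itoT e0.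
have [ps [s1 s2]] := ito_approximation itoS e0.
have sT := pint_sqint hF hW (lexx 0) pt.
have sS := pint_sqint hF hW (lexx 0) ps.
have [sIt et] := sqint_of_near sT It_measurable t2.
have [sIs es] := sqint_of_near sS Is_measurable s2.
have sR : sqint P ito_remainder.
  apply: sqintB; first exact: sqintB.
  apply: (sqint_mul_bounded Hs_measurable) => [w|]; first exact: H_bounded.
  exact: (dW_sqint hW).
exists (approx pt ps); split => //.
- have -> : (fun w => (pint W (approx pt ps) w - ito_remainder w) ^+ 2) =
      (fun w => ((pint W pt w - It w) + -1 * (pint W ps w - Is w)) ^+ 2).
    by apply/funext => w; rewrite pint_approx /ito_remainder; congr (_ ^+ 2); ring.
  have := ex_sqrD (sqintB sT sIt) (sqintZ (-1) (sqintB sS sIs)).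
  rewrite [X in _ + 2 * X](_ : _ = ex P (fun w => (pint W ps w - Is w) ^+ 2)).
    lra.
  by apply: eq_ex => w; rewrite mulN1r sqrrN.
- by move=> D HD; apply: pint_energy; exact: approx_energy.
- by apply: pint_energy; exact: approx_early_energy.
Qed.

Lemma ito_remainder_sqint : sqint P ito_remainder.
Proof.
have [pt [_ t2]] := ito_approximation itoT ltr01.
have [ps [_ s2]] := ito_approximation itoS ltr01.
have [sIt _] := sqint_of_near (pint_sqint hF hW (lexx 0) pt) It_measurable t2.
have [sIs _] := sqint_of_near (pint_sqint hF hW (lexx 0) ps) Is_measurable s2.
apply: sqintB; first exact: sqintB.
apply: (sqint_mul_bounded Hs_measurable) => [w|]; first exact: H_bounded.
exact: (dW_sqint hW).
Qed.

Lemma ito_remainder_variance D :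
  (dint P s t (fun r w => ((H r w - H s w) ^+ 2)%R) <= D%:E)%E ->
  ex P (fun w => ito_remainder w ^+ 2) <= 6 * D.
Proof.
move=> HD; apply/ler_addgt0Pr => e e0.
(* With accuracy [e1] the bound is [2 * 4 e1 + 2 * 3 (2 e1 + D) = 20 e1 + 6 D]. *)
have e1 : 0 < e / 20 by lra.
have [psi [sR H1 /(_ _ HD) H2 _]] := remainder_approx e1.
have sI := pint_sqint hF hW (lexx 0) psi.
have := ex_sqrD (sqintZ (-1) (sqintB sI sR)) sI.
have -> : (fun w => (-1 * (pint W psi w - ito_remainder w) + pint W psi w) ^+ 2) =
  (fun w => ito_remainder w ^+ 2) by apply/funext => w; congr (_ ^+ 2); ring.
have -> : (fun w => (-1 * (pint W psi w - ito_remainder w)) ^+ 2) =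
  (fun w => (pint W psi w - ito_remainder w) ^+ 2).
  by apply/funext => w; rewrite mulN1r sqrrN.
lra.
Qed.

(** The approximation is split at [s]: its late part has mean zero against [Y] by [pint_mean], while
    its early part and the approximation error are arbitrarily small in L2. *)
Lemma ito_remainder_mean L Y : fmeas F s Y -> (forall w, `|Y w| <= L) ->
  ex P (fun w => Y w * ito_remainder w) = 0.
Proof.
move=> fY bY; have mY := fmeas_measurable hF fY.
have sY : sqint P Y by exact: sqint_bounded bY.
have L0 : 0 <= L by exact: le_trans (bY point).
have EY : ex P (fun w => Y w ^+ 2) <= L ^+ 2.
  rewrite -[leRHS](ex_cst P); apply: ex_le => //; first by case: sY.
    exact: integ_cst.
  by move=> w; rewrite -real_normK ?num_real // lerXn2r ?nnegrE.
apply/eqP; rewrite -normr_le0; apply/ler_addgt0Pr => e e0; rewrite add0r.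
(* At accuracy [c ^+ 2] both L2 errors are at most [2 c], and [4 L c <= e]; the [+ 1] covers
   [L = 0]. *)
pose c := e / (4 * (L + 1)).
have c0 : 0 < c by rewrite divr_gt0 // mulr_gt0 // ltr_wpDl.
have [psi [sR H1 _ H2]] := remainder_approx (exprn_gt0 2 c0).
set below := map _ psi in H2.
have sI := pint_sqint hF hW (lexx 0) psi.
have sB := pint_sqint hF hW (lexx 0) below.
have sE := sqintB sI sR.
have iYA : integ P (fun w => Y w * pint W (map (piece_above hF st) psi) w).
  by apply: sqint_mul => //; exact: (pint_sqint hF hW s0).
have split w : Y w * ito_remainder w = (Y w * pint W below w +
    Y w * pint W (map (piece_above hF st) psi) w) -
    Y w * (pint W psi w - ito_remainder w).
  by rewrite (pint_split hF W s0 st); ring.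
rewrite (eq_ex _ split) exB; last 2 first.
- by apply: integD => //; exact: sqint_mul.
- exact: sqint_mul.
rewrite exD //; last exact: sqint_mul.
rewrite (pint_mean hF hW _ s0 fY bY) addr0.
have c20 : 0 <= 2 * c by rewrite mulr_ge0 // ltW.
have B1 : `|ex P (fun w => Y w * pint W below w)| <= L * (2 * c).
  by apply: ex_mul_le => //; lra.
have B2 : `|ex P (fun w => Y w * (pint W psi w - ito_remainder w))| <= L * (2 * c).
  by apply: ex_mul_le => //; lra.
apply: (le_trans (ler_normB _ _)); apply: (le_trans (lerD B1 B2)).
have -> : L * (2 * c) + L * (2 * c) = e * (L / (L + 1)) by rewrite /c; field; lra.
rewrite -[leRHS]mulr1 ler_wpM2l ?(ltW e0) // ler_pdivrMr ?mul1r; lra.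
Qed.

End ItoIncrement.

Definition path_cont {R : realType} (f : R -> R) : Prop :=
  {within `[0, +oo[, continuous f}.

Lemma path_contP {R : realType} (f : R -> R) : path_cont f <->
  forall x, 0 <= x -> forall e, 0 < e ->
    exists2 r, 0 < r & forall v, 0 <= v -> `|v - x| < r -> `|f v - f x| < e.
Proof.
rewrite /path_cont subspace_continuousP; split=> [H x x0 e e0|H x].
  have : `[0, +oo[%classic x by rewrite /= in_itv /= x0.
  move=> /H /cvgr_dist_lt /(_ e e0) [r /= r0 Hr]; exists r => // v v0 vx.
  rewrite distrC; apply: Hr => /=; first by rewrite distrC.
  by rewrite in_itv /= v0.
rewrite /= in_itv /= andbT => x0; apply/cvgrPdist_lt => e e0.
have [r r0 Hr] := H x x0 e e0; exists r => //= v vx.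
by rewrite in_itv /= andbT => v0; rewrite distrC; apply: Hr => //; rewrite distrC.
Qed.

Lemma path_cont_seq {R : realType} (f : R -> R) (x : R) (v : nat -> R) :
  path_cont f -> 0 <= x -> (forall n, 0 <= v n) ->
  v n @[n --> \oo] --> x -> f (v n) @[n --> \oo] --> f x.
Proof.
move=> /path_contP H x0 v0 vx; apply/cvgrPdist_lt => e e0.
have [r r0 Hr] := H x x0 e e0.
near=> n; rewrite distrC; apply: Hr => //; rewrite distrC.
by near: n; exact: cvgr_dist_lt.
Unshelve. all: end_near. Qed.

(** * Mean-square continuity of bounded processes with continuous paths *)

Section MeanSquareContinuity.
Context {R : realType} {d : measure_display} {Omega : measurableType d}.
Variable P : probability Omega R.
Variables (H : R -> Omega -> R) (K : R).
Hypothesis H_bounded : forall r w, 0 <= r -> `|H r w| <= K.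
Hypothesis H_measurable : forall r, 0 <= r -> measurable_fun setT (H r).
Hypothesis H_cont : forall w, path_cont (H ^~ w).

Let sq_bounded r s w : 0 <= r -> 0 <= s -> `|(H r w - H s w) ^+ 2| <= (2 * K) ^+ 2.
Proof.
move=> r0 s0; have K0 : 0 <= K by exact: le_trans (H_bounded w r0).
rewrite normrX lerXn2r ?nnegrE ?mulr_ge0 //.
apply: (le_trans (ler_normB _ _)).
by have := H_bounded w r0; have := H_bounded w s0; lra.
Qed.

Let sq_measurable r s : 0 <= r -> 0 <= s ->
  measurable_fun setT (fun w => (H r w - H s w) ^+ 2).
Proof. by move=> r0 s0; apply/measurable_funX/measurable_funB; exact: H_measurable. Qed.

Let sq_integ r s : 0 <= r -> 0 <= s -> integ P (fun w => (H r w - H s w) ^+ 2).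
Proof.
by move=> r0 s0; apply: integ_bounded => [|w]; [exact: sq_measurable|exact: sq_bounded].
Qed.

(** Otherwise some times [v n] tend to [x] with mean squares above [e], against dominated
    convergence along the continuous paths. *)
Let sq_cont x e : 0 <= x -> 0 < e -> exists2 r, 0 < r & forall v, 0 <= v ->
  `|v - x| < r -> ex P (fun w => (H v w - H x w) ^+ 2) <= e.
Proof.
move=> x0 e0; apply: contrapT => /forall2NP Hn.
have /choice [v Hv] n : exists v, [/\ 0 <= v, `|v - x| < n.+1%:R^-1 &
    e < ex P (fun w => (H v w - H x w) ^+ 2)].
  have [|/existsNP[v /not_implyP[v0 /not_implyP[vx /negP]]]] := Hn n.+1%:R^-1.
    by rewrite invr_gt0 ltr0n.
  by rewrite -ltNge => ev; exists v.
have vx : v n @[n --> \oo] --> x.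
  apply/cvgrPdist_lt => r r0.
  near=> n; have [_ vn _] := Hv n; rewrite distrC; apply: (lt_trans vn).
  by near: n; exact: (cvgr_lt 0 (@cvg_harmonic R) r r0).
have := @ex_dominated _ _ _ P ((2 * K) ^+ 2) (fun n w => (H (v n) w - H x w) ^+ 2)
   (fun=> 0).
rewrite ex_cst => Hc.
have {}Hc : ex P (fun w => (H (v n) w - H x w) ^+ 2) @[n --> \oo] --> (0 : R).
  apply: Hc => //.
  - by move=> n; have [vn0 _ _] := Hv n; exact: sq_measurable.
  - by move=> n w; have [vn0 _ _] := Hv n; exact: sq_bounded.
  - apply: aeW => w.
    have Hw : H (v n) w - H x w @[n --> \oo] --> H x w - H x w.
      apply: cvgB; last exact: cvg_cst.
      have v0 n : 0 <= v n by have [] := Hv n.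
      exact: (@path_cont_seq R (H ^~ w) x v (@H_cont w) x0 v0 vx).
    have HH := cvgM Hw Hw; rewrite subrr mulr0 in HH.
    have -> : (fun n => (H (v n) w - H x w) ^+ 2) =
      (fun n => (H (v n) w - H x w) * (H (v n) w - H x w)).
      by apply/funext => n; rewrite expr2.
    exact: HH.
have [n _ /(_ n (leqnn n))] := cvgr_lt 0 Hc e e0.
by have [_ _ ev] := Hv n; rewrite ltNge (ltW ev).
Unshelve. all: end_near. Qed.

(** Uniform continuity in L2, from compactness of [[0, T]]. *)
Lemma mean_square_uniform T e : 0 < e -> exists2 h, 0 < h & forall s t,
  0 <= s -> s <= t -> t <= T -> t - s <= h ->
  ex P (fun w => (H t w - H s w) ^+ 2) <= e.
Proof.
move=> e0.
have /compact_near_coveringP /(_ _ (0 : R)^'+ (fun h x => 0 <= x -> forall y, 0 <= y ->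
    `|y - x| <= h -> ex P (fun w => (H y w - H x w) ^+ 2) <= e)) := @segment_compact R 0 T.
case=> [x /=|h /= h0 Hh].
  rewrite in_itv /= => /andP[x0 _].
  (* Two points are compared through the centre [x], and [(a + b)^2 <= 2 a^2 + 2 b^2] turns two
     quarters into [e]. *)
  have e4 : 0 < e / 4 by lra.
  have [r r0 Hr] := sq_cont x0 e4.
  exists (ball x (r / 2), [set h : R | h < r / 2]) => [|[x' h] /= [xx' hr] x'0 y y0 yx'].
    split; first by apply: nbhsx_ballx; lra.
    by apply: nbhs_right_lt; lra.
  rewrite /ball /= in xx'.
  have h1 : `|x' - x| < r by rewrite distrC; lra.
  have h2 : `|y - x| < r.
    have -> : y - x = (y - x') + (x' - x) by ring.
    by apply: (le_lt_trans (ler_normD _ _)); rewrite [X in _ + X]distrC; lra.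
  have sq u : 0 <= u -> sqint P (fun w => H u w - H x w).
    by move=> u0; split; [apply: measurable_funB; exact: H_measurable|exact: sq_integ].
  have := ex_sqrD (sq y y0) (sqintZ (-1) (sq x' x'0)).
  have -> : (fun w => (H y w - H x w + -1 * (H x' w - H x w)) ^+ 2) =
    (fun w => (H y w - H x' w) ^+ 2) by apply/funext => w; congr (_ ^+ 2); ring.
  have -> : (fun w => (-1 * (H x' w - H x w)) ^+ 2) =
    (fun w => (H x' w - H x w) ^+ 2) by apply/funext => w; rewrite mulN1r sqrrN.
  have := Hr y y0 h2; have := Hr x' x'0 h1; lra.
exists (h / 2) => [|s t s0 st tT ts]; first by lra.
have h2 : 0 < h / 2 by lra.
apply: (Hh (h / 2)) => //=.
- by rewrite /ball /= sub0r normrN ger0_norm; lra.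
- by rewrite in_itv /= s0 (le_trans st tT).
- exact: le_trans st.
- by rewrite ger0_norm // subr_ge0.
Qed.

Lemma dint_mean_square T e : 0 < e -> exists2 h, 0 < h & forall s t,
  0 <= s -> s <= t -> t <= T -> t - s <= h -> strip_meas s t H ->
  (dint P s t (fun r w => ((H r w - H s w) ^+ 2)%R) <= (e * (t - s))%:E)%E.
Proof.
move=> e0; have [h h0 Hh] := mean_square_uniform T e0; exists h => //.
move=> s t s0 st tT ts mH.
have mG : strip_meas s t (fun r w => (H r w - H s w) ^+ 2).
  apply: measurable_funX; apply: measurable_funB => //.
  apply: (@measurable_funS _ _ _ _ setT) => //.
  by apply: measurableT_comp (H_measurable s0) _; exact: measurable_snd.
rewrite dint_swap //; last by move=> *; exact: sqr_ge0.
apply: (@le_trans _ _ (\int[lebesgue_measure]_(r in `[s, t]) e%:E)%E).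
  apply: ge0_le_integral => //.
  - by move=> r _; apply: integral_ge0 => w _; rewrite lee_fin sqr_ge0.
  - apply: (dint_inner_measurable P mG).
    by move=> *; exact: sqr_ge0.
  - move=> r; rewrite /= in_itv /= => /andP[sr rt].
    have r0 : 0 <= r by exact: le_trans sr.
    by rewrite -exE ?lee_fin; [apply: Hh => //; lra|exact: sq_integ].
rewrite integral_cst //= lebesgue_measure_itv /= lte_fin.
have [ts'|ts'] := ltP s t; first by rewrite -EFinB -EFinM.
by rewrite mule0 lee_fin mulr_ge0 ?subr_ge0 // ltW.
Qed.

End MeanSquareContinuity.

Section WienerExponential.
Context {R : realType} {d : measure_display} {Omega : measurableType d}.
Variable P : probability Omega R.
Variable F : R -> set (set Omega).
Hypothesis hF : filtration F.
Variable W : R -> Omega -> R.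
Hypothesis hW : standard_wiener P F W.
Variables s t : R.
Hypothesis s0 : 0 <= s.
Hypothesis st : s < t.
Local Notation Z := (dW W s t).

Let h0 : 0 < t - s. Proof. by rewrite subr_gt0. Qed.

Let mZ : measurable_fun setT Z.
Proof. by apply: (dW_measurable hW) => //; exact: (le_trans s0 (ltW st)). Qed.

Let lawZ := dW_law hW s0 st.

Lemma dW_expR_sqint k : sqint P (fun w => expR (k * Z w)).
Proof. exact: (gauss_sqint_expR h0 mZ lawZ). Qed.

Lemma dW_mean_expR K Y k : fmeas F s Y -> (forall w, `|Y w| <= K) ->
  ex P (fun w => Y w * expR (k * Z w)) = ex P Y * expR (k ^+ 2 * (t - s) / 2).
Proof.
move=> fY bY; have mY := fmeas_measurable hF fY.
have iE := gauss_integ_expR h0 mZ lawZ k.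
rewrite (ex_mul_dW hF hW (g := fun z => expR (k * z))) //.
- by rewrite (gauss_mgf h0 mZ lawZ).
- by apply: measurableT_comp => //; exact: measurable_funM.
- exact: integ_bounded bY.
- exact: integ_mul_bounded bY iE.
Qed.

Lemma dW_mean_ZexpR K Y k : fmeas F s Y -> (forall w, `|Y w| <= K) ->
  ex P (fun w => Y w * (Z w * expR (k * Z w))) =
  ex P Y * (k * (t - s) * expR (k ^+ 2 * (t - s) / 2)).
Proof.
move=> fY bY; have mY := fmeas_measurable hF fY.
have iE := gauss_integ_ZexpR h0 mZ lawZ k.
rewrite (ex_mul_dW hF hW (g := fun z => z * expR (k * z))) //.
- by rewrite (gauss_mean_expR h0 mZ lawZ).
- have mE : measurable_fun setT (fun z : R => expR (k * z)).
    by apply: measurableT_comp => //; exact: measurable_funM.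
  exact: measurable_funM.
- exact: integ_bounded bY.
- exact: integ_mul_bounded bY iE.
Qed.

Lemma dW_integ_ZexpR k : integ P (fun w => Z w * expR (k * Z w)).
Proof. exact: (gauss_integ_ZexpR h0 mZ lawZ). Qed.

(** With [u = 2 k^2 h], the expectation is [e^u - 2 e^(k^2 h / 2) + 1 <= e^u - 1 <= u e^u]; [h <= 1]
    then makes the exponential a constant. *)
Lemma dW_expR_sub1 k : t - s <= 1 ->
  ex P (fun w => (expR (k * Z w) - 1) ^+ 2) <=
  2 * k ^+ 2 * expR (2 * k ^+ 2) * (t - s).
Proof.
move=> h1; have i1 := gauss_integ_expR h0 mZ lawZ (2 * k).
have i2 := gauss_integ_expR h0 mZ lawZ k.
have -> : (fun w => (expR (k * Z w) - 1) ^+ 2) =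
    (fun w => (expR (2 * k * Z w) - 2 * expR (k * Z w)) + 1).
  apply/funext => w.
  have -> : expR (2 * k * Z w) = expR (k * Z w) ^+ 2.
    by rewrite expr2 -expRD; congr expR; ring.
  by ring.
rewrite exD; [|by apply: integB => //; exact: integZ|exact: integ_cst].
rewrite exB //; last exact: integZ.
rewrite exZ // ex_cst !(gauss_mgf h0 mZ lawZ).
set h := t - s in h1 *; have h0' : 0 <= h by exact: ltW.
have -> : (2 * k) ^+ 2 * h / 2 = 2 * k ^+ 2 * h by field.
have k2 : 0 <= k ^+ 2 by exact: sqr_ge0.
have e1 : 1 <= expR (k ^+ 2 * h / 2).
  by rewrite -expR0 ler_expR mulr_ge0 // mulr_ge0.
pose u := 2 * k ^+ 2 * h.
have u0 : 0 <= u by rewrite /u mulr_ge0 // mulr_ge0.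
have e2 : expR u - 1 <= u * expR u.
  have := expR_ge1Dx (- u); rewrite expRN => Hu.
  have eu := expR_gt0 u.
  have := ler_wpM2r (ltW eu) Hu.
  rewrite mulVf ?gt_eqF //; lra.
have e3 : u * expR u <= 2 * k ^+ 2 * expR (2 * k ^+ 2) * h.
  have -> : 2 * k ^+ 2 * expR (2 * k ^+ 2) * h = u * expR (2 * k ^+ 2).
    by rewrite /u; ring.
  by rewrite ler_wpM2l // ler_expR /u ler_piMr // mulr_ge0.
rewrite -/u; lra.
Qed.

End WienerExponential.

(** * Decay of the geometric mean *)

Section Expansion.
Context {R : realType} {d : measure_display} {Omega : measurableType d}.
Variable P : probability Omega R.
Variable F : R -> set (set Omega).
Hypothesis hF : filtration F.
Variable W : R -> Omega -> R.
Hypothesis hW : standard_wiener P F W.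

Definition remainder (x a : R -> Omega -> R) s t w : R :=
  x t w - x s w - a s w * dW W s t w.

(** [x] has stochastic differential [a dW], in the mean-square sense. *)
Record expands (x a : R -> Omega -> R) : Prop := {
  expands_sqint : forall s t, 0 <= s -> s <= t -> sqint P (remainder x a s t);
  expands_mean : forall s t, 0 <= s -> s <= t -> forall K Y,
    fmeas F s Y -> (forall w, `|Y w| <= K) ->
    ex P (fun w => Y w * remainder x a s t w) = 0;
  expands_variance : forall T e, 0 < e -> exists2 h, 0 < h & forall s t,
    0 <= s -> s <= t -> t <= T -> t - s <= h ->
    ex P (fun w => remainder x a s t w ^+ 2) <= e * (t - s)
}.

Lemma expandsD x a y b : expands x a -> expands y b ->
  expands (fun t w => x t w + y t w) (fun t w => a t w + b t w).
Proof.
move=> ex_ ey.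
have E s t : remainder (fun t w => x t w + y t w) (fun t w => a t w + b t w) s t =
    (fun w => remainder x a s t w + remainder y b s t w).
  by apply/funext => w; rewrite /remainder; ring.
split.
- by move=> s t s0 st; rewrite E; apply: sqintD; apply: expands_sqint.
- move=> s t s0 st K Y fY bY; have mY := fmeas_measurable hF fY; rewrite E.
  under eq_ex do rewrite mulrDr.
  rewrite exD; last 2 first.
  + by apply: (integ_mul_bounded mY bY); apply: sqint_integ; apply: expands_sqint.
  + by apply: (integ_mul_bounded mY bY); apply: sqint_integ; apply: expands_sqint.
  by rewrite (expands_mean ex_ s0 st fY bY) (expands_mean ey s0 st fY bY) addr0.
- move=> T e e0; have e4 : 0 < e / 4 by lra.
  have [h1 h10 H1] := expands_variance ex_ T e4.
  have [h2 h20 H2] := expands_variance ey T e4.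
  exists (Num.min h1 h2); first by rewrite lt_min h10.
  move=> s t s0 st tT; rewrite le_min => /andP[th1 th2]; rewrite E.
  apply: (le_trans (ex_sqrD (expands_sqint ex_ s0 st) (expands_sqint ey s0 st))).
  have := H1 s t s0 st tT th1; have := H2 s t s0 st tT th2; lra.
Qed.

Lemma expandsZ k x a : expands x a ->
  expands (fun t w => k * x t w) (fun t w => k * a t w).
Proof.
move=> ex_.
have E s t : remainder (fun t w => k * x t w) (fun t w => k * a t w) s t =
    (fun w => k * remainder x a s t w).
  by apply/funext => w; rewrite /remainder; ring.
split.
- by move=> s t s0 st; rewrite E; apply: sqintZ; apply: expands_sqint.
- move=> s t s0 st K Y fY bY; have mY := fmeas_measurable hF fY; rewrite E.
  under eq_ex do rewrite mulrCA.
  rewrite exZ; last first.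
    by apply: (integ_mul_bounded mY bY); apply: sqint_integ; apply: expands_sqint.
  by rewrite (expands_mean ex_ s0 st fY bY) mulr0.
- move=> T e e0.
  have c0 : 0 < k ^+ 2 + 1 by have := sqr_ge0 k; lra.
  have [h h0 H] := expands_variance ex_ T (divr_gt0 e0 c0).
  exists h => // s t s0 st tT th; rewrite E.
  under eq_ex do rewrite exprMn.
  rewrite exZ; last by have [] := expands_sqint ex_ s0 st.
  apply: (le_trans (ler_wpM2l (sqr_ge0 k) (H s t s0 st tT th))).
  rewrite mulrA ler_wpM2r ?subr_ge0 // mulrCA ler_piMr ?(ltW e0) //.
  by rewrite ler_pdivrMr // mul1r; lra.
Qed.

Lemma expands0 : expands (fun _ _ => 0) (fun _ _ => 0).
Proof.
have E s t : remainder (fun _ _ => 0) (fun _ _ => 0) s t = fun=> 0.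
  by apply/funext => w; rewrite /remainder; ring.
split.
- by move=> s t _ _; rewrite E; apply: (@sqint_bounded _ _ _ P 0) => // w; rewrite normr0.
- move=> s t _ _ K Y _ _; rewrite E; under eq_ex do rewrite mulr0.
  exact: ex_cst.
- move=> T e e0; exists 1 => // s t s0 st _ _; rewrite E.
  under eq_ex do rewrite expr0n.
  by rewrite ex_cst mulr_ge0 ?subr_ge0 // ltW.
Qed.

Lemma expands_sum I (r : seq I) (x a : I -> R -> Omega -> R) :
  (forall i, expands (x i) (a i)) ->
  expands (fun t w => \sum_(i <- r) x i t w) (fun t w => \sum_(i <- r) a i t w).
Proof.
move=> H; elim: r => [|i r ih].
  have -> : (fun t w => \sum_(i <- [::]) x i t w) = (fun _ _ => 0).
    by apply/funext => t; apply/funext => w; rewrite big_nil.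
  have -> : (fun t w => \sum_(i <- [::]) a i t w) = (fun _ _ => 0).
    by apply/funext => t; apply/funext => w; rewrite big_nil.
  exact: expands0.
have -> : (fun t w => \sum_(j <- i :: r) x j t w) =
    (fun t w => x i t w + \sum_(j <- r) x j t w).
  by apply/funext => t; apply/funext => w; rewrite big_cons.
have -> : (fun t w => \sum_(j <- i :: r) a j t w) =
    (fun t w => a i t w + \sum_(j <- r) a j t w).
  by apply/funext => t; apply/funext => w; rewrite big_cons.
exact: expandsD.
Qed.

(** Only increments of the process enter, so a term constant in time, such as the initial state, may
    be dropped. *)
Lemma expands_ext x a x' a' : (forall s t w, 0 <= s -> s <= t ->
    x' t w - x' s w = x t w - x s w /\ a' s w = a s w) ->
  expands x a -> expands x' a'.
Proof.
move=> H ex_.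
have E s t : 0 <= s -> s <= t -> remainder x' a' s t = remainder x a s t.
  move=> s0 st; apply/funext => w; rewrite /remainder.
  by have [-> ->] := H s t w s0 st.
split.
- by move=> s t s0 st; rewrite E //; apply: expands_sqint.
- by move=> s t s0 st K Y fY bY; rewrite E //; exact: (expands_mean ex_ s0 st fY bY).
- move=> T e e0; have [h h0 Hh] := expands_variance ex_ T e0.
  by exists h => // s t s0 st tT th; rewrite E //; exact: Hh.
Qed.

(** Mean-square continuity makes the time integral of [(H r - H s)^2] small compared with [t - s],
    which bounds the variance of the remainder. *)
Lemma ito_expands H I K :
  (forall t, 0 <= t -> is_ito_integral P F W H t (I t)) ->
  (forall r w, 0 <= r -> `|H r w| <= K) ->
  (forall w, path_cont (H ^~ w)) ->
  expands I H.
Proof.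
move=> ito bH cH.
have mH r : 0 <= r -> measurable_fun setT (H r).
  move=> r0; have [aH _ _ _] := ito r r0.
  by apply: (fmeas_measurable hF (t := r)) => B mB; exact: aH.
have E s t : remainder I H s t = ito_remainder W H s t (I s) (I t) by [].
split.
- by move=> s t s0 st; rewrite E; apply: (ito_remainder_sqint hF hW s0 st _ _ bH); apply: ito; lra.
- move=> s t s0 st L Y fY bY; rewrite E.
  by apply: (ito_remainder_mean hF hW s0 st _ _ bH fY bY); apply: ito; lra.
(* Compensates the factor 6 of [ito_remainder_variance]. *)
- move=> T e e0; have e6 : 0 < e / 6 by lra.
  have [h h0 Hh] := dint_mean_square P bH mH cH T e6.
  exists h => // s t s0 st tT th; rewrite E.
  have -> : e * (t - s) = 6 * (e / 6 * (t - s)) by field.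
  apply: (ito_remainder_variance hF hW s0 st _ _ bH); try (apply: ito; lra).
  apply: Hh => //; have [_ mHt _ _] := ito t (le_trans s0 st).
  apply: measurable_funS mHt.
    exact: strip_measurable.
  move=> z [/= + _]; rewrite in_itv /= => /andP[az zb]; split => //=.
  by rewrite in_itv /= (le_trans s0 az).
Qed.

End Expansion.

Section GeometricMean.
Context {R : realType}.
Implicit Types a b l q x y : R.

Lemma weighted_geometric_mean a b l l' : 0 <= a -> 0 <= b -> 0 <= l -> 0 <= l' ->
  l * l' = 1 -> Num.sqrt (a * b) <= (a * l + b * l') / 2.
Proof.
move=> a0 b0 l0 l'0 ll.
have al : 0 <= a * l by exact: mulr_ge0.
have bl : 0 <= b * l' by exact: mulr_ge0.
rewrite -(@ler_pXn2r _ 2) ?nnegrE ?sqrtr_ge0 ?divr_ge0 ?addr_ge0 //.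
rewrite sqr_sqrtr ?mulr_ge0 //.
have -> : a * b = (a * l) * (b * l') by rewrite mulrACA ll mulr1.
have := sqr_ge0 (a * l - b * l').
rewrite expr_div_n sqrrB sqrrD; lra.
Qed.

(** The shift by [q ^+ 2] keeps the square root away from its singularity. *)
Definition gmean q x y := Num.sqrt ((x + q ^+ 2) * (y + q ^+ 2)).

(** This is [sqrt ((y + q^2) / (x + q^2))], the weight that makes the two AM-GM terms equal. *)
Definition gratio q x y := gmean q x y * (x + q ^+ 2)^-1.

Variable q : R.
Hypothesis q0 : 0 < q.
Hypothesis q1 : q <= 1.

Let q2 : 0 < q ^+ 2. Proof. exact: exprn_gt0. Qed.
Let q21 : q ^+ 2 <= 1. Proof. exact: exprn_ile1 (ltW q0) q1. Qed.

Lemma gmean_ge0 x y : 0 <= gmean q x y.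
Proof. exact: sqrtr_ge0. Qed.

Lemma gmeanC x y : gmean q x y = gmean q y x.
Proof. by rewrite /gmean mulrC. Qed.

Lemma gmean_sqr x y : 0 <= x -> 0 <= y ->
  gmean q x y ^+ 2 = (x + q ^+ 2) * (y + q ^+ 2).
Proof. by move=> x0 y0; rewrite sqr_sqrtr // mulr_ge0; have := q2; lra. Qed.

Lemma gmean_le2 x y : 0 <= x <= 1 -> 0 <= y <= 1 -> gmean q x y <= 2.
Proof.
move=> /andP[x0 x1] /andP[y0 y1].
rewrite -(@ler_pXn2r _ 2) ?nnegrE ?gmean_ge0 // gmean_sqr //.
have -> : 2 ^+ 2 = 2 * 2 :> R by ring.
by apply: ler_pM; have := q2; have := q21; lra.
Qed.

Lemma gratio_ge0 x y : 0 <= x -> 0 <= gratio q x y.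
Proof. by move=> x0; rewrite mulr_ge0 ?gmean_ge0 // invr_ge0; have := q2; lra. Qed.

Lemma gratio_le x y : 0 <= x <= 1 -> 0 <= y <= 1 -> gratio q x y <= 2 / q.
Proof.
move=> /andP[x0 x1] /andP[y0 y1].
have X0 : 0 < x + q ^+ 2 by have := q2; have := q21; lra.
rewrite /gratio ler_pdivrMr //.
have X1 : 1 <= (x + q ^+ 2) / q ^+ 2 by rewrite ler_pdivlMr // mul1r; lra.
rewrite -(@ler_pXn2r _ 2) ?nnegrE ?gmean_ge0 ?mulr_ge0 ?invr_ge0 ?(ltW X0) ?(ltW q0) //.
rewrite gmean_sqr //.
have -> : (2 / q * (x + q ^+ 2)) ^+ 2 = (x + q ^+ 2) * (4 * ((x + q ^+ 2) / q ^+ 2)).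
  by field; rewrite gt_eqF.
by rewrite ler_wpM2l ?(ltW X0) //; have := q21; lra.
Qed.

Lemma gratioK x y : 0 <= x -> gratio q x y * (x + q ^+ 2) = gmean q x y.
Proof. by move=> x0; rewrite /gratio mulfVK // gt_eqF //; have := q2; lra. Qed.

Lemma gratio_inv x y : 0 <= x -> 0 <= y -> gratio q x y * gratio q y x = 1.
Proof.
move=> x0 y0; rewrite /gratio (gmeanC y x) mulrACA -expr2 gmean_sqr // -invfM.
by rewrite divff // gt_eqF // mulr_gt0; have := q2; lra.
Qed.

Lemma sqrt_le_gmean x y : 0 <= x -> 0 <= y -> Num.sqrt (x * y) <= gmean q x y.
Proof. by move=> x0 y0; apply: ler_wsqrtr; apply: ler_pM; have := q2; lra. Qed.

(** For [x], [y] and [q] at most 1, [(x + q^2) (y + q^2) <= x y + 3 q^2], which is below the square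
    of the right side. *)
Lemma gmean_le_sqrt x y : 0 <= x <= 1 -> 0 <= y <= 1 ->
  gmean q x y <= Num.sqrt (x * y) + 2 * q.
Proof.
move=> /andP[x0 x1] /andP[y0 y1]; have s0 := sqrtr_ge0 (x * y).
have qq := ltW q0.
rewrite -(@ler_pXn2r _ 2) ?nnegrE ?gmean_ge0 ?addr_ge0 ?mulr_ge0 // gmean_sqr //.
have := @sqr_sqrtr _ (x * y) (mulr_ge0 x0 y0).
have := mulr_ge0 s0 qq.
have h1 : x * q ^+ 2 <= q ^+ 2 by rewrite ler_piMl // ltW.
have h2 : y * q ^+ 2 <= q ^+ 2 by rewrite ler_piMl // ltW.
have h3 : q ^+ 2 * q ^+ 2 <= q ^+ 2 by rewrite ler_piMl // ltW.
rewrite sqrrD exprMn; have := q2; have := q21; lra.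
Qed.

End GeometricMean.

Section Decay.
Context {R : realType} {d : measure_display} {Omega : measurableType d}.
Variable P : probability Omega R.
Variable F : R -> set (set Omega).
Hypothesis hF : filtration F.
Variable W : R -> Omega -> R.
Hypothesis hW : standard_wiener P F W.

Variables (x y A B : R -> Omega -> R) (k K : R).
Hypothesis x01 : forall r w, 0 <= r -> 0 <= x r w <= 1.
Hypothesis y01 : forall r w, 0 <= r -> 0 <= y r w <= 1.
Hypothesis fx : forall r, 0 <= r -> fmeas F r (x r).
Hypothesis fy : forall r, 0 <= r -> fmeas F r (y r).
Hypothesis fA : forall r, 0 <= r -> fmeas F r (A r).
Hypothesis fB : forall r, 0 <= r -> fmeas F r (B r).
Hypothesis bA : forall r w, 0 <= r -> `|A r w| <= K.
Hypothesis bB : forall r w, 0 <= r -> `|B r w| <= K.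
Hypothesis AB : forall r w, 0 <= r -> A r w - B r w = 2 * k.
Hypothesis hx : expands P F W x (fun r w => A r w * x r w).
Hypothesis hy : expands P F W y (fun r w => B r w * y r w).

Lemma fmeas_gmean q r : 0 <= r -> fmeas F r (fun w => gmean q (x r w) (y r w)).
Proof.
move=> r0; apply: (fmeas_comp hF (g := @Num.sqrt R)).
  by apply: continuous_measurable_fun; exact: sqrt_continuous.
by apply: fmeasM => //; apply: fmeasD => //; (exact: fmeas_cst || exact: fx || exact: fy).
Qed.

Lemma fmeas_gratio q r (u v : Omega -> R) : 0 < q -> (forall w, 0 <= u w) ->
  fmeas F r u -> fmeas F r v -> fmeas F r (fun w => gratio q (u w) (v w)).
Proof.
move=> q0 u0 fu fv; rewrite /gratio; apply: fmeasM => //.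
  apply: (fmeas_comp hF (g := @Num.sqrt R)).
    by apply: continuous_measurable_fun; exact: sqrt_continuous.
  by apply: fmeasM => //; apply: fmeasD => //; exact: fmeas_cst.
(* The inverse becomes a power so that [measurable_powR] applies; the base is nonnegative, as
   [powR_inv1] requires. *)
have -> : (fun w => (u w + q ^+ 2)^-1) = (fun w => powR (u w + q ^+ 2) (-1)).
  apply/funext => w; rewrite powR_inv1 // addr_ge0 //; exact: sqr_ge0.
apply: (fmeas_comp hF (g := fun z => powR z (-1))); first exact: measurable_powR.
by apply: fmeasD => //; exact: fmeas_cst.
Qed.

(** The constant of [dW_expR_sub1]. *)
Let N := 2 * k ^+ 2 * expR (2 * k ^+ 2).
Let N0 : 0 <= N. Proof. by rewrite /N mulr_ge0 ?expR_ge0 // mulr_ge0 // sqr_ge0. Qed.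
Let K0 : 0 <= K. Proof. exact: le_trans (bA point (lexx 0)). Qed.

(** The first term is the cost of the shift by [q ^+ 2] in the drift, the [2] that of the two
    remainders. *)
Definition decay_const := 2 * `|k| * expR (k ^+ 2 / 2) * K + 2.

Section Step.
Variables (q s t : R) (S : set Omega).
Hypothesis q0 : 0 < q.
Hypothesis q1 : q <= 1.
Hypothesis s0 : 0 <= s.
Hypothesis st : s < t.
Hypothesis FS : F s S.
Hypothesis ts1 : t - s <= 1.
Hypothesis Rx : ex P (fun w => remainder W x (fun r w => A r w * x r w) s t w ^+ 2)
  <= q ^+ 4 / (N + 1) * (t - s).
Hypothesis Ry : ex P (fun w => remainder W y (fun r w => B r w * y r w) s t w ^+ 2)
  <= q ^+ 4 / (N + 1) * (t - s).

Local Notation I := (\1_S : Omega -> R).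
Local Notation Z := (dW W s t).
Local Notation h := (t - s).

Let t0 : 0 <= t. Proof. exact: le_trans s0 (ltW st). Qed.
Let h0 : 0 < h. Proof. by rewrite subr_gt0. Qed.

Let I01 w : 0 <= I w <= 1.
Proof. by rewrite indicE; case: (_ \in _); rewrite /= ?ler01 ?lexx. Qed.

(** As [g r] has mean zero, [e^(c Z)] may be replaced by [e^(c Z) - 1], of second moment at most
    [N h]. Cauchy-Schwarz gives [(2 / q) sqrt (q^4 h / (N + 1)) sqrt (N h) <= 2 q h], for which the
    tolerance [q^4 / (N + 1)] is made. Applied with [c = - k] and [c = k]. *)
Let error_term (g r : Omega -> R) c : fmeas F s g -> (forall w, `|g w| <= 2 / q) ->
  sqint P r -> ex P (fun w => g w * r w) = 0 ->
  ex P (fun w => r w ^+ 2) <= q ^+ 4 / (N + 1) * h -> c ^+ 2 = k ^+ 2 ->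
  integ P (fun w => g w * r w * expR (c * Z w)) /\
  `|ex P (fun w => g w * r w * expR (c * Z w))| <= 2 * q * h.
Proof.
move=> fg bg sr gr0 vr ck; have mg := fmeas_measurable hF fg.
have sgr := sqint_mul_bounded mg bg sr.
have sE := dW_expR_sqint hW s0 st c.
have sE1 : sqint P (fun w => expR (c * Z w) - 1).
  by apply: sqintB => //; apply: (@sqint_bounded _ _ _ P 1) => // w; rewrite normr1.
split; first exact: sqint_mul.
have E w : g w * r w * expR (c * Z w) = g w * r w * (expR (c * Z w) - 1) + g w * r w.
  by ring.
rewrite (eq_ex _ E) exD; [|exact: sqint_mul|exact: sqint_integ].
rewrite gr0 addr0.
have qp : 0 <= 2 / q by rewrite divr_ge0 // ltW.
have e0 : 0 <= q ^+ 4 / (N + 1) by rewrite divr_ge0 ?exprn_ge0 ?addr_ge0 // ltW.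
apply: (@le_trans _ _ (2 / q * Num.sqrt (q ^+ 4 / (N + 1) * h) * Num.sqrt (N * h))).
  apply: ex_mul_le => //; first by rewrite mulr_ge0 ?sqrtr_ge0.
  - rewrite exprMn sqr_sqrtr; last by rewrite mulr_ge0 // ltW.
    apply: le_trans (ler_wpM2l (sqr_ge0 _) vr).
    have [_ i2] := sr; rewrite -exZ //; apply: ex_le.
    + by have [] := sgr.
    + exact: integZ.
    + move=> w; rewrite exprMn ler_wpM2r ?sqr_ge0 //.
      by rewrite -real_normK ?num_real // lerXn2r ?nnegrE.
  - rewrite sqr_sqrtr; last by rewrite mulr_ge0 // ltW.
    by rewrite /N -ck; exact: (dW_expR_sub1 hW s0 st).
rewrite -mulrA -sqrtrM; last by rewrite mulr_ge0 // ltW.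
apply: (@le_trans _ _ (2 / q * Num.sqrt ((q ^+ 2 * h) ^+ 2))).
  rewrite ler_wpM2l // ler_wsqrtr //.
  have -> : q ^+ 4 / (N + 1) * h * (N * h) = (q ^+ 2 * h) ^+ 2 * (N / (N + 1)).
    by field; rewrite gt_eqF // ltr_wpDl.
  rewrite ler_piMr ?sqr_ge0 // ler_pdivrMr ?mul1r; have := N0; lra.
rewrite sqrtr_sqr ger0_norm; last by rewrite mulr_ge0 ?sqr_ge0 // ltW.
have -> : 2 / q * (q ^+ 2 * h) = 2 * q * h by field; rewrite gt_eqF.
exact: lexx.
Qed.

(** By AM-GM, [sqrt (x' * y')] is at most the mean of [x' * r * e^(- k Z)] and
    [y' * r^-1 * e^(k Z)], where [r] is [gratio] at time [s]. Up to the
    remainders [x' = x * (1 + A * Z)] and [y' = y * (1 + B * Z)]; as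
    [E (Z * e^(k Z)) = k * h * e^(k ^+ 2 * h / 2)] and [A - B = 2 * k], this
    mean has expectation [(1 - k ^+ 2 * h) * e^(k ^+ 2 * h / 2)] times the value
    at [s], and [1 - u <= e^(- u)]. *)
Lemma decay_step :
  ex P (fun w => I w * gmean q (x t w) (y t w)) <=
  expR (- (k ^+ 2 / 2) * h) * ex P (fun w => I w * gmean q (x s w) (y s w)) +
  decay_const * q * h.
Proof.
pose f w := gmean q (x s w) (y s w).
pose th w := gratio q (x s w) (y s w); pose th' w := gratio q (y s w) (x s w).
have fI : fmeas F s I by exact: fmeas_indic.
have x0 w : 0 <= x s w by have /andP[] := x01 w s0.
have y0 w : 0 <= y s w by have /andP[] := y01 w s0.
have fth : fmeas F s th by apply: fmeas_gratio => //; [exact: fx|exact: fy].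
have fth' : fmeas F s th' by apply: fmeas_gratio => //; [exact: fy|exact: fx].
have ff : fmeas F s f by exact: fmeas_gmean.
have bth w : 0 <= th w <= 2 / q by rewrite gratio_ge0 // gratio_le // ?x01 ?y01.
have bth' w : 0 <= th' w <= 2 / q by rewrite gratio_ge0 // gratio_le // ?x01 ?y01.
have qp : 0 <= 2 / q by rewrite divr_ge0 // ltW.
(* Writing [x_t + q^2] as [(x_s + q^2) + A x_s Z] plus a remainder, and likewise for [y], the AM-GM
   terms have coefficients [g1] on the exponentials, [g2] and [g2'] on [Z] times an exponential, and
   [g3] and [g3'] on the remainders. *)
pose g1 w := I w * f w.
pose g2 w := I w * th w * (A s w * x s w); pose g2' w := I w * th' w * (B s w * y s w).
pose g3 w := I w * th w; pose g3' w := I w * th' w.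
have fg1 : fmeas F s g1 by exact: fmeasM.
have fg3 : fmeas F s g3 by exact: fmeasM.
have fg3' : fmeas F s g3' by exact: fmeasM.
have fg2 : fmeas F s g2.
  by apply: fmeasM => //; apply: fmeasM => //; [exact: fA|exact: fx].
have fg2' : fmeas F s g2'.
  by apply: fmeasM => //; apply: fmeasM => //; [exact: fB|exact: fy].
have bg1 w : `|g1 w| <= 2.
  have /andP[i0 i1] := I01 w; rewrite ger0_norm; last by rewrite mulr_ge0 ?gmean_ge0.
  have := gmean_le2 q0 q1 (x01 w s0) (y01 w s0); rewrite -/(f w) => fw.
  by rewrite -[leRHS]mul1r; apply: ler_pM => //; exact: gmean_ge0.
have bg3 w : `|g3 w| <= 2 / q.
  have /andP[i0 i1] := I01 w; have /andP[b1 b2] := bth w.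
  rewrite ger0_norm; last exact: mulr_ge0.
  by rewrite -[leRHS]mul1r; apply: ler_pM.
have bg3' w : `|g3' w| <= 2 / q.
  have /andP[i0 i1] := I01 w; have /andP[b1 b2] := bth' w.
  rewrite ger0_norm; last exact: mulr_ge0.
  by rewrite -[leRHS]mul1r; apply: ler_pM.
have bAx w : `|A s w * x s w| <= K.
  have /andP[a0 a1] := x01 w s0.
  by rewrite normrM (ger0_norm a0) -[leRHS]mulr1 ler_pM // bA.
have bBy w : `|B s w * y s w| <= K.
  have /andP[a0 a1] := y01 w s0.
  by rewrite normrM (ger0_norm a0) -[leRHS]mulr1 ler_pM // bB.
have bg2 w : `|g2 w| <= 2 / q * K.
  by rewrite /g2 normrM; apply: ler_pM => //; exact: bg3.
have bg2' w : `|g2' w| <= 2 / q * K.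
  by rewrite /g2' normrM; apply: ler_pM => //; exact: bg3'.
pose rx := remainder W x (fun r w => A r w * x r w) s t.
pose ry := remainder W y (fun r w => B r w * y r w) s t.
have srx : sqint P rx by apply: (expands_sqint hx s0); exact: ltW.
have sry : sqint P ry by apply: (expands_sqint hy s0); exact: ltW.
have [iex eex] := error_term fg3 bg3 srx (expands_mean hx s0 (ltW st) fg3 bg3) Rx
  (sqrrN k).
have [iey eey] := error_term fg3' bg3' sry (expands_mean hy s0 (ltW st) fg3' bg3') Ry
  (erefl (k ^+ 2)).
have point w : I w * gmean q (x t w) (y t w) <=
    2^-1 * ((g1 w * expR (- k * Z w) + g1 w * expR (k * Z w)) +
      (g2 w * (Z w * expR (- k * Z w)) + g2' w * (Z w * expR (k * Z w))) +
      (g3 w * rx w * expR (- k * Z w) + g3' w * ry w * expR (k * Z w))).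
  have /andP[i0 i1] := I01 w.
  have /andP[b1 b2] := bth w; have /andP[b1' b2'] := bth' w.
  have /andP[xt0 _] := x01 w t0; have /andP[yt0 _] := y01 w t0.
  have H := @weighted_geometric_mean R (x t w + q ^+ 2) (y t w + q ^+ 2)
    (th w * expR (- k * Z w)) (th' w * expR (k * Z w)).
  have {}H : gmean q (x t w) (y t w) <= ((x t w + q ^+ 2) * (th w * expR (- k * Z w)) +
      (y t w + q ^+ 2) * (th' w * expR (k * Z w))) / 2.
    apply: H; try by rewrite addr_ge0 ?sqr_ge0.
    - by apply: mulr_ge0 => //; exact: expR_ge0.
    - by apply: mulr_ge0 => //; exact: expR_ge0.
    by rewrite mulrACA gratio_inv // mul1r mulNr expRN mulVf // gt_eqF // expR_gt0.
  apply: (le_trans (ler_wpM2l i0 H)).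
  have e1 : th w * (x s w + q ^+ 2) = f w by rewrite gratioK.
  have e2 : th' w * (y s w + q ^+ 2) = f w by rewrite gratioK // gmeanC.
  have -> : x t w + q ^+ 2 = x s w + q ^+ 2 + A s w * x s w * Z w + rx w.
    by rewrite /rx /remainder; ring.
  have -> : y t w + q ^+ 2 = y s w + q ^+ 2 + B s w * y s w * Z w + ry w.
    by rewrite /ry /remainder; ring.
  (* AM-GM has already been used; what is left is an algebraic identity. *)
  rewrite le_eqVlt; apply/orP; left; apply/eqP.
  have -> : g1 w * expR (- k * Z w) = I w * (th w * (x s w + q ^+ 2)) * expR (- k * Z w).
    by rewrite e1.
  have -> : g1 w * expR (k * Z w) = I w * (th' w * (y s w + q ^+ 2)) * expR (k * Z w).
    by rewrite e2.
  by rewrite /g2 /g2' /g3 /g3'; field.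
have i1 : integ P (fun w => g1 w * expR (- k * Z w)).
  apply: integ_mul_bounded bg1 _; first exact: (fmeas_measurable hF fg1).
  exact/sqint_integ/(dW_expR_sqint hW s0 st).
have i1' : integ P (fun w => g1 w * expR (k * Z w)).
  apply: integ_mul_bounded bg1 _; first exact: (fmeas_measurable hF fg1).
  exact/sqint_integ/(dW_expR_sqint hW s0 st).
have i2 : integ P (fun w => g2 w * (Z w * expR (- k * Z w))).
  apply: integ_mul_bounded bg2 _; first exact: (fmeas_measurable hF fg2).
  exact: (dW_integ_ZexpR hW s0 st).
have i2' : integ P (fun w => g2' w * (Z w * expR (k * Z w))).
  apply: integ_mul_bounded bg2' _; first exact: (fmeas_measurable hF fg2').
  exact: (dW_integ_ZexpR hW s0 st).
have it : integ P (fun w => I w * gmean q (x t w) (y t w)).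
  apply: (@integ_bounded _ _ _ P 2).
    apply: measurable_funM; first exact: (fmeas_measurable hF fI).
    exact: (fmeas_measurable hF (fmeas_gmean q t0)).
  move=> w; have /andP[i0 i01] := I01 w.
  rewrite ger0_norm ?mulr_ge0 ?gmean_ge0 // -[leRHS]mul1r ler_pM ?gmean_ge0 //.
  by apply: gmean_le2 => //; [exact: x01|exact: y01].
have i12 := integD i1 i1'; have i22 := integD i2 i2'; have i32 := integD iex iey.
have := ex_le it (integZ 2^-1 (integD (integD i12 i22) i32)) point.
rewrite exZ; last exact: integD (integD _ _) _.
rewrite (exD (integD i12 i22) i32) (exD i12 i22) (exD i1 i1') (exD i2 i2') (exD iex iey).
rewrite !(dW_mean_expR hF hW s0 st _ fg1 bg1).
rewrite (dW_mean_ZexpR hF hW s0 st _ fg2 bg2) (dW_mean_ZexpR hF hW s0 st _ fg2' bg2').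
rewrite sqrrN.
set m := expR (k ^+ 2 * h / 2).
(* Replacing [th * x] by [th * (x + q^2) = f] costs [q^2 th <= 2 q], and similarly for [y]; the
   leading terms combine through [A - B = 2 k]. *)
have eg2 : `|ex P g2 - ex P g2' - 2 * k * ex P g1| <= 4 * K * q.
  have ig1 : integ P g1 by apply: integ_bounded bg1; exact: (fmeas_measurable hF fg1).
  have ig2 : integ P g2 by apply: integ_bounded bg2; exact: (fmeas_measurable hF fg2).
  have ig2' : integ P g2' by apply: integ_bounded bg2'; exact: (fmeas_measurable hF fg2').
  rewrite -exB // -exZ // -exB //; [|exact: integB|exact: integZ].
  apply: ex_norm_le.
    apply: measurable_funB; first by apply: measurable_funB;
      [exact: (fmeas_measurable hF fg2)|exact: (fmeas_measurable hF fg2')].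
    by apply: measurable_funM => //; exact: (fmeas_measurable hF fg1).
  move=> w; have /andP[i0 i01] := I01 w.
  have e1 : th w * x s w = f w - q ^+ 2 * th w 
    by have := gratioK q0 (y s w) (x0 w); rewrite -/(th w) -/(f w) => <-; ring.
  have e2 : th' w * y s w = f w - q ^+ 2 * th' w.
    
    have := gratioK q0 (x s w) (y0 w); rewrite -/(th' w) gmeanC -/(f w) => <-; ring.
  have -> : g2 w - g2' w - 2 * k * g1 w =
    I w * (q ^+ 2 * (B s w * th' w - A s w * th w)).
    rewrite /g2 /g2' /g1 -(AB w s0).
    have -> : I w * th w * (A s w * x s w) = I w * A s w * (th w * x s w) by ring.
    have -> : I w * th' w * (B s w * y s w) = I w * B s w * (th' w * y s w) by ring.
    by rewrite e1 e2; ring.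
  have /andP[b1 b2] := bth w; have /andP[b1' b2'] := bth' w.
  rewrite normrM (ger0_norm i0) normrM (ger0_norm (sqr_ge0 q)).
  apply: (@le_trans _ _ (1 * (q ^+ 2 * (K * (2 / q) + K * (2 / q))))); last first.
    by rewrite le_eqVlt; apply/orP; left; apply/eqP; field; rewrite gt_eqF.
  apply: ler_pM => //; first by rewrite mulr_ge0 ?sqr_ge0.
  rewrite ler_wpM2l ?sqr_ge0 //; apply: (le_trans (ler_normB _ _)).
  rewrite (normrM (B s w)) (normrM (A s w)) (ger0_norm b1) (ger0_norm b1').
  by apply: lerD; apply: ler_pM => //; [exact: bB|exact: bA].
have m0 : 0 < m by exact: expR_gt0.
have mM : m <= expR (k ^+ 2 / 2).
  rewrite ler_expR ler_wpM2r // ler_piMr // sqr_ge0 //.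
have u0 : 0 <= ex P g1.
  by apply: ex_ge0 => w; have /andP[i0 _] := I01 w; rewrite mulr_ge0 ?gmean_ge0.
have main : m * (1 - k ^+ 2 * h) <= expR (- (k ^+ 2 / 2) * h).
  have -> : expR (- (k ^+ 2 / 2) * h) = m * expR (- (k ^+ 2 * h)).
    by rewrite -expRD; congr expR; field.
  by rewrite ler_wpM2l // ?(ltW m0) //; exact: expR_ge1Dx.
have main2 := ler_wpM2r u0 main.
rewrite -/g1.
have e5 : - k * h * m * (ex P g2 - ex P g2' - 2 * k * ex P g1) <=
    `|k| * h * expR (k ^+ 2 / 2) * (4 * K * q).
  apply: (le_trans (ler_norm _)); rewrite normrM ler_pM //.
  rewrite normrM normrM normrN (gtr0_norm h0) (gtr0_norm m0).
  by rewrite ler_wpM2l // mulr_ge0 // ltW.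
have := ler_norm (ex P (fun w => g3 w * rx w * expR (- k * Z w))).
have := ler_norm (ex P (fun w => g3' w * ry w * expR (k * Z w))).
rewrite /decay_const -/(f _).
set E1 := ex P (fun w => g3 w * _ * _) in eex *.
set E2 := ex P (fun w => g3' w * _ * _) in eey *.
move=> n1 n2 H; apply: (le_trans H).
set u := ex P g1 in main2 e5 u0 *.
set G := ex P g2 in e5 *; set G' := ex P g2' in e5 *.
nra.
Qed.

End Step.
Let C0 : 0 <= decay_const.
Proof.
by rewrite /decay_const addr_ge0 // mulr_ge0 // mulr_ge0 ?expR_ge0 // mulr_ge0.
Qed.

(** The interval is cut into equal steps short enough for [decay_step]; the contraction factors
    multiply and, being at most 1, let the errors merely add. *)
Let decay_gmean q s t S : 0 < q -> q <= 1 -> 0 <= s -> s < t -> F s S ->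
  ex P (fun w => \1_S w * gmean q (x t w) (y t w)) <=
  expR (- (k ^+ 2 / 2) * (t - s)) *
    ex P (fun w => \1_S w * gmean q (x s w) (y s w)) + decay_const * q * (t - s).
Proof.
move=> q0 q1 s0 st FS.
have e0 : 0 < q ^+ 4 / (N + 1) by rewrite divr_gt0 ?exprn_gt0 // ltr_wpDl.
have [h1 h10 H1] := expands_variance hx t e0.
have [h2 h20 H2] := expands_variance hy t e0.
pose h0 := Num.min 1 (Num.min h1 h2).
have h00 : 0 < h0 by rewrite !lt_min ltr01 h10.
have ts0 : 0 < t - s by rewrite subr_gt0.
(* The successor makes [n] positive and larger than [(t - s) / h0], so that [de <= h0]. *)
pose n := (Num.truncn ((t - s) / h0)).+1.
have n0 : 0 < n%:R :> R by rewrite ltr0n.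
pose de := (t - s) / n%:R.
have de0 : 0 < de by rewrite divr_gt0.
have deh : de <= h0.
  rewrite ler_pdivrMr // mulrC -ler_pdivrMr //; apply: ltW; exact: truncnS_gt.
have [de1 deh1 deh2] : [/\ de <= 1, de <= h1 & de <= h2].
  by move: deh; rewrite /h0 !le_min => /andP[-> /andP[-> ->]].
pose U r := ex P (fun w => \1_S w * gmean q (x r w) (y r w)).
suff H j : (j <= n)%N -> U (s + j%:R * de) <=
    expR (- (k ^+ 2 / 2) * (j%:R * de)) * U s + decay_const * q * (j%:R * de).
  have := H n (leqnn n); rewrite /de mulrC divfK ?gt_eqF //.
  by rewrite [s + _]addrC subrK.
elim: j => [|j ih] jn.
  by rewrite mul0r addr0 !mulr0 expR0 mul1r addr0.
pose sj := s + j%:R * de.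
have j0 : 0 <= j%:R * de by rewrite mulr_ge0 // ltW.
have sj0 : 0 <= sj by rewrite addr_ge0.
have sjE : s + j.+1%:R * de = sj + de by rewrite /sj -natr1; ring.
have tE : t = s + n%:R * de by rewrite /de mulrC divfK ?gt_eqF // addrC subrK.
have sjt : sj + de <= t.
  by rewrite -sjE tE lerD2l ler_wpM2r ?ler_nat // ltW.
have dd : sj + de - sj = de by ring.
have FSj : F sj S by apply: (filtration_mono hF _ FS); rewrite lerDl.
have lt1 : sj < sj + de by rewrite ltrDl.
have dn1 : sj + de - sj <= 1 by rewrite dd.
have R1 := H1 sj (sj + de) sj0 (ltW lt1) sjt; rewrite dd in R1.
have R2 := H2 sj (sj + de) sj0 (ltW lt1) sjt; rewrite dd in R2.
have := @decay_step q sj (sj + de) S q0 q1 sj0 lt1 FSj dn1.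
rewrite dd => /(_ (R1 deh1) (R2 deh2)) step.
rewrite sjE; apply: (le_trans step).
have E0 := expR_ge0 (- (k ^+ 2 / 2) * de).
have E1 : expR (- (k ^+ 2 / 2) * de) <= 1.
  rewrite -expR0 ler_expR mulNr oppr_le0 mulr_ge0 ?divr_ge0 ?sqr_ge0 //; exact: ltW.
have C1 : 0 <= decay_const * q * (j%:R * de).
  by rewrite mulr_ge0 // mulr_ge0 // ltW.
have := ler_wpM2l E0 (ih (ltnW jn)).
have := ler_wpM2r C1 E1.
have -> : j.+1%:R * de = j%:R * de + de by rewrite -natr1; ring.
rewrite [in X in _ -> _ -> _ <= X](mulrDr (- (k ^+ 2 / 2))) expRD.
rewrite /U -/sj; nra.
Qed.

(** Limit [q -> 0] of [decay_gmean], whose contraction factor does not depend on [q]. *)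
Lemma decay s t S : 0 <= s -> s <= t -> F s S ->
  ex P (fun w => \1_S w * Num.sqrt (x t w * y t w)) <=
  expR (- (k ^+ 2 / 2) * (t - s)) * ex P (fun w => \1_S w * Num.sqrt (x s w * y s w)).
Proof.
move=> s0; rewrite le_eqVlt => /predU1P[<- _|st FS].
  by rewrite subrr mulr0 expR0 mul1r.
have mS : measurable S := filtration_measurable hF FS.
have t0 : 0 <= t by exact: le_trans s0 (ltW st).
have I01 w : 0 <= (\1_S w : R) <= 1.
  by rewrite indicE; case: (_ \in _); rewrite /= ?ler01 ?lexx.
have iS r : 0 <= r -> integ P (fun w => \1_S w * Num.sqrt (x r w * y r w)).
  move=> r0; apply: (@integ_bounded _ _ _ P 1).
    apply: measurable_funM; first exact: measurable_indic.
    apply: (fmeas_measurable hF (t := r)).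
    apply: (fmeas_comp hF (g := @Num.sqrt R)).
      by apply: continuous_measurable_fun; exact: sqrt_continuous.
    by apply: fmeasM => //; [exact: fx|exact: fy].
  move=> w; have /andP[i0 i1] := I01 w.
  have /andP[a0 a1] := x01 w r0; have /andP[b0 b1] := y01 w r0.
  rewrite ger0_norm ?mulr_ge0 ?sqrtr_ge0 // -[leRHS]mul1r ler_pM ?sqrtr_ge0 //.
  by rewrite -[leRHS]sqrtr1 ler_wsqrtr // -[leRHS]mul1r ler_pM.
have iG q r : 0 < q -> q <= 1 -> 0 <= r ->
    integ P (fun w => \1_S w * gmean q (x r w) (y r w)).
  move=> q0 q1 r0; apply: (@integ_bounded _ _ _ P 2).
    apply: measurable_funM; first exact: measurable_indic.
    exact: (fmeas_measurable hF (fmeas_gmean q r0)).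
  move=> w; have /andP[i0 i1] := I01 w.
  rewrite ger0_norm ?mulr_ge0 ?gmean_ge0 // -[leRHS]mul1r ler_pM ?gmean_ge0 //.
  by apply: gmean_le2 => //; [exact: x01|exact: y01].
set L := ex P _; set D := expR _; set Q := ex P _.
have D0 : 0 <= D by exact: expR_ge0.
have D1 : D <= 1.
  rewrite /D -expR0 ler_expR mulNr oppr_le0 mulr_ge0 ?divr_ge0 ?sqr_ge0 //.
  by rewrite subr_ge0 ltW.
(* The total error is at most [c * q]: [2 q] from [gmean_le_sqrt] at time [s], the rest from
   [decay_gmean]. *)
pose c := 2 + decay_const * (t - s).
have c0 : 0 < c.
  by rewrite /c ltr_wpDr // mulr_ge0 // subr_ge0 ltW.
apply/ler_addgt0Pr => e e0.
pose q := Num.min 1 (e / c).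
have q0 : 0 < q by rewrite lt_min ltr01 divr_gt0.
have q1 : q <= 1 by rewrite ge_min lexx.
have qe : c * q <= e.
  by rewrite mulrC -ler_pdivlMr // /q ge_min lexx orbT.
have := decay_gmean q0 q1 s0 st FS; rewrite -/D.
have G1 : L <= ex P (fun w => \1_S w * gmean q (x t w) (y t w)).
  apply: ex_le; [exact: iS|exact: iG|] => w; have /andP[i0 _] := I01 w.
  rewrite ler_wpM2l // sqrt_le_gmean //; [by have /andP[] := x01 w t0|].
  by have /andP[] := y01 w t0.
have G2 : ex P (fun w => \1_S w * gmean q (x s w) (y s w)) <= Q + 2 * q.
  rewrite -[2 * q](ex_cst P) /Q -exD; [|exact: iS|exact: integ_cst].
  apply: ex_le; [exact: iG|by apply: integD; [exact: iS|exact: integ_cst]|].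
  move=> w; have /andP[i0 i1] := I01 w.
  have H := gmean_le_sqrt q0 q1 (x01 w s0) (y01 w s0).
  apply: (le_trans (ler_wpM2l i0 H)); rewrite mulrDr lerD2l.
  by rewrite ler_piMl // mulr_ge0 // ltW.
have := ler_wpM2l D0 G2.
have q20 : 0 <= 2 * q by rewrite mulr_ge0 // ltW.
have := ler_wpM2r q20 D1.
move: qe; rewrite /c mulrDl mulrDr; lra.
Qed.

End Decay.

Local Open Scope complex_scope.
Local Open Scope sesquilinear_scope.

(** * Density matrices in an orthonormal basis *)

Section ComplexParts.
Context {R : realType}.
Implicit Types z w : R[i].

Lemma cReD z w : complex.Re (z + w) = complex.Re z + complex.Re w.
Proof. by rewrite raddfD. Qed.

Lemma cImD z w : complex.Im (z + w) = complex.Im z + complex.Im w.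
Proof. by rewrite raddfD. Qed.

Lemma cReM z w : complex.Re (z * w) =
  complex.Re z * complex.Re w - complex.Im z * complex.Im w.
Proof. by case: z => a b; case: w. Qed.

Lemma cImM z w : complex.Im (z * w) =
  complex.Re z * complex.Im w + complex.Im z * complex.Re w.
Proof. by case: z => a b; case: w. Qed.

Lemma cRe_sum I (s : seq I) (f : I -> R[i]) :
  complex.Re (\sum_(i <- s) f i) = \sum_(i <- s) complex.Re (f i).
Proof. by rewrite raddf_sum. Qed.

Lemma ge0_Re_Im z : (0 <= z) = (complex.Im z == 0) && (0 <= complex.Re z).
Proof. by rewrite lecE. Qed.

Lemma complex_eqP z w : complex.Re z = complex.Re w ->
  complex.Im z = complex.Im w -> z = w.
Proof. by case: z => a b; case: w => c e /= -> ->. Qed.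

End ComplexParts.

Section Form.
Context {R : realType} {N : nat}.
Local Notation C := R[i].
Implicit Types (u v : 'cV[C]_N) (rho A : 'M[C]_N).

Definition matel u v A : C := (u ^t* *m A *m v) 0 0.

Lemma matelE u v A : matel u v A =
  \sum_k \sum_l (u k 0)^* * A k l * v l 0.
Proof.
rewrite /matel mxE exchange_big; apply: eq_bigr => l _.
by rewrite mxE mulr_suml; apply: eq_bigr => k _; rewrite !mxE.
Qed.

Lemma matelD u v A B : matel u v (A + B) = matel u v A + matel u v B.
Proof. by rewrite /matel mulmxDr mulmxDl mxE. Qed.

Lemma matelZ u v c A : matel u v (c *: A) = c * matel u v A.
Proof. by rewrite /matel -scalemxAr -scalemxAl mxE. Qed.

Lemma matelB u v A B : matel u v (A - B) = matel u v A - matel u v B.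
Proof. by rewrite matelD -scaleN1r matelZ mulN1r. Qed.

Lemma trace_pure v A : \tr (A *m pure v) = matel v v A.
Proof.
rewrite /pure mulmxA mxtrace_mulC mulmxA /mxtrace.
by rewrite big_ord1.
Qed.

Lemma matel_hermitian u v rho : rho = rho ^t* -> matel v u rho = (matel u v rho)^*.
Proof.
move=> hrho; rewrite !matelE rmorph_sum exchange_big; apply: eq_bigr => k _.
rewrite rmorph_sum; apply: eq_bigr => l _.
have -> : rho l k = (rho k l)^* by rewrite {1}hrho !mxE.
by rewrite !rmorphM /= conjcK; ring.
Qed.

Lemma matel_lincomb (r : R) u v rho :
  matel (u + r%:C *: v) (u + r%:C *: v) rho =
  matel u u rho + r%:C * (matel u v rho + matel v u rho) + (r ^+ 2)%:C * matel v v rho.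
Proof.
rewrite !matelE -big_split /= !mulr_sumr -!big_split /=; apply: eq_bigr => k _.
rewrite -big_split /= !mulr_sumr -!big_split /=; apply: eq_bigr => l _.
have E : Num.conj (r%:C : C) = r%:C by exact: conjc_real.
rewrite !mxE rmorphD rmorphM /= E rmorphXn; ring.
Qed.

Variable rho : 'M[C]_N.
Hypothesis drho : density rho.

Lemma matel_ge0 v : 0 <= matel v v rho.
Proof. by have [_ _] := drho; exact. Qed.

Lemma matel_Im v : complex.Im (matel v v rho) = 0.
Proof. by have := matel_ge0 v; rewrite ge0_Re_Im => /andP[/eqP]. Qed.

Lemma matel_Re_ge0 v : 0 <= complex.Re (matel v v rho).
Proof. by have := matel_ge0 v; rewrite ge0_Re_Im => /andP[_]. Qed.

(** Discriminant of the nonnegative real quadratic given by the form at [u + r v], [r] real. *)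
Lemma matel_Re_sqr u v : complex.Re (matel u v rho) ^+ 2 <=
  complex.Re (matel u u rho) * complex.Re (matel v v rho).
Proof.
apply: quadratic_discriminant; first exact: matel_Re_ge0.
move=> r; have := matel_Re_ge0 (u + r%:C *: v).
have [hrho _ _] := drho.
rewrite matel_lincomb (matel_hermitian u v hrho) !cReD !cReM /= !cReD.
case: (matel u v rho) => a b /=; case: (matel u u rho) => a' b'.
case: (matel v v rho) => a'' b'' /=.
by rewrite !mul0r !subr0; lra.
Qed.

(** Multiplying [u] by [i] turns the imaginary part into a real part and leaves the diagonal values
    unchanged. *)
Lemma matel_Im_sqr u v : complex.Im (matel u v rho) ^+ 2 <=
  complex.Re (matel u u rho) * complex.Re (matel v v rho).
Proof.
have E1 : matel ('i *: u) v rho = (0 -i* 1) * matel u v rho.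
  rewrite !matelE mulr_sumr; apply: eq_bigr => k _; rewrite mulr_sumr.
  by apply: eq_bigr => l _; rewrite !mxE rmorphM /= !mulrA.
have E2 : matel ('i *: u) ('i *: u) rho = matel u u rho.
  rewrite !matelE; apply: eq_bigr => k _; apply: eq_bigr => l _.
  rewrite !mxE rmorphM /=.
  have ii : (0 -i* 1 : C) * 'i = 1 by apply: complex_eqP => /=; ring.
  have -> : (0 -i* 1) * (u k 0)^* * rho k l * ('i * u l 0) =
    ((0 -i* 1 : C) * 'i) * ((u k 0)^* * rho k l * u l 0) by ring.
  by rewrite ii mul1r.
have := matel_Re_sqr ('i *: u) v; rewrite E2 E1 cReM /=.
by rewrite mul0r sub0r mulN1r opprK.
Qed.

Lemma matel_delta k l : matel (delta_mx k 0) (delta_mx l 0) rho = rho k l.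
Proof.
rewrite matelE (bigD1 k) //= [X in _ + X]big1 ?addr0; last first.
  move=> i ik; rewrite big1 // => j _.
  by rewrite !mxE (negbTE ik) /= conjC0 !mul0r.
rewrite (bigD1 l) //= [X in _ + X]big1 ?addr0; last first.
  by move=> i ik; rewrite !mxE (negbTE ik) /= mulr0.
by rewrite !mxE !eqxx /= conjC1 mul1r mulr1.
Qed.

Lemma diag_le1 k : 0 <= complex.Re (rho k k) <= 1.
Proof.
have H i : 0 <= complex.Re (rho i i) by rewrite -matel_delta matel_Re_ge0.
rewrite H /=; have [_ tr1 _] := drho.
have : complex.Re (\tr rho) = 1 by rewrite tr1.
rewrite /mxtrace cRe_sum (bigD1 k) //= => <-.
by rewrite lerDl sumr_ge0.
Qed.

Lemma entry_bounded k l :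
  `|complex.Re (rho k l)| <= 1 /\ `|complex.Im (rho k l)| <= 1.
Proof.
have /andP[k0 k1] := diag_le1 k; have /andP[l0 l1] := diag_le1 l.
have H : complex.Re (rho k k) * complex.Re (rho l l) <= 1.
  by rewrite -[leRHS]mul1r ler_pM.
have := matel_Re_sqr (delta_mx k 0) (delta_mx l 0).
have := matel_Im_sqr (delta_mx k 0) (delta_mx l 0).
rewrite !matel_delta => H1 H2.
split; rewrite -(@ler_pXn2r _ 2) ?nnegrE // real_normK ?num_real // expr1n.
  exact: le_trans H2 H.
exact: le_trans H1 H.
Qed.

End Form.

(** * Populations and matrix elements in the eigenbasis *)

Section Basis.
Context {R : realType} {N : nat}.
Local Notation C := R[i].
Variable e : 'I_N -> 'cV[C]_N.
Hypothesis he : orthonormal_basis e.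
Implicit Types (rho A : 'M[C]_N).

Definition pop n A : R := complex.Re (\tr (A *m pure (e n))).

(** The square matrix with columns [e n] has its adjoint as left inverse, hence as right inverse. *)
Lemma sum_pure : \sum_n pure (e n) = 1%:M.
Proof.
pose U : 'M[C]_N := \matrix_(i, j) e j i 0.
have UU : U ^t* *m U = 1%:M.
  apply/matrixP => n m; rewrite !mxE -he mxE; apply: eq_bigr => k _.
  by rewrite !mxE.
rewrite -(mulmx1C UU); apply/matrixP => k l; rewrite summxE mxE.
by apply: eq_bigr => n _; rewrite /pure !mxE big_ord1 !mxE.
Qed.

Lemma popE n A : pop n A = complex.Re (matel (e n) (e n) A).
Proof. by rewrite /pop trace_pure. Qed.

Lemma trace_basis A : \tr A = \sum_n matel (e n) (e n) A.
Proof.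
rewrite -[in LHS](mulmx1 A) -sum_pure mulmx_sumr raddf_sum /=.
by apply: eq_bigr => n _; rewrite trace_pure.
Qed.

(** The resolution of the identity [sum_pure] is inserted on both sides of [A]. *)
Lemma basis_expansion A k l :
  A k l = \sum_n \sum_m e n k 0 * matel (e n) (e m) A * (e m l 0)^*.
Proof.
rewrite -[in LHS](mul1mx A) -[in LHS](mulmx1 (1%:M *m A)) -sum_pure.
rewrite mulmx_suml mulmx_suml summxE; apply: eq_bigr => n _.
rewrite mulmx_sumr summxE; apply: eq_bigr => m _.
have -> : pure (e n) *m A *m pure (e m) =
    e n *m ((e n) ^t* *m A *m e m) *m (e m) ^t*.
  by rewrite /pure !mulmxA.
rewrite mxE big_ord1 mxE big_ord1 !mxE; congr (_ * _ * _).
by rewrite /matel mxE.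
Qed.

Lemma pop_pure n m : pop n (pure (e m)) = (n == m)%:R.
Proof.
rewrite popE /matel /pure !mulmxA -mulmxA mxE big_ord1 !he.
by rewrite (eq_sym m n); case: (n == m); rewrite ?mul1r ?mul0r.
Qed.

Section Density.
Variable rho : 'M[C]_N.
Hypothesis drho : density rho.

Lemma matel_basis n : matel (e n) (e n) rho = (pop n rho)%:C.
Proof. by apply: complex_eqP; rewrite ?popE // matel_Im. Qed.

Lemma pop_ge0 n : 0 <= pop n rho.
Proof. by rewrite popE matel_Re_ge0. Qed.

Lemma sum_pop : \sum_n pop n rho = 1.
Proof.
have [_ tr1 _] := drho; have := trace_basis rho; rewrite tr1.
move=> /(congr1 (@complex.Re R)); rewrite cRe_sum /= => ->.
by apply: eq_bigr => n _; rewrite popE.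
Qed.

Lemma pop_le1 n : pop n rho <= 1.
Proof.
by rewrite -sum_pop (bigD1 n) //= lerDl sumr_ge0 // => i _; exact: pop_ge0.
Qed.

Lemma pop01 n : 0 <= pop n rho <= 1.
Proof. by rewrite pop_ge0 pop_le1. Qed.

Lemma sum_pop_others n : \sum_(m | m != n) pop m rho = 1 - pop n rho.
Proof. by rewrite -sum_pop [in RHS](bigD1 n) //= addrAC subrr add0r. Qed.

Lemma pop_le_others n m : m != n -> pop m rho <= 1 - pop n rho.
Proof.
move=> mn; rewrite -sum_pop_others (bigD1 m) //= lerDl.
by apply: sumr_ge0 => i _; exact: pop_ge0.
Qed.

(** Off the position [(n, n)], positivity bounds the square by [p_a p_b], where one index differs
    from [n] and has weight at most [1 - p_n]. At [(n, n)] the element is [p_n - 1]. *)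
Lemma matel_near_pure n a b :
  complex.Re (matel (e a) (e b) (rho - pure (e n))) ^+ 2 <= 1 - pop n rho /\
  complex.Im (matel (e a) (e b) (rho - pure (e n))) ^+ 2 <= 1 - pop n rho.
Proof.
have d0 : 0 <= 1 - pop n rho by rewrite subr_ge0 pop_le1.
have Ep : matel (e a) (e b) (pure (e n)) = (a == n)%:R * (n == b)%:R.
  by rewrite /matel /pure !mulmxA -mulmxA mxE big_ord1 !he.
rewrite matelB Ep.
have [an|an] := eqVneq a n; have [bn|bn] := eqVneq n b.
- rewrite an -bn matel_basis mulr1.
  have -> : (pop n rho)%:C - 1 = (pop n rho - 1)%:C by rewrite rmorphB.
  rewrite /= expr0n; split => //.
  have := pop_ge0 n; have := pop_le1 n; nra.
- rewrite mulr0 subr0 an; have H : pop n rho * pop b rho <= 1 - pop n rho.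
    have := pop_le_others (n := n) (m := b); rewrite eq_sym => /(_ bn) H.
    by rewrite -[leRHS]mul1r ler_pM ?pop_ge0 ?pop_le1.
  split; apply: le_trans H; rewrite !popE.
    exact: matel_Re_sqr.
  exact: matel_Im_sqr.
- rewrite mul0r subr0 -bn; have H : pop a rho * pop n rho <= 1 - pop n rho.
    have H := pop_le_others an.
    by rewrite -[leRHS]mulr1 ler_pM ?pop_ge0 ?pop_le1.
  split; apply: le_trans H; rewrite !popE.
    exact: matel_Re_sqr.
  exact: matel_Im_sqr.
- rewrite mul0r subr0; have H : pop a rho * pop b rho <= 1 - pop n rho.
    have H := pop_le_others an.
    by rewrite -[leRHS]mulr1 ler_pM ?pop_ge0 ?pop_le1.
  split; apply: le_trans H; rewrite !popE.
    exact: matel_Re_sqr.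
  exact: matel_Im_sqr.
Qed.

Lemma eq_pure_of_pop n : pop n rho = 1 -> rho = pure (e n).
Proof.
move=> p1; apply/eqP; rewrite -subr_eq0; apply/eqP/matrixP => k l.
rewrite basis_expansion [RHS]mxE big1 // => a _; rewrite big1 // => b _.
have [] := matel_near_pure n a b; rewrite p1 subrr => H1 H2.
have -> : matel (e a) (e b) (rho - pure (e n)) = 0.
  by apply: complex_eqP => /=; apply/eqP; rewrite -sqrf_eq0 eq_le sqr_ge0 ?H1 ?H2.
by rewrite mulr0 mul0r.
Qed.

End Density.

Section Generator.
Variables (Jz : 'M[C]_N) (eta M omega : R).
Hypothesis hJz : is_Jz e Jz.

Definition spin (n : 'I_N) : R := (N%:R - 1) / 2 - n%:R.

Let Jz_right n A : matel (e n) (e n) (A *m Jz) = (spin n)%:C * matel (e n) (e n) A.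
Proof.
have [_ /(_ n) Jn] := hJz.
rewrite /matel -!mulmxA Jn -!scalemxAr mxE; congr (_ * _).
by rewrite /spin rmorphB rmorphM rmorphB fmorphV !rmorph_nat.
Qed.

Let Jz_left n A : matel (e n) (e n) (Jz *m A) = (spin n)%:C * matel (e n) (e n) A.
Proof.
have [Jh /(_ n) Jn] := hJz.
have lE : (N%:R - 1) / 2 - n%:R = (spin n)%:C :> C.
  by rewrite /spin rmorphB rmorphM rmorphB fmorphV !rmorph_nat.
(* Adjoint of the eigenvalue equation, with [Jz] self-adjoint and its eigenvalue real. *)
have H : (e n) ^t* *m Jz = (spin n)%:C *: (e n) ^t*.
  apply/matrixP => i j; rewrite {1}Jh.
  have := congr1 (fun B : 'cV[C]_N => (B j i)^*) Jn.
  rewrite lE !mxE rmorphM /= oppr0 rmorph_sum => <-.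
  by apply: eq_bigr => k _; rewrite !mxE rmorphM /= mulrC.
by rewrite /matel mulmxA H -!scalemxAl mxE.
Qed.

(** For the eigenvalue [l] the commutator contributes [l - l] and the dissipator
    [l^2 - l^2 / 2 - l^2 / 2]. *)
Lemma matel_drift n A : matel (e n) (e n) (sme_drift omega M Jz A) = 0.
Proof.
rewrite /sme_drift /bracket -[Jz *m Jz *m A]mulmxA.
rewrite matelD !matelZ !matelB !matelZ.
by rewrite !(Jz_left, Jz_right); field.
Qed.

Lemma matel_diffusion rho n : density rho ->
  matel (e n) (e n) (sme_diffusion eta M Jz rho) =
  (2 * Num.sqrt (eta * M) * (spin n - \sum_m spin m * pop m rho) * pop n rho)%:C.
Proof.
move=> drho; rewrite /sme_diffusion matelZ matelB matelD matelZ Jz_left Jz_right.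
have -> : \tr (Jz *m rho) = (\sum_m spin m * pop m rho)%:C.
  rewrite trace_basis rmorph_sum; apply: eq_bigr => m _.
  by rewrite Jz_left matel_basis // rmorphM.
rewrite matel_basis // (_ : (2 : C) = (2 : R)%:C); last by rewrite rmorph_nat.
by apply: complex_eqP; rewrite /=; ring.
Qed.

End Generator.
End Basis.

(** * Entrywise convergence of complex matrices *)

Section ComplexTopology.
Context {R : realType}.
Local Notation C := (R[i] : numFieldType).

Lemma normc_le_Re_Im (z : R[i]) :
  `|z| <= (`|complex.Re z| + `|complex.Im z|)%:C.
Proof.
rewrite normc_def lecR.
have a0 := normr_ge0 (complex.Re z); have b0 := normr_ge0 (complex.Im z).
rewrite -[leRHS]ger0_norm ?addr_ge0 // -sqrtr_sqr ler_wsqrtr // sqrrD.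
rewrite !real_normK ?num_real // addrAC lerDl mulrn_wge0 // mulr_ge0 //.
Qed.

Lemma cvg_complexP {T : Type} (G : set_system T) (FG : Filter G)
    (f : T -> C) (l : C) :
  (f t @[t --> G] --> l) <->
  (complex.Re (f t) @[t --> G] --> complex.Re l) /\
  (complex.Im (f t) @[t --> G] --> complex.Im l).
Proof.
split=> [/cvgrPdist_lt H|[/cvgrPdist_lt H1 /cvgrPdist_lt H2]].
- split; apply/cvgrPdist_lt => e e0.
  + have := H e%:C; rewrite ltcR => /(_ e0); apply: filterS => t.
    move=> /(le_lt_trans (normc_ge_Re _)); rewrite ltcR.
    by rewrite (cReD l) (raddfN (@complex.Re R)).
  + have := H e%:C; rewrite ltcR => /(_ e0); apply: filterS => t.
    set z := l - f t => zt.
    have -> : complex.Im l - complex.Im (f t) = complex.Im z.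
      by rewrite /z (cImD l) (raddfN (@complex.Im R)).
    (* Multiplication by [i] keeps the modulus, so [normc_ge_Re] also controls the imaginary
       part. *)
    have E : complex.Re (z * 'i) = - complex.Im z by exact: ReiNIm.
    rewrite -normrN -E -ltcR; apply: le_lt_trans zt.
    apply: (le_trans (normc_ge_Re _)); rewrite normrM.
    have -> : `|'i : R[i]| = 1 by rewrite normc_def /= expr0n /= expr1n add0r sqrtr1.
    by rewrite mulr1.
(* The radius is itself complex; its positivity means zero imaginary part and [0 < a]. *)
- apply/cvgrPdist_lt => e; case: e => a b; rewrite ltcE /= => /andP[/eqP -> a0].
  have a20 : 0 < a / 2 by rewrite divr_gt0.
  near=> t; apply: (le_lt_trans (normc_le_Re_Im _)); rewrite ltcR.
  have -> : complex.Re (l - f t) = complex.Re l - complex.Re (f t).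
    by rewrite (cReD l) (raddfN (@complex.Re R)).
  have -> : complex.Im (l - f t) = complex.Im l - complex.Im (f t).
    by rewrite (cImD l) (raddfN (@complex.Im R)).
  rewrite [a]splitr; apply: ltrD; near: t; [exact: H1|exact: H2].
Unshelve. all: end_near. Qed.

Lemma cvg_mxP {T : Type} N (G : set_system T) (FG : Filter G)
    (f : T -> 'M[C]_N) (l : 'M[C]_N) :
  (f t @[t --> G] --> l) <-> forall i j, f t i j @[t --> G] --> l i j.
Proof.
split=> [H i j|H].
  exact: (cvg_comp _ _ H (@coord_continuous C N N i j l)).
apply/cvg_ballP => e e0.
have : \forall t \near G, forall i j, ball (l i j) e (f t i j).
  apply: filter_forall => i; apply: filter_forall => j.
  have := H i j; move=> /cvg_ballP; exact.
by apply: filterS => t Ht; split.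
Qed.

End ComplexTopology.

Section PathContinuity.
Context {R : realType}.

Lemma path_cont_cst (c : R) : path_cont (fun=> c).
Proof. by move=> x; apply: cvg_cst. Qed.

Lemma path_contD (f g : R -> R) : path_cont f -> path_cont g ->
  path_cont (fun t => f t + g t).
Proof. by move=> cf cg x; apply: cvgD; [exact: cf|exact: cg]. Qed.

Lemma path_contM (f g : R -> R) : path_cont f -> path_cont g ->
  path_cont (fun t => f t * g t).
Proof. by move=> cf cg x; apply: cvgM; [exact: cf|exact: cg]. Qed.

Lemma path_contB (f g : R -> R) : path_cont f -> path_cont g ->
  path_cont (fun t => f t - g t).
Proof. by move=> cf cg x; apply: cvgB; [exact: cf|exact: cg]. Qed.

Lemma path_cont_sum I (s : seq I) (f : I -> R -> R) :
  (forall i, path_cont (f i)) -> path_cont (fun t => \sum_(i <- s) f i t).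
Proof.
move=> H; elim: s => [|i s ih].
  have -> : (fun t => \sum_(i <- [::]) f i t) = (fun=> 0).
    by apply/funext => t; rewrite big_nil.
  exact: path_cont_cst.
have -> : (fun t => \sum_(j <- i :: s) f j t) =
    (fun t => f i t + \sum_(j <- s) f j t).
  by apply/funext => t; rewrite big_cons.
by apply: path_contD.
Qed.

Lemma path_cont_integrable (f : R -> R) (t : R) : path_cont f ->
  (@lebesgue_measure R).-integrable `[0, t] (EFin \o f).
Proof.
move=> cf; apply: continuous_compact_integrable; first exact: segment_compact.
by apply: continuous_subspaceW cf => s /=; rewrite !in_itv /= => /andP[->].
Qed.

End PathContinuity.

Section Tame.
Context {R : realType} {N : nat}.
Local Notation C := R[i].

Lemma continuous_path_entry (x : R -> 'M[C]_N) k l : continuous_path x ->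
  path_cont (fun t => complex.Re (x t k l)) /\
  path_cont (fun t => complex.Im (x t k l)).
Proof.
move=> /subspace_continuousP cx.
have H (t : R) : `[0, +oo[%classic t ->
    complex.Re (x s k l) @[s --> within `[0, +oo[%classic (nbhs t)] --> complex.Re (x t k l) /\
    complex.Im (x s k l) @[s --> within `[0, +oo[%classic (nbhs t)] --> complex.Im (x t k l).
  by move=> t0; have /cvg_mxP /(_ k l) /cvg_complexP := cx t t0.
by split; apply/subspace_continuousP => t t0; have [] := H t t0.
Qed.

(** Exactly what [ito_expands] asks of an integrand along a solution. The property is stable under
    sums and products, so it holds for the coefficients of the equation without computing a
    bound. *)
Definition tame (f : 'M[C]_N -> C) : Prop :=
  (exists K, forall rho, density rho ->
     `|complex.Re (f rho)| <= K /\ `|complex.Im (f rho)| <= K) /\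
  (forall x, continuous_path x ->
     path_cont (fun t => complex.Re (f (x t))) /\
     path_cont (fun t => complex.Im (f (x t)))).

Lemma tame_entry k l : tame (fun rho => rho k l).
Proof.
split; last by move=> x cx; exact: continuous_path_entry.
by exists 1 => rho drho; exact: entry_bounded.
Qed.

Lemma tame_cst c : tame (fun=> c).
Proof.
split; last by move=> x _; split; exact: path_cont_cst.
exists (`|complex.Re c| + `|complex.Im c|) => rho _.
by rewrite lerDl lerDr.
Qed.

Lemma tameD f g : tame f -> tame g -> tame (fun rho => f rho + g rho).
Proof.
move=> [[K HK] cf] [[L HL] cg]; split.
  exists (K + L) => rho drho; have [f1 f2] := HK rho drho; have [g1 g2] := HL rho drho.
  by rewrite cReD cImD; split; apply: (le_trans (ler_normD _ _)); exact: lerD.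
move=> x cx; have [f1 f2] := cf x cx; have [g1 g2] := cg x cx.
split.
  under eq_fun do rewrite cReD; exact: path_contD.
under eq_fun do rewrite cImD; exact: path_contD.
Qed.

Lemma tameM f g : tame f -> tame g -> tame (fun rho => f rho * g rho).
Proof.
move=> [[K HK] cf] [[L HL] cg]; split.
  exists (K * L + K * L) => rho drho.
  have [f1 f2] := HK rho drho; have [g1 g2] := HL rho drho.
  rewrite cReM cImM; split.
    by apply: (le_trans (ler_normB _ _)); rewrite !normrM lerD // ler_pM.
  by apply: (le_trans (ler_normD _ _)); rewrite !normrM lerD // ler_pM.
move=> x cx; have [f1 f2] := cf x cx; have [g1 g2] := cg x cx.
split.
  by under eq_fun do rewrite cReM; apply: path_contB; exact: path_contM.
by under eq_fun do rewrite cImM; apply: path_contD; exact: path_contM.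
Qed.

Lemma tame_ext f g : f =1 g -> tame f -> tame g.
Proof. by move=> /funext ->. Qed.

Lemma tameB f g : tame f -> tame g -> tame (fun rho => f rho - g rho).
Proof.
move=> tf tg; apply: tame_ext (tameD tf (tameM (tame_cst (-1)) tg)) => rho /=.
by rewrite mulN1r.
Qed.

Lemma tame_sum I (s : seq I) (f : I -> 'M[C]_N -> C) :
  (forall i, tame (f i)) -> tame (fun rho => \sum_(i <- s) f i rho).
Proof.
move=> H; elim: s => [|i s ih].
  by apply: tame_ext (tame_cst 0) => rho; rewrite big_nil.
by apply: tame_ext (tameD (H i) ih) => rho; rewrite big_cons.
Qed.

Definition tame_mx (f : 'M[C]_N -> 'M[C]_N) := forall k l, tame (fun rho => f rho k l).

Lemma tame_mx_id : tame_mx id.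
Proof. exact: tame_entry. Qed.

Lemma tame_mx_cst A : tame_mx (fun=> A).
Proof. by move=> k l; exact: tame_cst. Qed.

Lemma tame_mxM f g : tame_mx f -> tame_mx g -> tame_mx (fun rho => f rho *m g rho).
Proof.
move=> tf tg k l.
have H : tame (fun rho => \sum_j f rho k j * g rho j l).
  by apply: tame_sum => j; exact: tameM.
by apply: tame_ext H => rho; rewrite mxE.
Qed.

Lemma tame_mxD f g : tame_mx f -> tame_mx g -> tame_mx (fun rho => f rho + g rho).
Proof.
by move=> tf tg k l; apply: tame_ext (tameD (tf k l) (tg k l)) => rho; rewrite mxE.
Qed.

Lemma tame_mxB f g : tame_mx f -> tame_mx g -> tame_mx (fun rho => f rho - g rho).
Proof.
by move=> tf tg k l; apply: tame_ext (tameB (tf k l) (tg k l)) => rho; rewrite !mxE.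
Qed.

Lemma tame_mxZ c f : tame c -> tame_mx f -> tame_mx (fun rho => c rho *: f rho).
Proof.
by move=> tc tf k l; apply: tame_ext (tameM tc (tf k l)) => rho; rewrite !mxE.
Qed.

Lemma tame_trace f : tame_mx f -> tame (fun rho => \tr (f rho)).
Proof. by move=> tf; apply: tame_sum => i; exact: tf. Qed.

Lemma tame_drift omega M Jz : tame_mx (sme_drift omega M Jz).
Proof.
rewrite /sme_drift /bracket.
by apply: tame_mxD; apply: (tame_mxZ (tame_cst _)); repeat first
  [ apply: tame_mxB | apply: (tame_mxZ (tame_cst _)) | exact: tame_mx_id
  | exact: tame_mx_cst | apply: tame_mxM ].
Qed.

Lemma tame_diffusion eta M Jz : tame_mx (sme_diffusion eta M Jz).
Proof.
apply: (tame_mxZ (tame_cst _)); apply: tame_mxB; first apply: tame_mxD.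
- by apply: tame_mxM; [exact: tame_mx_cst|exact: tame_mx_id].
- by apply: tame_mxM; [exact: tame_mx_id|exact: tame_mx_cst].
- apply: tame_mxZ; last exact: tame_mx_id.
  apply: tameM; first exact: tame_cst.
  by apply: tame_trace; apply: tame_mxM; [exact: tame_mx_cst|exact: tame_mx_id].
Qed.

End Tame.

Section Populations.
Context {R : realType} {N : nat}.
Local Notation C := R[i].
Variable e : 'I_N -> 'cV[C]_N.
Hypothesis he : orthonormal_basis e.

Definition wgt (n k l : 'I_N) : C := (e n k 0)^* * e n l 0.

(** Stochastic and time integrals are taken separately on the real and imaginary parts of the
    entries; this real-linear formula carries their properties over to populations. *)
Lemma pop_entries n A : pop e n A =
  \sum_k \sum_l (complex.Re (wgt n k l) * complex.Re (A k l) +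
                 - complex.Im (wgt n k l) * complex.Im (A k l)).
Proof.
rewrite popE matelE cRe_sum; apply: eq_bigr => k _.
rewrite cRe_sum; apply: eq_bigr => l _.
by rewrite mulrAC -/(wgt n k l) cReM mulNr.
Qed.

Lemma pop_path_cont n (x : R -> 'M[C]_N) : continuous_path x ->
  path_cont (fun t => pop e n (x t)).
Proof.
move=> cx; under eq_fun do rewrite pop_entries.
apply: path_cont_sum => k; apply: path_cont_sum => l.
have [cRe cIm] := continuous_path_entry k l cx.
by apply: path_contD; apply: path_contM => //; exact: path_cont_cst.
Qed.

Lemma popB n A B : pop e n (A - B) = pop e n A - pop e n B.
Proof. by rewrite !popE matelB cReD (raddfN (@complex.Re R)). Qed.

(** By linearity the population passes under the time integral, where [matel_drift] annihilates
    it. *)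
Lemma pop_integral_drift n omega M Jz t (x : R -> 'M[C]_N) :
  is_Jz e Jz -> continuous_path x ->
  pop e n (integral_mx t (fun s => sme_drift omega M Jz (x s))) = 0.
Proof.
move=> hJz cx; pose f s := sme_drift omega M Jz (x s).
have iRe k l : (@lebesgue_measure R).-integrable `[0, t]
    (EFin \o (fun s => complex.Re (f s k l))).
  apply: path_cont_integrable; have [_ /(_ x cx) []] := @tame_drift R N omega M Jz k l.
  by [].
have iIm k l : (@lebesgue_measure R).-integrable `[0, t]
    (EFin \o (fun s => complex.Im (f s k l))).
  apply: path_cont_integrable; have [_ /(_ x cx) []] := @tame_drift R N omega M Jz k l.
  by [].
have iZ c g : (@lebesgue_measure R).-integrable `[0, t] (EFin \o g) ->
    (@lebesgue_measure R).-integrable `[0, t] (EFin \o (fun s => c * g s)).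
  move=> ig; have := @integrableZl _ _ _ (@lebesgue_measure R) `[0, t]%classic
    (measurable_itv _) c _ ig.
  by apply: eq_integrable.
have iD g h : (@lebesgue_measure R).-integrable `[0, t] (EFin \o g) ->
    (@lebesgue_measure R).-integrable `[0, t] (EFin \o h) ->
    (@lebesgue_measure R).-integrable `[0, t] (EFin \o (fun s => g s + h s)).
  move=> ig ih; have := @integrableD _ _ _ (@lebesgue_measure R) `[0, t]%classic
    (measurable_itv _) _ _ ig ih.
  by apply: eq_integrable.
have Rsum (I : finType) (g : I -> R -> R) :
    (forall i, (@lebesgue_measure R).-integrable `[0, t] (EFin \o g i)) ->
    (@lebesgue_measure R).-integrable `[0, t] (EFin \o (fun s => \sum_i g i s)) /\
    \int[lebesgue_measure]_(s in `[0, t]) (\sum_i g i s) =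
      \sum_i \int[lebesgue_measure]_(s in `[0, t]) g i s.
  move=> ig; elim: (index_enum I) => [|i r [ih1 ih2]].
    have -> : (fun s : R => \sum_(i <- [::]) g i s) = (fun=> 0).
      by apply/funext => s; rewrite big_nil.
    split; last by rewrite big_nil Rintegral_cst ?mul0r //; exact: measurable_itv.
    by apply: path_cont_integrable; exact: path_cont_cst.
  have -> : (fun s : R => \sum_(j <- i :: r) g j s) =
      (fun s => g i s + \sum_(j <- r) g j s).
    by apply/funext => s; rewrite big_cons.
  split; first exact: iD.
  by rewrite big_cons -ih2 RintegralD //; exact: measurable_itv.
have E : \int[lebesgue_measure]_(s in `[0, t]) pop e n (f s) = 0.
  have -> : (fun s => pop e n (f s)) = (fun=> 0).
    by apply/funext => s; rewrite popE matel_drift.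
  by rewrite Rintegral_cst ?mul0r //; exact: measurable_itv.
rewrite pop_entries -[RHS]E.
have -> : (fun s => pop e n (f s)) = (fun s => \sum_k \sum_l
    (complex.Re (wgt n k l) * complex.Re (f s k l) +
     - complex.Im (wgt n k l) * complex.Im (f s k l))).
  by apply/funext => s; rewrite pop_entries.
have ikl k l := iD _ _ (iZ (complex.Re (wgt n k l)) _ (iRe k l))
  (iZ (- complex.Im (wgt n k l)) _ (iIm k l)).
have [_ ->] := Rsum _ _ (fun k => (Rsum _ _ (ikl k)).1).
apply: eq_bigr => k _; have [_ ->] := Rsum _ _ (ikl k); apply: eq_bigr => l _.
rewrite RintegralD //; [|exact: iZ|exact: iZ].
rewrite !RintegralZl //; try exact: measurable_itv.
by rewrite /integral_mx mxE.
Qed.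

End Populations.

(** * Maximal inequality for supermartingales *)

Section MaximalInequality.
Context {R : realType} {d : measure_display} {Omega : measurableType d}.
Variable P : probability Omega R.
Variable F : R -> set (set Omega).
Hypothesis hF : filtration F.
Variable U : R -> Omega -> R.
Hypothesis U_ge0 : forall t w, 0 <= t -> 0 <= U t w.
Hypothesis U_fmeas : forall t, 0 <= t -> fmeas F t (U t).
Hypothesis U_integ : forall t, 0 <= t -> integ P (U t).
Hypothesis U_cont : forall w, path_cont (U ^~ w).
Hypothesis U_super : forall s t S, 0 <= s -> s <= t -> F s S ->
  ex P (fun w => \1_S w * U t w) <= ex P (fun w => \1_S w * U s w).

Let FI t A B : F t A -> F t B -> F t (A `&` B).
Proof.
have := filtration_sigma hF t => /sigma_algebra_id E.
rewrite -E => FA FB; exact: (@measurableI _ (g_sigma_algebraType (F t))).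
Qed.

Let gt_fmeas t c : 0 <= t -> F t [set w | c < U t w].
Proof.
move=> t0; have -> : [set w | c < U t w] = U t @^-1` `]c, +oo[%classic.
  by apply/seteqP; split=> w /=; rewrite in_itv /= andbT.
by apply: (U_fmeas t0); exact: measurable_itv.
Qed.

Let le_fmeas t c : 0 <= t -> F t [set w | U t w <= c].
Proof.
move=> t0; have -> : [set w | U t w <= c] = U t @^-1` `]-oo, c]%classic.
  by apply/seteqP; split=> w /=; rewrite in_itv.
by apply: (U_fmeas t0); exact: measurable_itv.
Qed.

(** Exceedance at one of the [n] grid points from [tau j] on; peeling off the first point drives the
    induction. *)
Let exceeds (tau : nat -> R) c n j : set Omega :=
  [set w | exists2 i, (i < n)%N & c < U (tau (j + i)%N) w].

Let exceeds0 tau c j : exceeds tau c 0 j = set0.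
Proof. by apply/seteqP; split=> w // -[]. Qed.

Let exceedsS tau c n j : exceeds tau c n.+1 j =
  [set w | c < U (tau j) w] `|` exceeds tau c n j.+1.
Proof.
apply/seteqP; split=> w.
  move=> [[|i] ilt cU]; first by left; rewrite addn0 in cU.
  by right; exists i => //; rewrite addSnnS.
move=> [cU|[i ilt cU]]; first by exists 0%N; rewrite ?addn0.
by exists i.+1 => //; rewrite -addSnnS.
Qed.

Let exceeds_measurable tau c n j : (forall i, 0 <= tau i) ->
  measurable (exceeds tau c n j).
Proof.
move=> tau0; elim: n j => [|n ih] j; first by rewrite exceeds0.
rewrite exceedsS; apply: measurableU => //.
exact: (filtration_measurable hF (gt_fmeas c (tau0 j))).
Qed.

Let integ_indic_mul S t : 0 <= t -> measurable S ->
  integ P (fun w => \1_S w * U t w).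
Proof.
move=> t0 mS; apply: (@integ_mul_bounded _ _ _ P 1) => //.
- by move=> w; rewrite indicE; case: (_ \in _); rewrite /= ?normr1 ?normr0.
- exact: U_integ.
Qed.

Let integ_indic S : measurable S -> integ P (\1_S : Omega -> R).
Proof.
move=> mS; apply: (@integ_bounded _ _ _ P 1); first exact: measurable_indic.
by move=> w; rewrite indicE; case: (_ \in _); rewrite /= ?normr1 ?normr0.
Qed.

Let ex_indic S : measurable S -> (ex P (\1_S : Omega -> R))%:E = P S.
Proof. by move=> mS; rewrite exE ?integral_indic ?setIT //; exact: integ_indic. Qed.

(** Doob's maximal inequality on the grid [tau], by induction on the number of
    grid points that remain after [tau j]. *)
Let maximal_finite tau c n j S : 0 < c -> (forall i, 0 <= tau i) ->
  (forall i, tau i <= tau i.+1) -> F (tau j) S ->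
  c * ex P (\1_(S `&` exceeds tau c n j) : Omega -> R) <=
  ex P (fun w => \1_S w * U (tau j) w).
Proof.
move=> c0 tau0 tauS; elim: n j S => [|n ih] j S FS.
  rewrite exceeds0 setI0; under eq_ex do rewrite indic0.
  rewrite ex_cst mulr0; apply: ex_ge0 => w.
  by rewrite mulr_ge0 ?U_ge0.
have mS := filtration_measurable hF FS.
(* On [S1] the level is exceeded at once and Markov's inequality applies; on [S2] the induction
   hypothesis and the supermartingale property do. *)
pose S1 := S `&` [set w | c < U (tau j) w].
pose S2 := S `&` [set w | U (tau j) w <= c].
have F1 : F (tau j) S1 by apply: FI => //; exact: gt_fmeas.
have F2 : F (tau j) S2 by apply: FI => //; exact: le_fmeas.
have mS1 := filtration_measurable hF F1; have mS2 := filtration_measurable hF F2.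
have mE := exceeds_measurable c n j.+1 tau0.
have F2' : F (tau j.+1) S2 by exact: (filtration_mono hF (tauS j)).
have H := ih j.+1 S2 F2'.
have H2 := U_super (tau0 j) (tauS j) F2.
have iS1 := integ_indic mS1.
have iS2 := integ_indic (measurableI _ _ mS2 mE).
have H1 : c * ex P (\1_S1 : Omega -> R) <= ex P (fun w => \1_S1 w * U (tau j) w).
  rewrite -exZ //; apply: ex_le; [exact: integZ|exact: integ_indic_mul|].
  move=> w; rewrite indicE; case: (boolP (w \in S1)) => [|_] /=; last by rewrite mulr0 mul0r.
  by rewrite inE => -[_ /ltW cU]; rewrite mulr1 mul1r.
have H3 : ex P (\1_(S `&` exceeds tau c n.+1 j) : Omega -> R) <=
    ex P (\1_S1 : Omega -> R) + ex P (\1_(S2 `&` exceeds tau c n j.+1) : Omega -> R).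
  rewrite -exD //; apply: ex_le.
  - by apply: integ_indic; apply: measurableI => //; exact: exceeds_measurable.
  - exact: integD.
  move=> w; rewrite !indicE exceedsS.
  case: (boolP (w \in S `&` _)) => [|_] /=; last by rewrite addr_ge0.
  rewrite inE => -[Sw Ew].
  have [cU|Uc] := ltP c (U (tau j) w).
    by rewrite [w \in S1]mem_set //= lerDl.
  have -> : w \in S2 `&` exceeds tau c n j.+1.
    by rewrite inE; split => //; case: Ew => //=; rewrite ltNge Uc.
  by rewrite /= lerDr.
have H4 : ex P (fun w => \1_S1 w * U (tau j) w) + ex P (fun w => \1_S2 w * U (tau j) w)
    = ex P (fun w => \1_S w * U (tau j) w).
  rewrite -exD; [|exact: integ_indic_mul|exact: integ_indic_mul].
  apply: eq_ex => w; rewrite -mulrDl; congr (_ * _); rewrite !indicE.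
  have [Sw|Sw] := pselect (S w).
    have [cU|Uc] := ltP c (U (tau j) w).
      rewrite (mem_set Sw) (mem_set (A := S1)) // memNset ?addr0 // => -[_ /=].
      by rewrite leNgt cU.
    rewrite (mem_set Sw) (mem_set (A := S2)) // memNset ?add0r // => -[_ /=].
    by rewrite ltNge Uc.
  by rewrite (memNset Sw) !memNset ?addr0 // => -[].
rewrite -H4; apply: (le_trans (ler_wpM2l (ltW c0) H3)); rewrite mulrDr lerD //.
exact: le_trans H2.
Qed.

Let dyadic n (j : nat) : R := j%:R / 2 ^+ n.

Let dyadic_ge0 n j : 0 <= dyadic n j.
Proof. by rewrite divr_ge0 // exprn_ge0. Qed.

(** The grid of mesh [2^-n] over [[0, n]]; the successor counts both endpoints. *)
Let above c n := exceeds (dyadic n) c (n * 2 ^ n).+1 0.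

Let above_mono c : {homo above c : n m / (n <= m)%N >-> (n <= m)%O}.
Proof.
apply: homo_leq => [A|A B C|n]; [exact: lexx|exact: le_trans|].
(* The grids are nested: [i / 2^n = 2 i / 2^(n + 1)]. *)
apply/subsetPset => w [i ilt cU]; exists (2 * i)%N.
  rewrite ltnS expnS mulnCA leq_mul2l /=; apply: leq_trans (_ : n * 2 ^ n <= _)%N => //.
  by rewrite leq_mul2r leqnSn orbT.
rewrite add0n in cU *; rewrite (_ : dyadic _ _ = dyadic n i) //.
by rewrite add0n /dyadic natrM exprS; field; rewrite expf_neq0.
Qed.

Let above_measurable c n : measurable (above c n).
Proof. exact: exceeds_measurable. Qed.

(** The finite-grid bound does not depend on [n] and passes to the increasing union of events. *)
Lemma exceeds_probability c : 0 < c ->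
  (P (\bigcup_n above c n) <= (ex P (U 0) / c)%:E)%E.
Proof.
move=> c0.
have cvg := @nondecreasing_cvg_mu _ _ _ P (above c) (above_measurable c)
  (bigcupT_measurable _ (above_measurable c)) (above_mono c).
rewrite -(cvg_lim _ cvg) //; apply: lime_le; first by apply/cvg_ex; eexists; exact: cvg.
apply: nearW => n /=; rewrite -ex_indic // lee_fin ler_pdivlMr // mulrC.
have F0 : F 0 setT.
  have := filtration_sigma hF 0 => /sigma_algebra_id E.
  rewrite -E; exact: (@measurableT _ (g_sigma_algebraType (F 0))).
have tauS i : dyadic n i <= dyadic n i.+1.
  by rewrite ler_wpM2r ?invr_ge0 ?exprn_ge0 // ler_nat.
have d0 : dyadic n 0 = 0 by rewrite /dyadic mul0r.
have := @maximal_finite (dyadic n) c (n * 2 ^ n).+1 0 setT c0 (dyadic_ge0 n) tauS.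
rewrite d0 setTI => /(_ F0) /le_trans; apply.
rewrite le_eqVlt; apply/orP; left; apply/eqP; apply: eq_ex => w.
by rewrite indicT mul1r.
Qed.

(** By continuity, exceeding [c] at any time implies exceeding it at a dyadic
    time. *)
Lemma exceeds_path c t w : 0 <= t -> c < U t w -> (\bigcup_n above c n) w.
Proof.
move=> t0 cU; have e0 : 0 < U t w - c by rewrite subr_gt0.
have [r r0 Hr] := (path_contP (U ^~ w)).1 (@U_cont w) t t0 _ e0.
(* Chosen so that [t <= n] and [2^-n < r]; the grid point just below [t] is then within the range
   where [U] stays above [c]. *)
pose n := maxn (Num.truncn t).+1 (Num.truncn r^-1).+1.
have nt : t <= n%:R.
  apply: ltW; apply: (lt_le_trans (truncnS_gt t)).
  by rewrite ler_nat leq_maxl.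
have n2 : n%:R < 2 ^+ n :> R by rewrite -natrX ltr_nat ltn_expl.
have nr : (2 ^+ n)^-1 < r.
  rewrite invf_plt ?posrE ?exprn_gt0 //; apply: lt_trans n2.
  apply: (lt_le_trans (truncnS_gt r^-1)).
  by rewrite ler_nat leq_maxr.
have p0 : 0 < 2 ^+ n :> R by rewrite exprn_gt0.
pose j := Num.truncn (t * 2 ^+ n).
have tp : 0 <= t * 2 ^+ n by rewrite mulr_ge0 // ltW.
have /andP[j1 j2] := truncn_itv tp.
exists n => //; exists j.
  rewrite ltnS -(@ler_nat R) natrM natrX; apply: (le_trans j1).
  by rewrite ler_wpM2r // ltW.
rewrite add0n.
have := Hr (dyadic n j) (dyadic_ge0 n j).
have h1 : dyadic n j <= t by rewrite ler_pdivrMr.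
have h2 : t < dyadic n j + (2 ^+ n)^-1.
  by rewrite /dyadic -[X in _ + X]mul1r -mulrDl natr1 ltr_pdivlMr.
rewrite ler0_norm ?subr_le0 // opprB => H.
have {H} : `|U (dyadic n j) w - U t w| < U t w - c by apply: H; lra.
by rewrite ltr_distl => /andP[]; lra.
Qed.

(** An unbounded path exceeds every level [k + 1], an event of probability at most
    [E U_0 / (k + 1)]. *)
Lemma supermartingale_bounded : {ae P, forall w, exists K, forall t, 0 <= t -> U t w <= K}.
Proof.
pose B := \bigcap_k \bigcup_n above k.+1%:R n.
have mB : measurable B.
  by apply: bigcapT_measurable => k; apply: bigcupT_measurable => n.
exists B; split => //.
  apply/eqP; rewrite eq_le measure_ge0 andbT; apply/lee_addgt0Pr => e e0.
  rewrite add0e.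
  have U00 : 0 <= ex P (U 0) by apply: ex_ge0 => w; exact: U_ge0.
  pose k := Num.truncn (ex P (U 0) / e).
  apply: (@le_trans _ _ (P (\bigcup_n above k.+1%:R n))).
    apply: le_measure; rewrite ?inE //; first exact: bigcupT_measurable.
    by move=> w; exact.
  apply: (le_trans (exceeds_probability _)); first by rewrite ltr0n.
  rewrite lee_fin ler_pdivrMr ?ltr0n // mulrC -ler_pdivrMr //.
  by apply: ltW; exact: truncnS_gt.
move=> w /= nb k _; apply: contrapT => H; apply: nb.
exists k.+1%:R => t t0; rewrite leNgt; apply/negP => cU.
by apply: H; exact: (exceeds_path t0 cU).
Qed.

(** With [E U_0 = 0] each level [1 / (k + 1)] is exceeded with probability 0. This yields the
    invariance of the set of pure states. *)
Lemma supermartingale_zero : ex P (U 0) = 0 ->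
  {ae P, forall w, forall t, 0 <= t -> U t w = 0}.
Proof.
move=> U00.
have H k : {ae P, forall w, ~ (\bigcup_n above k.+1%:R^-1 n) w}.
  exists (\bigcup_n above k.+1%:R^-1 n); split.
  - exact: bigcupT_measurable.
  - apply/eqP; rewrite eq_le measure_ge0 andbT.
    by have := @exceeds_probability k.+1%:R^-1; rewrite U00 mul0r invr_gt0 ltr0n; apply.
  - by move=> w /= /contrapT.
have /ae_foralln := H; apply: filterS => w /= Hw t t0; apply: contrapT => Ut.
have Up : 0 < U t w by rewrite lt_def U_ge0 // andbT; exact/eqP.
apply: (Hw (Num.truncn (U t w)^-1)); apply: exceeds_path t0 _.
rewrite invf_plt ?posrE ?ltr0n //; exact: truncnS_gt.
Qed.

End MaximalInequality.

Lemma natural_filtration_filtration {R : realType} {d : measure_display}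
    {Omega : measurableType d} (P : probability Omega R) (W : R -> Omega -> R) :
  (forall t, 0 <= t -> measurable_fun setT (W t)) ->
  filtration (natural_filtration P W).
Proof.
move=> mW; split.
- by move=> t; exact: smallest_sigma_algebra.
- move=> s t st; apply: sub_sigma_algebra2; apply: setSU => A [r [B [r0 rs mB ->]]].
  by exists r, B; split => //; exact: le_trans st.
- move=> t A; apply: smallest_sub; first exact: sigma_algebra_measurable.
  move=> B [[r [D [r0 rs mD ->]]]|[] //].
  by rewrite -[_ @^-1` _]setTI; exact: mW.
Qed.

(** * Populations along a solution *)

Lemma le_double_sum {R : realType} {N : nat} (f : 'I_N -> 'I_N -> R) :
  (forall i j, 0 <= f i j) -> forall n m, f n m <= \sum_i \sum_j f i j.
Proof.
move=> f0 n m; apply: (@le_trans _ _ (\sum_j f n j)).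
  by rewrite (bigD1 m) //= lerDl sumr_ge0.
by rewrite [leRHS](bigD1 n) //= lerDl sumr_ge0 // => i _; rewrite sumr_ge0.
Qed.

Lemma sqrt_mul_le1 {R : realType} (a b : R) : 0 <= a <= 1 -> 0 <= b <= 1 ->
  Num.sqrt (a * b) <= 1.
Proof.
move=> /andP[a0 a1] /andP[b0 b1].
by rewrite -[leRHS]sqrtr1 ler_wsqrtr // mulr_ile1.
Qed.

(** Replaces both expectations of a decay estimate by equal expressions in one application. *)
Lemma le_scale_eq {R : realType} (k a b c d : R) :
  a = b -> c = d -> b <= k * d -> a <= k * c.
Proof. by move=> -> ->. Qed.

Section Coherence.
Context {R : realType} {N : nat}.
Variable e : 'I_N -> 'cV[R[i]]_N.

Definition coherence (A : 'M[R[i]]_N) : R :=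
  \sum_n \sum_m (if n == m then 0 else Num.sqrt (pop e n A * pop e m A)).

Lemma coherence_ge0 A : 0 <= coherence A.
Proof.
by apply: sumr_ge0 => n _; apply: sumr_ge0 => m _; case: ifP => // _; exact: sqrtr_ge0.
Qed.

End Coherence.

Section Solution.
Context {R : realType} {d : measure_display} {Omega : measurableType d}.
Variable P : probability Omega R.
Variable F : R -> set (set Omega).
Hypothesis hF : filtration F.
Variable W : R -> Omega -> R.
Hypothesis hW : standard_wiener P F W.
Variables (N : nat) (e : 'I_N -> 'cV[R[i]]_N).
Hypothesis he : orthonormal_basis e.
Variable Jz : 'M[R[i]]_N.
Hypothesis hJz : is_Jz e Jz.
Variables eta M omega : R.
Hypothesis eta0 : 0 < eta.
Hypothesis M0 : 0 < M.
Variables (rho0 : 'M[R[i]]_N) (X : R -> Omega -> 'M[R[i]]_N).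
Hypothesis hX : solution_in P F W (sme_drift omega M Jz) (sme_diffusion eta M Jz)
  density rho0 X.

Let dX t w : 0 <= t -> density (X t w).
Proof. exact: (solution_state hX). Qed.

Let cX w : continuous_path (X ^~ w).
Proof. exact: (solution_continuous hX). Qed.

Lemma pop_fmeas n t : 0 <= t -> fmeas F t (fun w => pop e n (X t w)).
Proof.
move=> t0; have -> : (fun w => pop e n (X t w)) = (fun w => \sum_k \sum_l
    (complex.Re (wgt e n k l) * complex.Re (X t w k l) +
     - complex.Im (wgt e n k l) * complex.Im (X t w k l))).
  by apply/funext => w; rewrite pop_entries.
apply: (fmeas_sum hF) => k; apply: (fmeas_sum hF) => l.
have [aRe aIm] := solution_adapted hX k l.
apply: (fmeasD hF); apply: (fmeasM hF); try exact: (fmeas_cst hF).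
  exact: (aRe t t0).
exact: (aIm t t0).
Qed.

Let pop01X n t w : 0 <= t -> 0 <= pop e n (X t w) <= 1.
Proof. by move=> t0; apply: (pop01 he); exact: dX. Qed.

Definition rate (n : 'I_N) t w : R :=
  2 * Num.sqrt (eta * M) * (spin n - \sum_m spin m * pop e m (X t w)).

(** Each entry of the stochastic integral expands by [ito_expands], and a population is a fixed real
    combination of entries. The initial state cancels in increments and the drift integral has zero
    population. *)
Lemma pop_expands n : expands P F W (fun t w => pop e n (X t w))
  (fun t w => rate n t w * pop e n (X t w)).
Proof.
pose H s w := sme_diffusion eta M Jz (X s w).
pose I t w := X t w - rho0 - integral_mx t (fun s => sme_drift omega M Jz (X s w)).
have entry k l : expands P F W (fun t w => complex.Re (I t w k l))
                               (fun s w => complex.Re (H s w k l)) /\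
                 expands P F W (fun t w => complex.Im (I t w k l))
                               (fun s w => complex.Im (H s w k l)).
  have [[K HK] cH] := @tame_diffusion R N eta M Jz k l.
  split; apply: (ito_expands hF hW (K := K)).
  - by move=> t t0; have [] := solution_sde hX t0 k l.
  - by move=> r w r0; have [] := HK _ (dX w r0).
  - by move=> w; have [] := cH _ (@cX w).
  - by move=> t t0; have [] := solution_sde hX t0 k l.
  - by move=> r w r0; have [] := HK _ (dX w r0).
  - by move=> w; have [] := cH _ (@cX w).
have sumE := expands_sum hF (index_enum 'I_N) (fun k => expands_sum hF (index_enum 'I_N)
  (fun l => expandsD hF (expandsZ hF (complex.Re (wgt e n k l)) (entry k l).1)
                     (expandsZ hF (- complex.Im (wgt e n k l)) (entry k l).2))).
apply: expands_ext sumE => s t w s0 st; rewrite -!pop_entries /I /H.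
have t0 : 0 <= t by exact: le_trans st.
rewrite 4!popB !(pop_integral_drift _ _ _ _ hJz (@cX w)) !subr0; split; first by ring.
by rewrite [RHS]popE (matel_diffusion he eta M hJz n (dX w s0)).
Qed.

Let rate_bound := 2 * Num.sqrt (eta * M) * (\sum_(m < N) `|spin m : R| + \sum_(m < N) `|spin m : R|).

Let rate_le n t w : 0 <= t -> `|rate n t w| <= rate_bound.
Proof.
move=> t0; rewrite /rate normrM ger0_norm ?mulr_ge0 ?sqrtr_ge0 //.
rewrite ler_wpM2l ?mulr_ge0 ?sqrtr_ge0 //; apply: (le_trans (ler_normB _ _)).
apply: lerD.
  by rewrite (bigD1 n) //= lerDl sumr_ge0.
apply: (le_trans (ler_norm_sum _ _ _)); apply: ler_sum => m _.
have /andP[p0 p1] := pop01X m w t0.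
by rewrite normrM (ger0_norm p0) ler_piMr.
Qed.

Let rate_fmeas n t : 0 <= t -> fmeas F t (rate n t).
Proof.
move=> t0; apply: (fmeasM hF); first exact: (fmeas_cst hF).
apply: (fmeasB hF); first exact: (fmeas_cst hF).
apply: (fmeas_sum hF) => m; apply: (fmeasM hF); first exact: (fmeas_cst hF).
exact: pop_fmeas.
Qed.

(** The expansion is used on all of [[0, t]]: both the [dW] term and the remainder have mean zero
    over intervals of any length. *)
Lemma pop_mean n t : 0 <= t -> ex P (fun w => pop e n (X t w)) = pop e n rho0.
Proof.
move=> t0; have fa : fmeas F 0 (fun w => rate n 0 w * pop e n (X 0 w)).
  by apply: (fmeasM hF); [exact: rate_fmeas|exact: pop_fmeas].
have ba w : `|rate n 0 w * pop e n (X 0 w)| <= rate_bound.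
  have /andP[p0 p1] := pop01X n w (lexx 0).
  rewrite normrM (ger0_norm p0); apply: le_trans (rate_le n w (lexx 0)).
  by rewrite ler_piMr.
have sa := sqint_bounded P (fmeas_measurable hF fa) ba.
have iW : integ P (fun w => rate n 0 w * pop e n (X 0 w) * dW W 0 t w).
  by apply: sqint_mul => //; exact: (dW_sqint hW).
have m1 := dW_mean hF hW (lexx 0) t0 fa sa.
have m2 := expands_mean (pop_expands n) (lexx 0) t0 (fmeas_cst hF 0 1)
  (fun=> lexx `|1 : R|).
have sr := expands_sqint (pop_expands n) (lexx 0) t0.
have E w : pop e n (X t w) = pop e n rho0 + (rate n 0 w * pop e n (X 0 w) * dW W 0 t w +
    1 * remainder W (fun t w => pop e n (X t w)) (fun t w => rate n t w * pop e n (X t w)) 0 t w).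
  by rewrite /remainder -(solution_start hX w); ring.
rewrite (eq_ex _ E) exD; last 2 first.
- exact: integ_cst.
- by apply: integD => //; apply: integZ; exact: sqint_integ.
rewrite exD //; last by apply: integZ; exact: sqint_integ.
by rewrite ex_cst m1 m2 !addr0.
Qed.

Let sqrt_integ n m t S : 0 <= t -> measurable S ->
  integ P (fun w => \1_S w * Num.sqrt (pop e n (X t w) * pop e m (X t w))).
Proof.
move=> t0 mS; apply: (@integ_bounded _ _ _ P 1).
  apply: measurable_funM; first exact: measurable_indic.
  apply: (fmeas_measurable hF (t := t)).
  apply: (fmeas_comp hF (g := @Num.sqrt R)).
    by apply: continuous_measurable_fun; exact: sqrt_continuous.
  by apply: (fmeasM hF); exact: pop_fmeas.
move=> w; have H := sqrt_mul_le1 (pop01X n w t0) (pop01X m w t0).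
rewrite indicE; case: (_ \in _); rewrite /= ?mul1r ?mul0r ?normr0 //.
by rewrite ger0_norm ?sqrtr_ge0.
Qed.

Lemma sqrt_pop_decay n m s t S : n != m -> 0 <= s -> s <= t -> F s S ->
  ex P (fun w => \1_S w * Num.sqrt (pop e n (X t w) * pop e m (X t w))) <=
  expR (- (eta * M / 2) * (t - s)) *
    ex P (fun w => \1_S w * Num.sqrt (pop e n (X s w) * pop e m (X s w))).
Proof.
move=> nm s0 st FS; pose k : R := Num.sqrt (eta * M) * (spin n - spin m).
have AB r w : 0 <= r -> rate n r w - rate m r w = 2 * k.
  by move=> _; rewrite /rate /k; ring.
have := decay hF hW (pop01X n) (pop01X m) (pop_fmeas n) (pop_fmeas m)
  (rate_fmeas n) (rate_fmeas m) (rate_le n) (rate_le m) AB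
  (pop_expands n) (pop_expands m) s0 st FS.
move=> /le_trans; apply; apply: ler_wpM2r.
  by apply: ex_ge0 => w; rewrite mulr_ge0 ?sqrtr_ge0.
rewrite ler_expR ler_wpM2r ?subr_ge0 // lerN2 ler_wpM2r //.
rewrite /k exprMn sqr_sqrtr ?mulr_ge0 ?(ltW eta0) ?(ltW M0) //.
rewrite ler_peMr ?mulr_ge0 ?(ltW eta0) ?(ltW M0) //.
have -> : spin n - spin m = (m%:R - n%:R : R) by rewrite /spin; ring.
rewrite -real_normK ?num_real // expr_ge1 //.
have [nltm|mltn|nmE] := ltngtP n m.
- by rewrite -natrB ?(ltnW nltm) // normr_nat ler1n subn_gt0.
- by rewrite distrC -natrB ?(ltnW mltn) // normr_nat ler1n subn_gt0.
- by move: nm; rewrite -(inj_eq val_inj) /= nmE eqxx.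
Qed.

Local Notation V := (fun t w => coherence e (X t w)).

Lemma coherence_decay s t S : 0 <= s -> s <= t -> F s S ->
  ex P (fun w => \1_S w * V t w) <=
  expR (- (eta * M / 2) * (t - s)) * ex P (fun w => \1_S w * V s w).
Proof.
move=> s0 st FS; have mS := filtration_measurable hF FS.
have t0 : 0 <= t by exact: le_trans st.
pose T r n m w := \1_S w * (if n == m then 0 else
  Num.sqrt (pop e n (X r w) * pop e m (X r w))).
have iT r n m : 0 <= r -> integ P (T r n m).
  rewrite /T; case: eqP => _ r0; last exact: sqrt_integ.
  by under eq_fun do rewrite mulr0; exact: integ_cst.
have E r : 0 <= r -> ex P (fun w => \1_S w * V r w) = \sum_n \sum_m ex P (T r n m).
  move=> r0; transitivity (ex P (fun w => \sum_n \sum_m T r n m w)).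
    apply: eq_ex => w; rewrite /coherence mulr_sumr; apply: eq_bigr => n _.
    by rewrite mulr_sumr.
  rewrite ex_sum; last by move=> n; apply: integ_sum => m; exact: iT.
  by apply: eq_bigr => n _; rewrite ex_sum // => m; exact: iT.
apply: (le_scale_eq (E t t0) (E s s0)); rewrite mulr_sumr; apply: ler_sum => n _; rewrite mulr_sumr.
apply: ler_sum => m _; rewrite /T; case: (eqVneq n m) => [_|nm].
  have -> : (fun w => \1_S w * (0 : R)) = fun=> 0.
    by apply/funext => w; rewrite mulr0.
  by rewrite ex_cst mulr0.
exact: sqrt_pop_decay.
Qed.

Lemma coherence_fmeas t : 0 <= t -> fmeas F t (V t).
Proof.
move=> t0; apply: (fmeas_sum hF) => n; apply: (fmeas_sum hF) => m.
case: eqP => _; first exact: (fmeas_cst hF).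
apply: (fmeas_comp hF (g := @Num.sqrt R)).
  by apply: continuous_measurable_fun; exact: sqrt_continuous.
by apply: (fmeasM hF); exact: pop_fmeas.
Qed.

Lemma coherence_integ t : 0 <= t -> integ P (V t).
Proof.
move=> t0; apply: integ_sum => n; apply: integ_sum => m.
case: eqP => _; first exact: integ_cst.
have := @sqrt_integ n m t setT t0 measurableT.
by under eq_fun do rewrite indicT mul1r.
Qed.

Lemma coherence_cont w : path_cont (V ^~ w).
Proof.
apply: path_cont_sum => n; apply: path_cont_sum => m.
case: eqP => _; first exact: path_cont_cst.
have cM : path_cont (fun t => pop e n (X t w) * pop e m (X t w)).
  by apply: path_contM; exact: (@pop_path_cont _ _ e _ (X ^~ w) (@cX w)).
move=> t; apply: (@cvg_comp _ _ _ (fun t => pop e n (X t w) * pop e m (X t w))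
  (@Num.sqrt R) _ _ _ (cM t)).
exact: sqrt_continuous.
Qed.

Lemma coherence_mean t : 0 <= t ->
  ex P (V t) <= expR (- (eta * M / 2) * t) * coherence e rho0.
Proof.
move=> t0; have F0 : F 0 setT.
  have := filtration_sigma hF 0 => /sigma_algebra_id E.
  rewrite -E; exact: (@measurableT _ (g_sigma_algebraType (F 0))).
have E r : ex P (V r) = ex P (fun w => \1_setT w * V r w).
  by apply: eq_ex => w; rewrite indicT mul1r.
have E0 : coherence e rho0 = ex P (fun w => \1_setT w * V 0 w).
  by rewrite -E -[LHS](ex_cst P); apply: eq_ex => w; rewrite (solution_start hX).
apply: (le_scale_eq (E t) E0); rewrite -[X in expR (_ * X)](subr0 t).
exact: coherence_decay.
Qed.

Let U t w := expR (eta * M / 2 * t) * V t w.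

Let U_super s t S : 0 <= s -> s <= t -> F s S ->
  ex P (fun w => \1_S w * U t w) <= ex P (fun w => \1_S w * U s w).
Proof.
move=> s0 st FS; have mS := filtration_measurable hF FS.
have t0 : 0 <= t by exact: le_trans st.
have iV r : 0 <= r -> integ P (fun w => \1_S w * V r w).
  move=> r0; apply: (@integ_mul_bounded _ _ _ P 1) (coherence_integ r0) => //.
  by move=> w; rewrite indicE; case: (_ \in _); rewrite /= ?normr1 ?normr0.
have E r : 0 <= r -> ex P (fun w => \1_S w * U r w) =
    expR (eta * M / 2 * r) * ex P (fun w => \1_S w * V r w).
  by move=> r0; rewrite -exZ ?iV //; apply: eq_ex => w; rewrite /U mulrCA.
have := ler_wpM2l (expR_ge0 (eta * M / 2 * t)) (coherence_decay s0 st FS).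
rewrite mulrA -expRD -(E t t0) => /le_trans; apply.
rewrite le_eqVlt; apply/orP; left; apply/eqP.
by apply: (etrans _ (esym (E s s0))); congr (expR _ * _); ring.
Qed.

Let U_ge0 t w : 0 <= t -> 0 <= U t w.
Proof. by move=> _; rewrite mulr_ge0 ?expR_ge0 ?coherence_ge0. Qed.

Let U_fmeas t : 0 <= t -> fmeas F t (U t).
Proof.
by move=> t0; apply: (fmeasM hF); [exact: (fmeas_cst hF)|exact: coherence_fmeas].
Qed.

Let U_integ t : 0 <= t -> integ P (U t).
Proof. by move=> t0; apply: integZ; exact: coherence_integ. Qed.

Let U_cont w : path_cont (U ^~ w).
Proof.
apply: path_contM; last exact: coherence_cont.
apply: continuous_subspaceT => t.
apply: (@continuous_comp _ _ _ (fun t : R => eta * M / 2 * t) expR).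
  by apply: cvgM; [exact: cvg_cst|exact: cvg_id].
exact: continuous_expR.
Qed.

Lemma coherence_ae_bounded : {ae P, forall w, exists K, forall t, 0 <= t ->
  coherence e (X t w) <= K * expR (- (eta * M / 2) * t)}.
Proof.
have := supermartingale_bounded hF U_ge0 U_fmeas U_integ U_cont U_super.
apply: filterS => w [K HK]; exists K => t t0.
have := ler_wpM2r (expR_ge0 (- (eta * M / 2) * t)) (HK t t0).
by rewrite /U mulrAC -expRD mulNr subrr expR0 mul1r.
Qed.

Lemma coherence_ae_zero : coherence e rho0 = 0 ->
  {ae P, forall w, forall t, 0 <= t -> coherence e (X t w) = 0}.
Proof.
move=> c0; have E0 : ex P (U 0) = 0.
  rewrite -[RHS](ex_cst P); apply: eq_ex => w.
  by rewrite /U (solution_start hX) c0 mulr0.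
have := supermartingale_zero hF U_ge0 U_fmeas U_integ U_cont U_super E0.
apply: filterS => w H t t0; apply/eqP.
by have /eqP := H t t0; rewrite /U mulf_eq0 gt_eqF ?expR_gt0.
Qed.

End Solution.

(** * Bures distance and convergence *)

Section ProbabilityVector.
Context {R : realType} {N : nat}.
Variable p : 'I_N -> R.
Hypothesis p0 : forall n, 0 <= p n.
Hypothesis p1 : \sum_n p n = 1.

Let V := \sum_n \sum_m (if n == m then 0 else Num.sqrt (p n * p m)).

Let term_ge0 n m : 0 <= if n == m then 0 else Num.sqrt (p n * p m).
Proof. by case: ifP => // _; exact: sqrtr_ge0. Qed.

Let V_ge0 : 0 <= V.
Proof. by apply: sumr_ge0 => n _; apply: sumr_ge0. Qed.

Let sum_others n : \sum_(m | m != n) p m = 1 - p n.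
Proof. by rewrite -p1 [in RHS](bigD1 n) //= addrAC subrr add0r. Qed.

Let p_le_others n m : n != m -> p n <= 1 - p m.
Proof.
by move=> nm; rewrite -sum_others (bigD1 n) //= lerDl sumr_ge0.
Qed.

Let p_le1 n : p n <= 1.
Proof. by rewrite -p1 (bigD1 n) //= lerDl sumr_ge0. Qed.

(** Some [p k] is at least [1 / N]. Then [1 - p k] is at most [N] times the sum of the [p k * p m],
    and each product is the square of a term of [V], hence at most that term times [V]. *)
Lemma exists_heavy_weight : exists k, 1 - p k <= N%:R * V ^+ 2.
Proof.
have [k Hk] : exists k, 1 <= N%:R * p k.
  apply: contrapT => H; have lt1 k : N%:R * p k < 1.
    by rewrite ltNge; apply/negP => Hk; apply: H; exists k.
  have N0 : (0 < N)%N.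
    by case: (posnP N) p1 => // N0; move: p; rewrite N0 => q;
      rewrite big_ord0 => /eqP; rewrite eq_sym oner_eq0.
  have : \sum_(k < N) N%:R * p k < \sum_(k < N) 1.
    rewrite (bigD1 (Ordinal N0)) //= [ltRHS](bigD1 (Ordinal N0)) //=.
    by apply: ltr_leD => //; apply: ler_sum => k _; exact: ltW.
  by rewrite -mulr_sumr p1 mulr1 sumr_const card_ord ltxx.
exists k; rewrite -sum_others.
apply: (@le_trans _ _ (\sum_(m | m != k) N%:R * (Num.sqrt (p k * p m) * V))).
  apply: ler_sum => m mk; apply: (@le_trans _ _ (N%:R * (p k * p m))).
    by rewrite mulrA ler_peMl.
  rewrite ler_wpM2l // -{1}[p k * p m]sqr_sqrtr ?mulr_ge0 // expr2.
  apply: ler_wpM2l; first exact: sqrtr_ge0.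
  have := le_double_sum term_ge0 k m.
  by rewrite eq_sym (negbTE mk).
rewrite -mulr_sumr ler_wpM2l // -mulr_suml expr2 ler_wpM2r //.
apply: (@le_trans _ _ (\sum_m (if k == m then 0 else Num.sqrt (p k * p m)))).
  rewrite [leRHS](bigID (fun m => m != k)) /=.
  rewrite (eq_bigr (fun m => if k == m then 0 else Num.sqrt (p k * p m))).
    by rewrite lerDl sumr_ge0.
  by move=> m mk; rewrite eq_sym (negbTE mk).
by rewrite /V [leRHS](bigD1 k) //= lerDl sumr_ge0 // => n _; exact: sumr_ge0.
Qed.

(** Products of weights are at most 1, hence below their square roots. *)
Lemma weight_variance_le k : p k * (1 - p k) <= V.
Proof.
rewrite -sum_others mulr_sumr.
apply: (@le_trans _ _ (\sum_m (if k == m then 0 else Num.sqrt (p k * p m)))).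
  rewrite [leRHS](bigD1 k) //= eqxx add0r; apply: ler_sum => m mk.
  rewrite eq_sym (negbTE mk); have q0 : 0 <= p k * p m by rewrite mulr_ge0.
  rewrite -{1}[p k * p m]sqr_sqrtr // expr2 ler_piMl ?sqrtr_ge0 //.
  by apply: sqrt_mul_le1; rewrite p0 p_le1.
by rewrite /V [leRHS](bigD1 k) //= lerDl sumr_ge0 // => n _; exact: sumr_ge0.
Qed.

(** Of two distinct indices one differs from [k], so its weight, and with it the product, is at most
    [1 - p k]; there are [N^2] terms. *)
Lemma double_sum_sqrt_le k : V <= N%:R ^+ 2 * Num.sqrt (1 - p k).
Proof.
apply: (@le_trans _ _ (\sum_(n < N) \sum_(m < N) Num.sqrt (1 - p k))).
  apply: ler_sum => n _; apply: ler_sum => m _; case: eqVneq => [_|nm].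
    exact: sqrtr_ge0.
  apply: ler_wsqrtr; have [nk|nk] := eqVneq n k.
    apply: (le_trans (ler_piMl (p0 m) (p_le1 n))).
    by apply: p_le_others; rewrite eq_sym -nk.
  apply: (le_trans (ler_piMr (p0 n) (p_le1 m))).
  exact: p_le_others.
by rewrite !sumr_const card_ord -mulrnA -[leLHS]mulr_natl natrM expr2.
Qed.

(** With [s = sqrt (p k)] in [[0, 1]]: [1 - s^2 <= 2 - 2 s] since [(1 - s)^2 >= 0], and
    [2 - 2 s <= 2 (1 - s^2)] since [s^2 <= s]. *)
Lemma sqrt_bures_bounds k :
  Num.sqrt (1 - p k) <= Num.sqrt (2 - 2 * Num.sqrt (p k)) <= Num.sqrt (2 * (1 - p k)).
Proof.
have s0 := sqrtr_ge0 (p k).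
have s1 : Num.sqrt (p k) <= 1 by rewrite -[leRHS]sqrtr1 ler_wsqrtr.
move: (sqr_sqrtr (p0 k)) s0 s1; move: (Num.sqrt (p k)) => s <- s0 s1.
by apply/andP; split; apply: ler_wsqrtr; nra.
Qed.

End ProbabilityVector.

Section Bures.
Context {R : realType} {N : nat}.
Variable e : 'I_N -> 'cV[R[i]]_N.
Hypothesis he : orthonormal_basis e.
Variable rho : 'M[R[i]]_N.
Hypothesis drho : density rho.

Let p0 n : 0 <= pop e n rho. Proof. exact: pop_ge0. Qed.
Let p1 : \sum_n pop e n rho = 1. Proof. exact: sum_pop. Qed.

Lemma bures_set_le_bures n : bures_set rho (pure_states e) <= bures rho (pure (e n)).
Proof.
apply: ge_inf; last by exists (pure (e n)) => //; exists n.
by exists 0 => _ [s _ <-]; exact: sqrtr_ge0.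
Qed.

Lemma le_bures_set c : (0 < N)%N -> (forall n, c <= bures rho (pure (e n))) ->
  c <= bures_set rho (pure_states e).
Proof.
move=> N0 H; apply: lb_le_inf.
  by exists (bures rho (pure (e (Ordinal N0)))); exists (pure (e (Ordinal N0))) => //;
    exists (Ordinal N0).
by move=> _ [_ [n _ <-] <-]; exact: H.
Qed.

(** The quadratic bound of [exists_heavy_weight] cancels the square root in the distance; the
    comparison is linear in the coherence, so the decay rate is not halved. *)
Lemma bures_set_le_coherence :
  bures_set rho (pure_states e) <= Num.sqrt (2 * N%:R) * coherence e rho.
Proof.
have [k Hk] := exists_heavy_weight p0 p1.
apply: (le_trans (bures_set_le_bures k)).
have /andP[_ H] := sqrt_bures_bounds p0 p1 k; apply: (le_trans H).
have -> : Num.sqrt (2 * N%:R) * coherence e rho =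
    Num.sqrt (2 * N%:R * coherence e rho ^+ 2).
  by rewrite [RHS]sqrtrM ?mulr_ge0 // sqrtr_sqr ger0_norm ?coherence_ge0.
by rewrite ler_wsqrtr // -mulrA ler_wpM2l.
Qed.

Lemma coherence_le_bures_set : (0 < N)%N ->
  coherence e rho <= N%:R ^+ 2 * bures_set rho (pure_states e).
Proof.
move=> N0; have N2 : 0 < N%:R ^+ 2 :> R by rewrite exprn_gt0 // ltr0n.
rewrite -ler_pdivrMl //; apply: le_bures_set => // k.
rewrite ler_pdivrMl //; apply: (le_trans (double_sum_sqrt_le p0 p1 k)).
apply: ler_wpM2l; first exact: ltW.
by have /andP[] := sqrt_bures_bounds p0 p1 k.
Qed.

Lemma pop_variance_le n : pop e n rho * (1 - pop e n rho) <= coherence e rho.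
Proof. exact: (weight_variance_le p0 p1). Qed.

Lemma pure_state_of_coherence0 : coherence e rho = 0 -> pure_states e rho.
Proof.
move=> c0; have [k Hk] := exists_heavy_weight p0 p1.
exists k => //; symmetry; apply: (eq_pure_of_pop he drho); apply/eqP.
rewrite eq_le (pop_le1 he drho) /= -subr_le0; apply: (le_trans Hk).
by move: c0; rewrite /coherence => ->; rewrite expr0n mulr0.
Qed.

End Bures.

Lemma coherence_pure {R : realType} {N : nat} (e : 'I_N -> 'cV[R[i]]_N) k :
  orthonormal_basis e -> coherence e (pure (e k)) = 0.
Proof.
move=> he; rewrite /coherence big1 // => n _; rewrite big1 // => m _.
case: eqVneq => // nm; rewrite !(pop_pure he).
by have [nk|] := eqVneq n k; rewrite ?mul0r ?sqrtr0 // -nk eq_sym (negbTE nm) mulr0 sqrtr0.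
Qed.

(** * Limits and exponential rates at infinity *)

Section AtInfinity.
Context {R : realType}.
Implicit Types (f : R -> R).

Lemma cvg_pinfty_natP f (l : R) : f t @[t --> +oo] --> l <->
  forall k : nat, exists m : nat, forall t, m%:R <= t -> `|f t - l| <= k.+1%:R^-1.
Proof.
split=> [/cvgrPdist_le H k|H].
  have k0 : 0 < k.+1%:R^-1 :> R by rewrite invr_gt0 ltr0n.
  have [A [_ HA]] := H _ k0; exists (Num.truncn A).+1 => t At.
  by rewrite distrC; apply: HA; apply: lt_le_trans At; exact: truncnS_gt.
apply/cvgrPdist_le => d d0; have [m Hm] := H (Num.truncn d^-1).
exists m%:R; split; first exact: num_real.
move=> t /ltW /Hm; rewrite distrC => /le_trans; apply.
by rewrite invf_ple ?posrE ?ltr0n // ltW // truncnS_gt.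
Qed.

(** From [e^(b t) >= 1 + b t], it suffices that [t] exceed [|K| / (b d)]. *)
Lemma near_exp_decay_le (K b d : R) : 0 < b -> 0 < d ->
  \forall t \near +oo, K * expR (- b * t) <= d.
Proof.
move=> b0 d0; exists (`|K| / (b * d)); split; first exact: num_real.
move=> t; rewrite ltr_pdivrMr ?mulr_gt0 // => Kt.
rewrite mulNr expRN ler_pdivrMr ?expR_gt0 //.
apply: (le_trans (ler_norm K)); apply: (le_trans (ltW Kt)).
rewrite mulrA mulrC ler_wpM2l ?(ltW d0) //; apply: le_trans (expR_ge1Dx _).
by rewrite mulrC lerDr.
Qed.

Lemma dense_fractions (s r : R) : 0 <= s -> 0 < r ->
  exists n j : nat, `|j%:R / n.+1%:R - s| < r.
Proof.
move=> s0 r0; pose n := Num.truncn r^-1; pose j := Num.truncn (s * n.+1%:R).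
exists n, j; have n0 : 0 < n.+1%:R :> R by rewrite ltr0n.
have /andP[j1 j2] : j%:R <= s * n.+1%:R < j.+1%:R.
  by apply: truncn_itv; rewrite mulr_ge0.
have h1 : j%:R / n.+1%:R <= s by rewrite ler_pdivrMr.
have h2 : s < j%:R / n.+1%:R + n.+1%:R^-1.
  by rewrite -[X in _ + X]mul1r -mulrDl natr1 ltr_pdivlMr.
have h3 : n.+1%:R^-1 < r.
  by rewrite invf_plt ?posrE //; exact: truncnS_gt.
by rewrite ler0_norm ?subr_le0 // opprB; apply: lt_trans h3; rewrite ltrBlDl.
Qed.

(** Path continuity reduces the condition for all [t >= m] to the times [m + j / (n + 1)], leaving
    only countable operations on events. *)
Lemma measurable_cvg_pinfty {d : measure_display} {Omega : measurableType d}
    (f : R -> Omega -> R) (l : R) :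
  (forall w, path_cont (f ^~ w)) ->
  (forall t, 0 <= t -> measurable_fun setT (f t)) ->
  measurable [set w | f t w @[t --> +oo] --> l].
Proof.
move=> cf mf; pose tau m n j : R := m%:R + j%:R / n.+1%:R.
have tau0 m n j : 0 <= tau m n j by rewrite addr_ge0 // divr_ge0.
pose A k m n j := [set w | `|f (tau m n j) w - l| <= k.+1%:R^-1].
have mA k m n j : measurable (A k m n j).
  rewrite /A -[X in measurable X]setTI.
  apply: (@measurable_fun_le _ _ _ setT (fun w => `|f (tau m n j) w - l|)
    (fun=> k.+1%:R^-1)) => //.
  apply: measurableT_comp => //; apply: measurable_funB => //; exact: mf.
have -> : [set w | f t w @[t --> +oo] --> l] =
    \bigcap_k \bigcup_m \bigcap_n \bigcap_j A k m n j.
  apply/seteqP; split => w /=.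
    move/cvg_pinfty_natP => H k _; have [m Hm] := H k.
    by exists m => // n _ j _; apply: Hm; rewrite lerDl divr_ge0.
  move=> H; apply/cvg_pinfty_natP => k; have [m _ Hm] := H k I; exists m => t mt.
  rewrite leNgt; apply/negP => lt; have e0 : 0 < `|f t w - l| - k.+1%:R^-1.
    by rewrite subr_gt0.
  have t0 : 0 <= t by apply: le_trans mt.
  have [r r0 Hr] := (path_contP (f ^~ w)).1 (cf w) t t0 _ e0.
  have [||n [j nj]] := @dense_fractions (t - m%:R) r; rewrite ?subr_ge0 //.
  have := Hm n I j I; rewrite /A /= => h1.
  have := Hr _ (tau0 m n j); rewrite /tau => h2.
  have {h2}h2 : `|f (m%:R + j%:R / n.+1%:R) w - f t w| < `|f t w - l| - k.+1%:R^-1.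
    by apply: h2; move: nj; rewrite opprB addrA [_ + m%:R]addrC.
  have := ler_distD (f (m%:R + j%:R / n.+1%:R) w) (f t w) l.
  rewrite [`|f t w - f _ w|]distrC => /le_lt_trans /(_ (ltr_leD h2 h1)).
  by rewrite subrK ltxx.
apply: bigcapT_measurable => k; apply: bigcupT_measurable => m.
by apply: bigcapT_measurable => n; apply: bigcapT_measurable => j.
Qed.

(** Once [f (1 - f) <= 1/8], below its value [1/4] at [f = 1/2], the path cannot cross [1/2]. It
    stays on one side, where one factor is at least [1/2] and the other must vanish in the limit. *)
Lemma cvg_0_or_1 f (K b : R) : path_cont f -> 0 < b ->
  (forall t, 0 <= t -> 0 <= f t <= 1) ->
  (forall t, 0 <= t -> f t * (1 - f t) <= K * expR (- b * t)) ->
  (f t @[t --> +oo] --> (1 : R)) \/ (f t @[t --> +oo] --> (0 : R)).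
Proof.
move=> cf b0 f01 Hf; have e8 : (0 : R) < 8^-1 by rewrite invr_gt0.
have [A0 [_ HA0]] := near_exp_decay_le K b0 e8.
pose A := Num.max A0 0 + 1.
have A0A : A0 < A by rewrite ltr_pwDr // le_max lexx.
have A_ge0 : 0 <= A by rewrite addr_ge0 // le_max lexx orbT.
have nhalf t : A <= t -> f t != 2^-1.
  move=> At; apply/eqP => ft; have := Hf t (le_trans A_ge0 At).
  have := HA0 t (lt_le_trans A0A At); rewrite ft /=; lra.
have side t : A <= t -> (f A < 2^-1) = (f t < 2^-1).
  move=> At; apply: contrapT => /eqP ne.
  have c : {within `[A, t], continuous f}.
    apply: continuous_subspaceW cf => s /=; rewrite !in_itv /= => /andP[h _].
    by rewrite andbT; exact: le_trans h.
  have [|c0] := @IVT R f A t 2^-1 At c.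
    rewrite le_max ge_min; move: ne.
    by case: (ltP (f A) 2^-1) => h1; case: (ltP (f t) 2^-1) => h2 //= _;
      rewrite ?(ltW h1) ?(ltW h2) ?h1 ?h2 ?orbT.
  by rewrite in_itv /= => /andP[h _] /eqP; rewrite (negbTE (nhalf _ h)).
have [fA|fA] := ltP (f A) 2^-1; [right|left].
  apply/cvgrPdist_le => d d0; near=> t.
  have At : A <= t by near: t; apply: nbhs_pinfty_ge; exact: num_real.
  have t0 := le_trans A_ge0 At; have /andP[f0 f1] := f01 t t0.
  have ft : f t < 2^-1 by rewrite -side.
  have H : K * expR (- b * t) <= d / 2.
    by near: t; apply: near_exp_decay_le => //; rewrite divr_gt0.
  have := Hf t t0; rewrite sub0r normrN ger0_norm //; nra.
apply/cvgrPdist_le => d d0; near=> t.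
have At : A <= t by near: t; apply: nbhs_pinfty_ge; exact: num_real.
have t0 := le_trans A_ge0 At; have /andP[f0 f1] := f01 t t0.
have ft : 2^-1 <= f t by rewrite leNgt -side // -leNgt.
have H : K * expR (- b * t) <= d / 2.
  by near: t; apply: near_exp_decay_le => //; rewrite divr_gt0.
have := Hf t t0; rewrite ger0_norm ?subr_ge0 //; nra.
Unshelve. all: end_near. Qed.

(** The quotient is at most [ln C / t - b], and [ln C / t <= d] beyond [T]. Replacing [K] by its
    maximum with 1 keeps the logarithm finite and nonnegative; zeros of [g] are covered by
    monotonicity of [lne]. *)
Lemma limf_esup_lne_exp_decay (g : R -> R) (K b : R) : (forall t, 0 <= g t) ->
  (forall t, 0 <= t -> g t <= K * expR (- b * t)) ->
  (limf_esup (fun t : R => ((t^-1)%:E * lne (g t)%:E)%E) (pinfty_nbhs R) <= (- b)%:E)%E.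
Proof.
move=> g0 Hg; pose C := Num.max K 1.
have C0 : 0 < C by rewrite lt_max ltr01 orbT.
have Hg' t : 0 <= t -> g t <= C * expR (- b * t).
  by move=> /Hg /le_trans; apply; rewrite ler_wpM2r ?expR_ge0 // le_max lexx.
have lnC : 0 <= ln C by rewrite ln_ge0 // le_max lexx orbT.
apply/lee_addgt0Pr => d d0; rewrite -EFinD.
pose T := ln C / d + 1.
have T0 : 0 < T by rewrite ltr_wpDl // divr_ge0 // ltW.
apply: (@le_trans _ _ (ereal_sup ((fun t : R => ((t^-1)%:E * lne (g t)%:E)%E) @`
    [set t | T < t]))).
  apply: ereal_inf_lbound; exists [set t | T < t] => //.
  by exists T; split => //; exact: num_real.
apply: ge_ereal_sup => _ [t /= Tt <-].
have t0 : 0 < t by exact: lt_trans Tt.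
have Ce0 : 0 < C * expR (- b * t) by rewrite mulr_gt0 ?expR_gt0.
apply: (@le_trans _ _ ((t^-1)%:E * (ln C - b * t)%:E)%E).
  apply: lee_wpmul2l; first by rewrite lee_fin invr_ge0 ltW.
  have -> : ln C - b * t = ln (C * expR (- b * t)).
    by rewrite lnM ?posrE ?expR_gt0 // expRK mulNr.
  have : (lne (g t)%:E <= lne (C * expR (- b * t))%:E)%E.
    rewrite lee_lne ?in_itv /= ?leey ?andbT ?lee_fin ?g0 ?(ltW Ce0) //.
    by apply: Hg'; exact: ltW.
  by rewrite (lne_EFin Ce0).
rewrite -EFinM lee_fin mulrBr mulrCA mulVf ?gt_eqF // mulr1 addrC lerD2l.
rewrite mulrC ler_pdivrMr //; move: Tt; rewrite /T => h.
have : ln C / d < t by lra.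
by rewrite ltr_pdivrMr // mulrC => /ltW.
Qed.

End AtInfinity.

Section PureLimit.
Context {R : realType} {N : nat}.
Local Notation C := (R[i] : numFieldType).
Variable e : 'I_N -> 'cV[R[i]]_N.
Hypothesis he : orthonormal_basis e.
Variable x : R -> 'M[R[i]]_N.
Hypothesis dx : forall t, 0 <= t -> density (x t).

Lemma cvg_sumr (K : numFieldType) T (G : set_system T) (FG : Filter G) I
    (s : seq I) (f : I -> T -> K) (l : I -> K) :
  (forall i, f i t @[t --> G] --> l i) ->
  \sum_(i <- s) f i t @[t --> G] --> \sum_(i <- s) l i.
Proof.
by move=> H; apply: cvg_big => [|i _]; [exact: add_continuous|exact: H].
Qed.

Lemma cvg_bilinear_remainder (K : numFieldType) T (G : set_system T)
    (FG : Filter G) (I J : finType) (c : K) (u : I -> K) (v : J -> K)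
    (z : I -> J -> T -> K) : (forall i j, z i j t @[t --> G] --> (0 : K)) ->
  c + \sum_i \sum_j u i * z i j t * v j @[t --> G] --> c.
Proof.
move=> H; have E : c = c + \sum_i \sum_j u i * 0 * v j.
  rewrite big1 ?addr0 // => i _; rewrite big1 // => j _.
  by rewrite mulr0 mul0r.
rewrite [X in _ --> X]E; apply: cvgD; first exact: cvg_cst.
apply: cvg_sumr => i; apply: cvg_sumr => j.
apply: cvgM; last exact: cvg_cst.
by apply: cvgM; [exact: cvg_cst|exact: H].
Qed.

Lemma matel_near_pure_cvg n a b : pop e n (x t) @[t --> +oo] --> (1 : R) ->
  (matel (e a) (e b) (x t - pure (e n)) : C) @[t --> +oo] --> (0 : C).
Proof.
move=> H; apply/cvg_complexP; split; apply/cvgrPdist_le => d d0; near=> t.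
all: have t0 : 0 <= t by near: t; apply: nbhs_pinfty_ge; exact: num_real.
all: have [h1 h2] := matel_near_pure he (dx t0) n a b.
all: have h3 : `|1 - pop e n (x t)| <= d ^+ 2 by near: t; move/cvgrPdist_le: H; apply; rewrite exprn_gt0.
all: have h4 := le_trans (ler_norm _) h3.
all: rewrite sub0r normrN -(@ler_pXn2r _ 2) ?nnegrE ?(ltW d0) // real_normK ?num_real //.
  exact: le_trans h1 h4.
exact: le_trans h2 h4.
Unshelve. all: end_near. Qed.

(** One direction is continuity of the population. Conversely [matel_near_pure] sends all matrix
    elements of the difference to 0, and [basis_expansion] recovers the entries. *)
Lemma path_converges_pure n :
  path_converges x (pure (e n)) <-> pop e n (x t) @[t --> +oo] --> (1 : R).
Proof.
split=> H.
  have -> : (fun t => pop e n (x t)) = (fun t => \sum_k \sum_l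
    (complex.Re (wgt e n k l) * complex.Re (x t k l) +
     - complex.Im (wgt e n k l) * complex.Im (x t k l))).
    by apply/funext => t; rewrite pop_entries.
  have -> : (1 : R) = pop e n (pure (e n)) by rewrite (pop_pure he) eqxx.
  rewrite pop_entries; apply: cvg_sumr => k; apply: cvg_sumr => l.
  move/cvg_mxP: H => /(_ k l) /cvg_complexP [hR hI].
  by apply: cvgD; apply: cvgM => //; exact: cvg_cst.
apply/cvg_mxP => k l.
have -> : (fun t => x t k l : C) = (fun t => pure (e n) k l + \sum_a \sum_b
    e a k 0 * matel (e a) (e b) (x t - pure (e n)) * (e b l 0)^*).
  apply/funext => t; rewrite -(basis_expansion he) !mxE; ring.
apply: (@cvg_bilinear_remainder C _ _ _ _ _ _ (fun a => e a k 0)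
  (fun b => (e b l 0)^*) (fun a b t => matel (e a) (e b) (x t - pure (e n)))).
by move=> a b; exact: matel_near_pure_cvg.
Qed.

End PureLimit.

(** [f] and [g] need not be measurable: the integral is a supremum over simple
    functions below. *)
Lemma le_nonneg_integral {R : realType} {d : measure_display}
    {Omega : measurableType d} (mu : {measure set Omega -> \bar R})
    (f g : Omega -> \bar R) :
  (forall w, 0 <= f w)%E -> (forall w, f w <= g w)%E ->
  (\int[mu]_w f w <= \int[mu]_w g w)%E.
Proof.
move=> f0 fg; have g0 w : (0 <= g w)%E by exact: le_trans (fg w).
rewrite !ge0_integralTE //; apply: le_ereal_sup => _ [h hf <-].
by exists h => // w; exact: le_trans (fg w).
Qed.

(** * Stability and selection of the limit along a solution *)

Section Solution.
Context {R : realType} {d : measure_display} {Omega : measurableType d}.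
Variable P : probability Omega R.
Variable F : R -> set (set Omega).
Hypothesis hF : filtration F.
Variable W : R -> Omega -> R.
Hypothesis hW : standard_wiener P F W.
Variables (N : nat) (e : 'I_N -> 'cV[R[i]]_N).
Hypothesis he : orthonormal_basis e.
Variable Jz : 'M[R[i]]_N.
Hypothesis hJz : is_Jz e Jz.
Variables eta M omega : R.
Hypothesis eta0 : 0 < eta.
Hypothesis M0 : 0 < M.
Variables (rho0 : 'M[R[i]]_N) (X : R -> Omega -> 'M[R[i]]_N).
Hypothesis hX : solution_in P F W (sme_drift omega M Jz) (sme_diffusion eta M Jz)
  density rho0 X.

Let dX t w : 0 <= t -> density (X t w).
Proof. exact: (solution_state hX). Qed.

(** Read off at time 0 on any outcome; one exists because [P] has mass 1. *)
Lemma start_density : density rho0.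
Proof.
have [w _] : exists w : Omega, setT w.
  apply: contrapT => H; have E : [set: Omega] = set0.
    by apply/seteqP; split => // w _; apply: H; exists w.
  by have := probability_setT P; rewrite E measure0 => /eqP; rewrite eq_sym onee_eq0.
by rewrite -(solution_start hX w); exact: dX.
Qed.

Lemma pure_states_absorbing : pure_states e rho0 ->
  {ae P, forall w, forall t, 0 <= t -> pure_states e (X t w)}.
Proof.
move=> [k _ E]; have c0 : coherence e rho0 = 0 by rewrite -E coherence_pure.
have := coherence_ae_zero hF hW he hJz eta0 M0 hX c0.
apply: filterS => w H t t0; apply: (pure_state_of_coherence0 he (dX w t0)).
exact: H.
Qed.

Lemma bures_set_mean t : (0 < N)%N -> 0 <= t ->
  ('E_P[fun w => bures_set (X t w) (pure_states e)] <=
    (Num.sqrt (2 * N%:R) * N%:R ^+ 2 * bures_set rho0 (pure_states e) *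
     expR (- (eta * M / 2) * t))%:E)%E.
Proof.
move=> N0 t0; rewrite unlock.
apply: (@le_trans _ _ (\int[P]_w (Num.sqrt (2 * N%:R) * coherence e (X t w))%:E)%E).
  apply: le_nonneg_integral => w; rewrite lee_fin.
    by apply: le_bures_set => // n; exact: sqrtr_ge0.
  exact: (bures_set_le_coherence he (dX w t0)).
have iV := coherence_integ hF he hX t0.
rewrite -(exE (integZ _ iV)) lee_fin exZ //.
have -> (s q b c : R) : s * q * b * c = s * (c * (q * b)) by ring.
apply: ler_wpM2l; first exact: sqrtr_ge0.
apply: (le_trans (coherence_mean hF hW he hJz eta0 M0 hX t0)).
apply: ler_wpM2l; first exact: expR_ge0.
exact: coherence_le_bures_set start_density N0.
Qed.

Lemma bures_set_lyapunov : (0 < N)%N -> {ae P, forall w,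
  (limf_esup (fun t : R =>
     ((t^-1)%:E * lne (bures_set (X t w) (pure_states e))%:E)%E) (pinfty_nbhs R)
   <= (- (eta * M / 2))%:E)%E}.
Proof.
move=> N0; have := coherence_ae_bounded hF hW he hJz eta0 M0 hX.
apply: filterS => w [K HK].
apply: (@limf_esup_lne_exp_decay _ (fun t => bures_set (X t w) (pure_states e))
  (Num.sqrt (2 * N%:R) * K)).
  by move=> t; apply: le_bures_set => // n; exact: sqrtr_ge0.
move=> t t0; apply: (le_trans (bures_set_le_coherence he (dX w t0))).
by rewrite -[leRHS]mulrA; apply: ler_wpM2l; [exact: sqrtr_ge0|exact: HK].
Qed.

Section Selection.
Variable n : 'I_N.
Let conv := [set w | path_converges (X ^~ w) (pure (e n))].

Let convE : conv = [set w | pop e n (X t w) @[t --> +oo] --> (1 : R)].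
Proof.
apply/seteqP; split => w /= h; apply/(path_converges_pure he (fun t => @dX t w)) => //.
Qed.

Lemma pure_limit_measurable : measurable conv.
Proof.
rewrite convE; apply: (@measurable_cvg_pinfty _ _ _ (fun t w => pop e n (X t w))).
  by move=> w; apply: pop_path_cont; exact: (solution_continuous hX).
by move=> t t0; exact: (fmeas_measurable hF (pop_fmeas hF e hX n t0)).
Qed.

(** Along integer times the population has constant mean and converges almost surely to the
    indicator of [conv]; dominated convergence identifies the two expectations. *)
Lemma pure_limit_probability : P conv = (pop e n rho0)%:E.
Proof.
have mc := pure_limit_measurable.
have iC : integ P (\1_conv : Omega -> R).
  apply: (@integ_bounded _ _ _ P 1); first exact: measurable_indic.
  by move=> w; rewrite indicE; case: (_ \in _); rewrite /= ?normr1 ?normr0.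
rewrite -[conv]setIT -(integral_indic P measurableT mc) -(exE iC); congr EFin.
have lim : ex P (fun w => pop e n (X k%:R w)) @[k --> \oo] --> ex P (\1_conv : Omega -> R).
  apply: (@ex_dominated _ _ _ P 1 (fun k w => pop e n (X k%:R w))).
  - by move=> k; exact: (fmeas_measurable hF (pop_fmeas hF e hX n (ler0n R k))).
  - exact: measurable_indic.
  - move=> k w; have /andP[p0 p1] := pop01 he (dX w (ler0n R k)) n.
    by rewrite ger0_norm.
  have := coherence_ae_bounded hF hW he hJz eta0 M0 hX.
  apply: filterS => w [K HK].
  have b0 : 0 < eta * M / 2 by rewrite divr_gt0 // mulr_gt0.
  have cp : path_cont (fun t => pop e n (X t w)).
    by apply: (@pop_path_cont _ _ e _ (X ^~ w)); exact: (solution_continuous hX).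
  have [||L|L] := cvg_0_or_1 cp b0 (K := K).
  - by move=> t t0; exact: (pop01 he (dX w t0)).
  - by move=> t t0; apply: (le_trans (pop_variance_le he (dX w t0) n)); exact: HK.
  - have -> : \1_conv w = 1 :> R by rewrite indicE mem_set // convE.
    exact: (cvg_comp _ _ (@cvgr_idn R) L).
  have -> : \1_conv w = 0 :> R.
    rewrite indicE memNset // convE => L1.
    have : (1 : R) = 0 := cvg_unique (@Rhausdorff R) L1 L.
    by move=> h; have := oner_neq0 R; rewrite h eqxx.
  exact: (cvg_comp _ _ (@cvgr_idn R) L).
apply: (cvg_unique (@Rhausdorff R) lim); rewrite (_ : (fun k => _) = fun=> pop e n rho0).
  exact: cvg_cst.
by apply/funext => k; rewrite (pop_mean hF hW he hJz hX).
Qed.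

End Selection.

End Solution.
Close Scope complex_scope.
Close Scope sesquilinear_scope.

Theorem theorem5p1 (R : realType) (N : nat) (hN : (2 <= N)%N)
  (e : 'I_N -> 'cV[R[i]]_N) (he : orthonormal_basis e)
  (Jz : 'M[R[i]]_N) (hJz : is_Jz e Jz)
  (eta M omega : R) (heta0 : 0 < eta) (heta1 : eta <= 1) (hM : 0 < M)
  (homega : 0 <= omega)
  (d : measure_display) (Omega : measurableType d) (P : probability Omega R)
  (W : R -> Omega -> R)
  (hW : standard_wiener P (natural_filtration P W) W) :
  let Sol := solution_in P (natural_filtration P W) W
               (sme_drift omega M Jz) (sme_diffusion eta M Jz) density in
  let Ebar := pure_states e in
  [/\ exponentially_stable_in_mean P Sol Ebar,
      almost_surely_exponentially_stable P Sol Ebar,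
      exists2 a : R, 0 < a &
        forall rho0 rho, density rho0 -> Sol rho0 rho ->
        forall t : R, 0 <= t ->
          ('E_P[fun w => bures_set (rho t w) Ebar]
             <= (a * bures_set rho0 Ebar * expR (- (eta * M / 2) * t))%:E)%E,
      forall rho0 rho, density rho0 -> Sol rho0 rho ->
        {ae P, forall w,
          (limf_esup (fun t : R =>
             ((t^-1)%:E * lne (bures_set (rho t w) Ebar)%:E)%E) (pinfty_nbhs R)
           <= (- (eta * M / 2))%:E)%E}
    & forall rho0 rho, density rho0 -> Sol rho0 rho ->
        forall n : 'I_N,
          let conv := [set w | path_converges (rho ^~ w) (pure (e n))] in
          measurable conv /\
          P conv = (complex.Re (\tr (rho0 *m pure (e n))))%:E].
Proof.
move=> Sol Ebar; have N0 : (0 < N)%N by exact: ltn_trans hN.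
have hF := natural_filtration_filtration P (wiener_measurable hW).
have b0 : 0 < eta * M / 2 by rewrite divr_gt0 // mulr_gt0.
(* The factor [N^2] bounds the initial coherence by the distance, and [sqrt (2 N)] bounds the
   distance at time [t] by the coherence. *)
have a0 : 0 < Num.sqrt (2 * N%:R) * N%:R ^+ 2 :> R.
  by rewrite mulr_gt0 ?sqrtr_gt0 ?exprn_gt0 ?mulr_gt0 ?ltr0n.
have inv : invariant_set P Sol Ebar.
  move=> rho0 rho E hX; exact: (pure_states_absorbing hF hW he hJz heta0 hM hX E).
have mean : mean_bound P Sol Ebar (Num.sqrt (2 * N%:R) * N%:R ^+ 2) (eta * M / 2).
  by move=> rho0 rho _ hX t t0; exact: (bures_set_mean hF hW he hJz heta0 hM hX N0 t0).
have lyap rho0 rho : Sol rho0 rho -> {ae P, forall w,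
    (sample_lyapunov Ebar (rho ^~ w) <= (- (eta * M / 2))%:E)%E}.
  by move=> hX; exact: (bures_set_lyapunov hF hW he hJz heta0 hM hX N0).
split.
- by split => //; exists (Num.sqrt (2 * N%:R) * N%:R ^+ 2), (eta * M / 2).
- split => // rho0 rho _ /lyap; apply: filterS => w /le_lt_trans; apply.
  by rewrite lte_fin oppr_lt0.
- by exists (Num.sqrt (2 * N%:R) * N%:R ^+ 2).
- by move=> rho0 rho _ /lyap.
move=> rho0 rho _ hX n conv; split; first exact: (pure_limit_measurable hF he hX).
exact: (pure_limit_probability hF hW he hJz heta0 hM hX).
Qed.
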